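(* For any Dynkin diagram $\Delta$ and any set $J$ of vertices of $\Delta$, there exists a pair $(A,e)$, with $A$ a $\mathbb C[[t]]$-order and $e\in A$ an idempotent, which models $(\Delta,J)$.
   Context: $R=\mathbb C[[t]]$, $K=\mathbb C((t))$; $\Delta$ is simply laced. An $R$-order is an $R$-algebra free of finite rank as an $R$-module; modules are finitely generated left modules. $\operatorname{CM}A$: $A$-modules free of finite rank over $R$; $\operatorname{mod}_eA=\{X\in\operatorname{mod}A\mid eX\in\operatorname{proj}(eAe)\}$, $\operatorname{CM}_eA=\operatorname{CM}A\cap\operatorname{mod}_eA$, exact categories with structure induced from $\operatorname{mod}A$; $\operatorname{Ext}^2_{\operatorname{mod}_eA}$ is Yoneda Ext in the exact category $\operatorname{mod}_eA$. $\Pi=\Pi(\Delta)$ is the preprojective algebra over $\mathbb C$, $g\in\Pi$ the idempotent corresponding to $J$, $I_J:=\operatorname{Hom}_\Pi(\Pi/(g),\Pi)$, the biggest ideal of $\Pi$ with $gI_J=0$. $Q_J$ is the direct sum of the indecomposable injective $\Pi$-modules corresponding to (i.e. with socle the simple $S_j$ at) the vertices $j\in J$; it is also an injective $\Pi/I_J$-module. For $X\in\operatorname{CM}A$, $\operatorname{corad}X$ is the largest $A$-submodule $Y$ of $X\otimes_RK$ with $X\subset Y$ and $Y/X$ semisimple; $\operatorname{cotop}X=(\operatorname{corad}X)/X$; for $B=A/(e)$, $B\text{-}\operatorname{cotop}X:=\operatorname{Hom}_A(B,\operatorname{cotop}X)$, the largest $B$-module contained in $\operatorname{cotop}X$. $\operatorname{ind}M$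 is the set of isomorphism classes of indecomposable direct summands of $M$. The pair $(A,e)$ models $(\Delta,J)$ if: (i) $B:=A/(e)\cong\Pi/I_J$ as $\mathbb C$-algebras; (ii) $\operatorname{Ext}^1_A(X,Ae)=0$ for all $X\in\operatorname{CM}_eA$ and $\operatorname{Ext}^2_{\operatorname{mod}_eA}(X,Ae)=0$ for all $X\in\operatorname{mod}_eA$; (iii) $B\text{-}\operatorname{cotop}$ induces a bijection from $\operatorname{ind}Ae$ to $\operatorname{ind}(\operatorname{soc}Q_J)$. *)

(* Defs.v *)
From Stdlib Require Relation_Operators.
From HB Require Import structures.
From mathcomp Require Import all_boot all_algebra.
From mathcomp Require Import boolp reals complex.

Set Implicit Arguments.
Unset Strict Implicit.
Unset Printing Implicit Defensive.

Import GRing.Theory.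
Local Open Scope ring_scope.
Local Open Scope quotient_scope.

Record fps (k : Type) := Fps { fps_coef : nat -> k }.

HB.instance Definition _ (k : Type) := gen_eqMixin (fps k).
HB.instance Definition _ (k : Type) := gen_choiceMixin (fps k).

Section PowerSeries.
Variable k : fieldType.
Implicit Types f g h : fps k.

Lemma fpsP f g : fps_coef f =1 fps_coef g -> f = g.
Proof. by case: f; case: g => f g /= /funext ->. Qed.

Definition fps_zero : fps k := Fps (fun _ => 0).
Definition fps_add f g : fps k := Fps (fun n => fps_coef f n + fps_coef g n).
Definition fps_opp f : fps k := Fps (fun n => - fps_coef f n).
Definition fpsC (c : k) : fps k := Fps (fun n => if n is 0%N then c else 0).
Definition fps_mul f g : fps k :=
  Fps (fun n => \sum_(i < n.+1) fps_coef f i * fps_coef g (n - i)).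

Fact fps_addA : associative fps_add.
Proof. by move=> f g h; apply: fpsP => n /=; rewrite addrA. Qed.
Fact fps_addC : commutative fps_add.
Proof. by move=> f g; apply: fpsP => n /=; rewrite addrC. Qed.
Fact fps_add0 : left_id fps_zero fps_add.
Proof. by move=> f; apply: fpsP => n /=; rewrite add0r. Qed.
Fact fps_addN : left_inverse fps_zero fps_opp fps_add.
Proof. by move=> f; apply: fpsP => n /=; rewrite addNr. Qed.
HB.instance Definition _ :=
  GRing.isZmodule.Build (fps k) fps_addA fps_addC fps_add0 fps_addN.

Let trunc n f : {poly k} := \poly_(i < n) fps_coef f i.

Lemma trunc_mul n m f g : (m < n)%N ->
  fps_coef (fps_mul f g) m = (trunc n f * trunc n g)`_m.
Proof.
move=> ltmn; rewrite coefM /=; apply: eq_bigr => i _.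
rewrite !coef_poly (leq_ltn_trans _ ltmn) ?(leq_ltn_trans _ ltmn) ?leq_subr //.
by rewrite -ltnS.
Qed.

Fact fps_mulA : associative fps_mul.
Proof.
move=> f g h; apply: fpsP => n.
transitivity ((trunc n.+1 f * trunc n.+1 g * trunc n.+1 h)`_n).
  rewrite -mulrA coefM; apply: eq_bigr => i _.
  rewrite coef_poly ltn_ord; congr (_ * _).
  by apply: trunc_mul; rewrite ltnS leq_subr.
rewrite coefM; apply: eq_bigr => i _.
rewrite [X in _ * X]coef_poly ltnS leq_subr; congr (_ * _).
by symmetry; apply: trunc_mul.
Qed.
Fact fps_mulC : commutative fps_mul.
Proof.
by move=> f g; apply: fpsP => n; rewrite !(@trunc_mul n.+1) // mulrC.
Qed.
Fact fps_mul1 : left_id (fpsC 1) fps_mul.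
Proof.
move=> f; apply: fpsP => n /=; rewrite big_ord_recl /= mul1r subn0.
by rewrite big1 ?addr0 // => i _; rewrite mul0r.
Qed.
Fact fps_mulDl : left_distributive fps_mul fps_add.
Proof.
move=> f g h; apply: fpsP => n /=; rewrite -big_split /=.
by apply: eq_bigr => i _; rewrite mulrDl.
Qed.
Fact fps_1neq0 : fpsC 1 != 0.
Proof.
by apply/eqP => /(congr1 (fun f => fps_coef f 0)) /eqP /=; rewrite oner_eq0.
Qed.
HB.instance Definition _ := GRing.Zmodule_isComNzRing.Build (fps k)
  fps_mulA fps_mulC fps_mul1 fps_mulDl fps_1neq0.

Definition fps_unit : {pred fps k} := fun f => `[< exists g, g * f = 1 >].
Definition fps_inv f : fps k :=
  match pselect (exists g, g * f = 1) with
  | left ex => sval (cid ex)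
  | right _ => f
  end.
Fact fps_mulVr : {in fps_unit, left_inverse 1 fps_inv *%R}.
Proof.
move=> f /asboolP ex; rewrite /fps_inv; case: pselect => // ex'.
exact: (svalP (cid ex')).
Qed.
Fact fps_unitPl f g : g * f = 1 -> fps_unit f.
Proof. by move=> gf; apply/asboolP; exists g. Qed.
Fact fps_inv_out : {in [predC fps_unit], fps_inv =1 id}.
Proof.
by move=> f /asboolP nex; rewrite /fps_inv; case: pselect.
Qed.
HB.instance Definition _ := GRing.ComNzRing_hasMulInverse.Build (fps k)
  fps_mulVr fps_unitPl fps_inv_out.

Fact fps_integral (f g : fps k) : f * g = 0 -> (f == 0) || (g == 0).
Proof.
move=> fg0; apply/orP; apply: contrapT => nz.
have coef_neq0 h : h != 0 -> exists n, fps_coef h n != 0.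
  move=> h0; apply: contrapT => nex; case/eqP: h0; apply: fpsP => n.
  by apply: contrapT => /eqP hn; apply: nex; exists n.
have [f0 g0] : f != 0 /\ g != 0.
  by split; apply/negP => h0; apply: nz; [left | right].
have [m fm mmin] := ex_minnP (coef_neq0 f f0).
have [n gn nmin] := ex_minnP (coef_neq0 g g0).
have : fps_coef (f * g) (m + n) = 0 by rewrite fg0.
have lem : (m < (m + n).+1)%N by rewrite ltnS leq_addr.
rewrite /= (bigD1 (Ordinal lem)) //= addKn big1 ?addr0 => [/eqP|i neq].
  by rewrite mulf_eq0 (negPf fm) (negPf gn).
have [ltim|ltmi|eqim] := ltngtP i m.
- have /eqP-> : fps_coef f i == 0; last by rewrite mul0r.
  by apply: contraLR ltim => /mmin; rewrite -leqNgt.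
- have /eqP-> : fps_coef g (m + n - i) == 0; last by rewrite mulr0.
  apply: contraLR ltmi => /nmin; rewrite -leqNgt => le.
  have := ltn_ord i; rewrite ltnS => leimn.
  by rewrite -(leq_add2r n) -leq_subRL.
- by case/eqP: neq; apply: val_inj.
Qed.
HB.instance Definition _ := GRing.ComUnitRing_isIntegral.Build (fps k)
  fps_integral.

Fact fpsC_zmod : zmod_morphism fpsC.
Proof. by move=> c d; apply: fpsP => -[|n] //=; rewrite subr0. Qed.
Fact fpsC_monoid : monoid_morphism fpsC.
Proof.
split=> // c d; apply: fpsP => -[|n] /=.
  by rewrite big_ord1.
rewrite big1 // => -[[|i] lti] _ /=; last by rewrite mul0r.
by rewrite mulr0.
Qed.
HB.instance Definition _ := GRing.isZmodMorphism.Build k (fps k) fpsC fpsC_zmod.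
HB.instance Definition _ :=
  GRing.isMonoidMorphism.Build k (fps k) fpsC fpsC_monoid.

End PowerSeries.

(* Rings may be zero here: MathComp's algType excludes the zero algebra, which
   occurs for the empty set of vertices. *)
Record algebra (k : comPzRingType) := Algebra {
  alg_sort :> pzRingType;
  alg_struct : {rmorphism k -> alg_sort};
  alg_central : forall c x, alg_struct c * x = x * alg_struct c
}.

HB.mixin Record isIdeal (A : pzRingType) (I : {pred A}) := {
  idealMl : forall a x, x \in I -> a * x \in I;
  idealMr : forall a x, x \in I -> x * a \in I
}.
#[short(type="ideal")]
HB.structure Definition Ideal (A : pzRingType) :=
  {I of GRing.ZmodClosed A I & isIdeal A I}.

Definition gen_ideal (A : pzRingType) (P : A -> Prop) : {pred A} :=
  [pred x | `[< forall I : ideal A, (forall y, P y -> y \in I) -> x \in I >]].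

Section GenIdeal.
Variables (A : pzRingType) (P : A -> Prop).
Fact gen_ideal_zmod : zmod_closed (gen_ideal P).
Proof.
split; first by apply/asboolP => I _; apply: rpred0.
move=> x y /asboolP xI /asboolP yI; apply/asboolP => I PI.
by apply: rpredB; [apply: xI | apply: yI].
Qed.
Fact gen_idealMl a x : x \in gen_ideal P -> a * x \in gen_ideal P.
Proof.
by move=> /asboolP xI; apply/asboolP => I PI; apply: idealMl; apply: xI.
Qed.
Fact gen_idealMr a x : x \in gen_ideal P -> x * a \in gen_ideal P.
Proof.
by move=> /asboolP xI; apply/asboolP => I PI; apply: idealMr; apply: xI.
Qed.
HB.instance Definition _ :=
  GRing.isZmodClosed.Build A (gen_ideal P) gen_ideal_zmod.
HB.instance Definition _ :=
  isIdeal.Build A (gen_ideal P) gen_idealMl gen_idealMr.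
End GenIdeal.

Definition principal_ideal (A : pzRingType) (a : A) : ideal A :=
  gen_ideal (fun x => x = a).

Definition quot_ring (A : pzRingType) (I : ideal A) : Type := ring_quotient.Quotient.quot I.

Section QuotRing.
Variables (A : pzRingType) (I : ideal A).
Local Notation Q := (quot_ring I).
HB.instance Definition _ := GRing.Zmodule.on Q.

Definition quot_pi (x : A) : Q := \pi_(ring_quotient.Quotient.quot I) x.

Lemma quot_piP x y : quot_pi x = quot_pi y <-> x - y \in I.
Proof. by rewrite ring_quotient.Quotient.idealrBE; split => [/eqP|/eqP]. Qed.
Lemma quot_pi_zmod : zmod_morphism quot_pi.
Proof. exact: ring_quotient.pi_is_zmod_morphism. Qed.
HB.instance Definition _ := GRing.isZmodMorphism.Build A Q quot_pi quot_pi_zmod.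
Lemma quot_repr (u : Q) : quot_pi (repr u) = u.
Proof. exact: reprK. Qed.

Definition quot_mul (u v : Q) : Q := quot_pi (repr u * repr v).

Lemma quot_piM x y : quot_pi (x * y) = quot_mul (quot_pi x) (quot_pi y).
Proof.
apply/quot_piP; set x' := repr _; set y' := repr _.
have -> : x * y - x' * y' = (x - x') * y + x' * (y - y').
  by rewrite mulrBl mulrBr addrA subrK.
apply: rpredD; [apply: idealMr | apply: idealMl]; apply/quot_piP;
  by rewrite quot_repr.
Qed.
Fact quot_mulA : associative quot_mul.
Proof.
move=> u v w; rewrite -[u]quot_repr -[v]quot_repr -[w]quot_repr.
by rewrite -!quot_piM mulrA.
Qed.
Fact quot_mul1 : left_id (quot_pi 1) quot_mul.
Proof. by move=> u; rewrite -[u]quot_repr -quot_piM mul1r. Qed.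
Fact quot_1mul : right_id (quot_pi 1) quot_mul.
Proof. by move=> u; rewrite -[u]quot_repr -quot_piM mulr1. Qed.
Fact quot_mulDl : left_distributive quot_mul +%R.
Proof.
move=> u v w; rewrite -[u]quot_repr -[v]quot_repr -[w]quot_repr.
by rewrite -raddfD -!quot_piM mulrDl raddfD.
Qed.
Fact quot_mulDr : right_distributive quot_mul +%R.
Proof.
move=> u v w; rewrite -[u]quot_repr -[v]quot_repr -[w]quot_repr.
by rewrite -raddfD -!quot_piM mulrDr raddfD.
Qed.
HB.instance Definition _ := GRing.Zmodule_isPzRing.Build Q
  quot_mulA quot_mul1 quot_1mul quot_mulDl quot_mulDr.
Fact quot_pi_monoid : monoid_morphism quot_pi.
Proof. by split=> // x y; rewrite quot_piM. Qed.
HB.instance Definition _ :=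
  GRing.isMonoidMorphism.Build A Q quot_pi quot_pi_monoid.
End QuotRing.

Section QuotAlg.
Variables (k : comPzRingType) (A : algebra k) (I : ideal A).
Fact quot_alg_central c (u : quot_ring I) :
  quot_pi I (alg_struct A c) * u = u * quot_pi I (alg_struct A c).
Proof. by rewrite -[u]quot_repr -!rmorphM alg_central. Qed.
Definition quot_alg : algebra k :=
  @Algebra k (quot_ring I) (quot_pi I \o alg_struct A) quot_alg_central.
End QuotAlg.

Record idem (A : pzRingType) := Idem {
  idem_val :> A;
  idemP : idem_val * idem_val = idem_val
}.

(* The ring eAe = {x | e x e = x}, with unit e. *)
Record corner (A : pzRingType) (e : idem A) := Corner {
  corner_val : A;
  cornerP : idem_val e * corner_val * idem_val e = corner_val
}.
HB.instance Definition _ (A : pzRingType) (e : idem A) :=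
  gen_eqMixin (corner e).
HB.instance Definition _ (A : pzRingType) (e : idem A) :=
  gen_choiceMixin (corner e).

Section Corner.
Variables (A : pzRingType) (e : idem A).
Local Notation C := (corner e).
Local Notation ev := (idem_val e).
Implicit Types x y z : C.

Lemma corner_val_inj : injective (@corner_val A e).
Proof. by case=> x Px [y Py] /= xy; subst y; rewrite (Prop_irrelevance Px Py). Qed.
Lemma corner_idl x : ev * corner_val x = corner_val x.
Proof. by rewrite -(cornerP x) !mulrA idemP. Qed.
Lemma corner_idr x : corner_val x * ev = corner_val x.
Proof. by rewrite -(cornerP x) -!mulrA idemP. Qed.
Fact corner_0P : ev * 0 * ev = 0. Proof. by rewrite mulr0 mul0r. Qed.
Fact corner_1P : ev * ev * ev = ev. Proof. by rewrite !idemP. Qed.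
Fact corner_addP x y :
  ev * (corner_val x + corner_val y) * ev = corner_val x + corner_val y.
Proof. by rewrite mulrDr mulrDl !cornerP. Qed.
Fact corner_oppP x : ev * (- corner_val x) * ev = - corner_val x.
Proof. by rewrite mulrN mulNr cornerP. Qed.
Fact corner_mulP x y :
  ev * (corner_val x * corner_val y) * ev = corner_val x * corner_val y.
Proof. by rewrite mulrA corner_idl -mulrA corner_idr. Qed.

Definition corner_zero : C := Corner corner_0P.
Definition corner_one : C := Corner corner_1P.
Definition corner_add x y : C := Corner (corner_addP x y).
Definition corner_opp x : C := Corner (corner_oppP x).
Definition corner_mul x y : C := Corner (corner_mulP x y).

Fact corner_addA : associative corner_add.
Proof. by move=> x y z; apply: corner_val_inj; rewrite /= addrA. Qed.
Fact corner_addC : commutative corner_add.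
Proof. by move=> x y; apply: corner_val_inj; rewrite /= addrC. Qed.
Fact corner_add0 : left_id corner_zero corner_add.
Proof. by move=> x; apply: corner_val_inj; rewrite /= add0r. Qed.
Fact corner_addN : left_inverse corner_zero corner_opp corner_add.
Proof. by move=> x; apply: corner_val_inj; rewrite /= addNr. Qed.
Fact corner_mulA : associative corner_mul.
Proof. by move=> x y z; apply: corner_val_inj; rewrite /= mulrA. Qed.
Fact corner_mul1 : left_id corner_one corner_mul.
Proof. by move=> x; apply: corner_val_inj; rewrite /= corner_idl. Qed.
Fact corner_1mul : right_id corner_one corner_mul.
Proof. by move=> x; apply: corner_val_inj; rewrite /= corner_idr. Qed.
Fact corner_mulDl : left_distributive corner_mul corner_add.
Proof. by move=> x y z; apply: corner_val_inj; rewrite /= mulrDl. Qed.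
Fact corner_mulDr : right_distributive corner_mul corner_add.
Proof. by move=> x y z; apply: corner_val_inj; rewrite /= mulrDr. Qed.
HB.instance Definition _ := GRing.isPzRing.Build C
  corner_addA corner_addC corner_add0 corner_addN
  corner_mulA corner_mul1 corner_1mul corner_mulDl corner_mulDr.
End Corner.

Definition submod (A : pzRingType) (V : lmodType A) (S : submodClosed V) : Type :=
  {x : V | x \in S}.

Section Submodule.
Variables (A : pzRingType) (V : lmodType A) (S : submodClosed V).
HB.instance Definition _ := SubChoice.on (submod S).
Fact submod_subproof : GRing.subsemimod_closed S.
Proof. by split; [split; [exact: rpred0 | exact: rpredD] | exact: rpredZ]. Qed.
HB.instance Definition _ :=
  GRing.SubChoice_isSubLmodule.Build A V (mem S) (submod S) submod_subproof.
End Submodule.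

Section PropSubmodules.
Variables (A : pzRingType) (V : lmodType A).

Definition gen_submod (P : V -> Prop) : {pred V} :=
  [pred x | `[< forall S : submodClosed V, (forall y, P y -> y \in S) ->
                  x \in S >]].
Fact gen_submod_closed P : GRing.subsemimod_closed (gen_submod P).
Proof.
split; [split=> [|x y /asboolP xS /asboolP yS]|move=> a x /asboolP xS];
  apply/asboolP => S PS; first exact: rpred0.
- by apply: rpredD; [apply: xS | apply: yS].
- by apply: rpredZ; apply: xS.
Qed.
HB.instance Definition _ P :=
  GRing.isSubmodClosed.Build A V (gen_submod P) (gen_submod_closed P).

(* The trace of T on S, as a submodule of the module S. *)
Definition submod_inter (S T : submodClosed V) : {pred submod S} :=
  [pred x | val x \in T].
Arguments submod_inter : clear implicits.
Fact submod_inter_closed S T : GRing.subsemimod_closed (submod_inter S T).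
Proof.
split; [split=> [|x y xT yT]|move=> a x xT]; rewrite inE /=.
- by rewrite rpred0.
- by rewrite rpredD.
- by rewrite rpredZ.
Qed.
HB.instance Definition _ S T := GRing.isSubmodClosed.Build A (submod S)
  (submod_inter S T) (submod_inter_closed S T).

(* MathComp does not make a submodClosed predicate a zmodClosed one. *)
Definition zmod_of_submod (S : submodClosed V) : {pred V} := S.
Arguments zmod_of_submod : clear implicits.
Fact zmod_of_submod_closed S : zmod_closed (zmod_of_submod S).
Proof. exact: GRing.submod_closedB (submodClosedP S). Qed.
HB.instance Definition _ S :=
  GRing.isZmodClosed.Build V (zmod_of_submod S) (zmod_of_submod_closed S).

Definition quot_mod (S : submodClosed V) : Type :=
  ring_quotient.Quotient.quot (zmod_of_submod S).
HB.instance Definition _ S := GRing.Zmodule.on (quot_mod S).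

Section QuotMod.
Variable S : submodClosed V.
Definition mod_pi (x : V) : quot_mod S :=
  \pi_(ring_quotient.Quotient.quot (zmod_of_submod S)) x.

Lemma mod_piP x y : mod_pi x = mod_pi y <-> x - y \in S.
Proof.
have -> : (x - y \in S) = (x - y \in zmod_of_submod S) by [].
by rewrite ring_quotient.Quotient.idealrBE; split => [/eqP|/eqP].
Qed.
Fact mod_pi_zmod : zmod_morphism mod_pi.
Proof. exact: ring_quotient.pi_is_zmod_morphism. Qed.
HB.instance Definition _ :=
  GRing.isZmodMorphism.Build V (quot_mod S) mod_pi mod_pi_zmod.
Lemma mod_repr (u : quot_mod S) : mod_pi (repr u) = u.
Proof. exact: reprK. Qed.

Definition quot_scale (a : A) (u : quot_mod S) : quot_mod S :=
  mod_pi (a *: repr u).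
Lemma mod_piZ a x : mod_pi (a *: x) = quot_scale a (mod_pi x).
Proof.
by apply/mod_piP; rewrite -scalerBr; apply: rpredZ; apply/mod_piP;
  rewrite mod_repr.
Qed.
Fact quot_scaleA a b u : quot_scale a (quot_scale b u) = quot_scale (a * b) u.
Proof. by rewrite -[u]mod_repr -!mod_piZ scalerA. Qed.
Fact quot_scale1 : left_id 1 quot_scale.
Proof. by move=> u; rewrite -[u]mod_repr -!mod_piZ scale1r. Qed.
Fact quot_scaleDr : right_distributive quot_scale +%R.
Proof.
move=> a u v; rewrite -[u]mod_repr -[v]mod_repr -raddfD -!mod_piZ.
by rewrite scalerDr raddfD.
Qed.
Fact quot_scaleDl u : {morph quot_scale^~ u : a b / a + b}.
Proof. by move=> a b; rewrite -[u]mod_repr -!mod_piZ scalerDl raddfD. Qed.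
HB.instance Definition _ := GRing.Zmodule_isLmodule.Build A (quot_mod S)
  quot_scaleA quot_scale1 quot_scaleDr quot_scaleDl.
Fact mod_pi_scalable : scalable mod_pi.
Proof. by move=> a x; rewrite mod_piZ. Qed.
HB.instance Definition _ :=
  GRing.isScalable.Build A V (quot_mod S) _ mod_pi mod_pi_scalable.
End QuotMod.

End PropSubmodules.
Arguments submod_inter {A V} S T x.

Section Subquotients.
Variables (A : pzRingType) (V : lmodType A).

(* S / (S \cap T); used when T is contained in S. *)
Definition subquot (S T : submodClosed V) : lmodType A :=
  quot_mod (submod_inter S T).

Definition simple_submod (S : submodClosed V) :=
  (exists2 x, x \in S & x != 0) /\
  (forall T : submodClosed V, {subset T <= S} ->
     (forall x, x \in T -> x = 0) \/ {subset S <= T}).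

Definition soc : submodClosed V :=
  gen_submod (fun x => exists2 S, simple_submod S & x \in S).

Definition semisimple := forall x : V, x \in soc.

(* Hom_A(A/I, V), by evaluation at 1. *)
Definition ann_by (I : ideal A) : {pred V} :=
  [pred x | `[< forall b, b \in I -> b *: x = 0 >]].
Fact ann_by_closed I : GRing.subsemimod_closed (ann_by I).
Proof.
split; [split=> [|x y /asboolP xI /asboolP yI]|move=> a x /asboolP xI];
  apply/asboolP => b bI.
- by rewrite scaler0.
- by rewrite scalerDr xI ?yI ?addr0.
- by rewrite scalerA; apply: xI; apply: idealMr.
Qed.
HB.instance Definition _ I :=
  GRing.isSubmodClosed.Build A V (ann_by I) (ann_by_closed I).

End Subquotients.
Arguments ann_by {A} V I.

Section HomologicalNotions.
Variable A : pzRingType.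
Implicit Types M N P X Y Z : lmodType A.

Definition surjective (T U : Type) (f : T -> U) := forall y, exists x, f x = y.

Definition lin_iso M N := exists f : {linear M -> N}, bijective f.

Definition short_exact X Y Z (i : {linear X -> Y}) (p : {linear Y -> Z}) :=
  [/\ injective i, surjective p & forall y, p y = 0 <-> exists x, i x = y].

Definition fin_gen M := exists (n : nat) (b : 'I_n -> M),
  forall x, exists c : 'I_n -> A, x = \sum_i c i *: b i.

Definition projective M :=
  forall N P (p : {linear N -> P}) (f : {linear M -> P}), surjective p ->
  exists g : {linear M -> N}, forall x, p (g x) = f x.

Definition injective_mod M :=
  forall N P (i : {linear N -> P}) (f : {linear N -> M}), injective i ->
  exists g : {linear P -> M}, forall x, g (i x) = f x.

Definition proj M := fin_gen M /\ projective M.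

Definition zero_mod M := forall x : M, x = 0.

Definition indecomposable M :=
  ~ zero_mod M /\
  (forall N P, lin_iso M (N * P)%type -> zero_mod N \/ zero_mod P).

(* The class of X belongs to ind M. *)
Definition ind M X := indecomposable X /\ exists Y, lin_iso M (X * Y)%type.

(* Yoneda extensions of X by Y whose middle terms are in the full subcategory
   C, with the exact structure induced from the category of A-modules. *)
Section Yoneda.
Variables (C : lmodType A -> Prop) (X Y : lmodType A).

Record ext1 := Ext1 {
  ext1_mid : lmodType A;
  ext1_inj : {linear Y -> ext1_mid};
  ext1_proj : {linear ext1_mid -> X};
  _ : C ext1_mid;
  _ : short_exact ext1_inj ext1_proj
}.
Definition ext1_hom (E F : ext1) :=
  exists2 f : {linear ext1_mid E -> ext1_mid F},
    forall y, f (ext1_inj E y) = ext1_inj F y &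
    forall x, ext1_proj F (f x) = ext1_proj E x.

(* 0 -> Y -> ext2_left -> ext2_right -> X -> 0, spliced at ext2_mid. *)
Record ext2 := Ext2 {
  ext2_left : lmodType A;
  ext2_mid : lmodType A;
  ext2_right : lmodType A;
  ext2_inj : {linear Y -> ext2_left};
  ext2_lproj : {linear ext2_left -> ext2_mid};
  ext2_rinj : {linear ext2_mid -> ext2_right};
  ext2_proj : {linear ext2_right -> X};
  _ : [/\ C ext2_left, C ext2_mid & C ext2_right];
  _ : short_exact ext2_inj ext2_lproj;
  _ : short_exact ext2_rinj ext2_proj
}.
Definition ext2_hom (E F : ext2) :=
  exists f : {linear ext2_left E -> ext2_left F},
  exists h : {linear ext2_mid E -> ext2_mid F},
  exists g : {linear ext2_right E -> ext2_right F},
  [/\ forall y, f (ext2_inj E y) = ext2_inj F y,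
      forall x, ext2_lproj F (f x) = h (ext2_lproj E x),
      forall z, g (ext2_rinj E z) = ext2_rinj F (h z) &
      forall x, ext2_proj F (g x) = ext2_proj E x].

(* The set of classes, modulo the equivalence relation generated by morphisms
   fixing both ends, always contains the class 0. *)
Definition Ext1_eq0 := forall E F,
  Relation_Operators.clos_refl_sym_trans ext1 ext1_hom E F.
Definition Ext2_eq0 := forall E F,
  Relation_Operators.clos_refl_sym_trans ext2 ext2_hom E F.
End Yoneda.
End HomologicalNotions.

(* eX = {x | e x = x}, as a module over eAe. *)
Section CornerMod.
Variables (A : pzRingType) (e : idem A) (X : lmodType A).
Definition corner_pred : {pred X} := [pred x | idem_val e *: x == x].
Definition corner_mod : Type := {x : X | x \in corner_pred}.
Fact corner_mod_zmod : zmod_closed corner_pred.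
Proof.
split=> [|x y]; rewrite !inE ?scaler0 // => /eqP ex /eqP ey.
by rewrite scalerBr ex ey.
Qed.
HB.instance Definition _ := SubChoice.on corner_mod.
HB.instance Definition _ := GRing.SubChoice_isSubZmodule.Build X corner_pred
  corner_mod corner_mod_zmod.
Fact corner_scaleP (a : corner e) (x : corner_mod) :
  corner_val a *: val x \in corner_pred.
Proof. by rewrite inE scalerA corner_idl. Qed.
Definition corner_scale (a : corner e) (x : corner_mod) : corner_mod :=
  exist (fun x => x \in corner_pred) _ (corner_scaleP a x).
Fact corner_scaleA a b x :
  corner_scale a (corner_scale b x) = corner_scale (a * b) x.
Proof. by apply: val_inj; rewrite /= scalerA. Qed.
Fact corner_scale1 : left_id 1 corner_scale.
Proof. by move=> x; apply: val_inj => /=; apply/eqP; apply: (valP x). Qed.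
Fact corner_scaleDr : right_distributive corner_scale +%R.
Proof. by move=> a x y; apply: val_inj; rewrite /= scalerDr. Qed.
Fact corner_scaleDl x : {morph corner_scale^~ x : a b / a + b}.
Proof. by move=> a b; apply: val_inj; rewrite /= scalerDl. Qed.
HB.instance Definition _ := GRing.Zmodule_isLmodule.Build (corner e) corner_mod
  corner_scaleA corner_scale1 corner_scaleDr corner_scaleDl.
End CornerMod.

Section LeftIdeal.
Variables (A : pzRingType) (a : A).
Definition left_ideal : {pred A^o} := [pred x | `[< exists b : A, x = b * a >]].
Fact left_ideal_closed : GRing.subsemimod_closed left_ideal.
Proof.
split; [split=> [|x y /asboolP[b ->] /asboolP[c ->]]|move=> d x /asboolP[b ->]];
  apply/asboolP.
- by exists 0; rewrite mul0r.
- by exists (b + c); rewrite mulrDl.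
- by exists (d * b); rewrite -mulrA.
Qed.
HB.instance Definition _ :=
  GRing.isSubmodClosed.Build A A^o left_ideal left_ideal_closed.
End LeftIdeal.

Section Orders.
Variables (R : idomainType) (A : algebra R).
Implicit Types X : lmodType A.

Definition free_of_finite_rank X := exists (n : nat) (b : 'I_n -> X),
  forall x, exists! c : {ffun 'I_n -> R}, x = \sum_i alg_struct A (c i) *: b i.

Definition is_order := free_of_finite_rank A^o.

Definition CM X := free_of_finite_rank X.

Definition mod_ (e : idem A) X := fin_gen X /\ proj (corner_mod e X).

Definition CM_ (e : idem A) X := CM X /\ mod_ e X.

End Orders.

(* X \otimes_R K for K = Frac R (so K = k((t)) when R = k[[t]]), with A acting
   on the left factor: formal sums of pairs (x, c), standing for x \otimes c,
   modulo the defining relations of a tensor product. *)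
Section ScalarExtension.
Variables (R : idomainType) (A : algebra R) (X : lmodType A).
Local Notation K := {fraction R}.
Local Notation sums := (seq (X * K)).

Inductive tensor_eq : sums -> sums -> Prop :=
| TensorRefl s : tensor_eq s s
| TensorSym s t : tensor_eq s t -> tensor_eq t s
| TensorTrans s t u : tensor_eq s t -> tensor_eq t u -> tensor_eq s u
| TensorCat s s' t t' :
    tensor_eq s s' -> tensor_eq t t' -> tensor_eq (s ++ t) (s' ++ t')
| TensorC s t : tensor_eq (s ++ t) (t ++ s)
| Tensor0 c : tensor_eq [:: (0, c)] [::]
| TensorDl x y c : tensor_eq [:: (x + y, c)] [:: (x, c); (y, c)]
| TensorDr x c d : tensor_eq [:: (x, c + d)] [:: (x, c); (x, d)]
| TensorZ r x c :
    tensor_eq [:: (alg_struct A r *: x, c)] [:: (x, tofrac r * c)].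

Definition tensor_rel : rel sums := [rel s t | `[< tensor_eq s t >]].
Fact tensor_rel_refl : reflexive tensor_rel.
Proof. by move=> s; apply/asboolP; apply: TensorRefl. Qed.
Fact tensor_rel_sym : symmetric tensor_rel.
Proof. by move=> s t; apply/asboolP/asboolP; apply: TensorSym. Qed.
Fact tensor_rel_trans : transitive tensor_rel.
Proof.
move=> t s u /asboolP st /asboolP tu; apply/asboolP.
exact: TensorTrans st tu.
Qed.
Canonical tensor_equiv :=
  EquivRel tensor_rel tensor_rel_refl tensor_rel_sym tensor_rel_trans.

Definition ext_scal : Type := {eq_quot tensor_rel}.
HB.instance Definition _ := Choice.on ext_scal.

Definition tensor_sum (s : sums) : ext_scal := \pi_({eq_quot tensor_rel}) s.

Lemma tensor_sumP s t : tensor_sum s = tensor_sum t <-> tensor_eq s t.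
Proof.
split; first by move=> /eqmodP /asboolP.
by move=> st; apply/eqmodP/asboolP.
Qed.
Lemma tensor_repr u : tensor_sum (repr u) = u.
Proof. exact: reprK. Qed.
Lemma tensor_reprP s : tensor_eq (repr (tensor_sum s)) s.
Proof. by apply/tensor_sumP; rewrite tensor_repr. Qed.

Definition pure_tensor x c : ext_scal := tensor_sum [:: (x, c)].

Let smap (f : X -> X) (s : sums) : sums := [seq (f p.1, p.2) | p <- s].

Definition tensor_add (u v : ext_scal) := tensor_sum (repr u ++ repr v).
Definition tensor_opp (u : ext_scal) := tensor_sum (smap -%R (repr u)).
Definition tensor_scale (a : A) (u : ext_scal) :=
  tensor_sum (smap ( *:%R a) (repr u)).

Lemma tensor_addE s t :
  tensor_add (tensor_sum s) (tensor_sum t) = tensor_sum (s ++ t).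
Proof. by apply/tensor_sumP; apply: TensorCat; apply: tensor_reprP. Qed.
Let smap_eq f s t : zmod_morphism f ->
  (forall r x, f (alg_struct A r *: x) = alg_struct A r *: f x) ->
  tensor_eq s t -> tensor_eq (smap f s) (smap f t).
Proof.
move=> fB fZ.
have f0 : f 0 = 0 by have := fB 0 0; rewrite !subrr.
have fN x : f (- x) = - f x by rewrite -[- x]add0r fB f0 add0r.
have fD x y : f (x + y) = f x + f y by rewrite -{1}[y]opprK fB fN opprK.
elim=> [s'|s' t' _|s' t' u _ IH1 _|s1 s2 t1 t2 _ IH1 _ IH2|s' t'|c|x y c|x c d|r x c].
- exact: TensorRefl.
- exact: TensorSym.
- exact: TensorTrans.
- by rewrite /smap !map_cat; apply: TensorCat.
- by rewrite /smap !map_cat; apply: TensorC.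
- by rewrite /smap /= f0; apply: Tensor0.
- by rewrite /smap /= fD; apply: TensorDl.
- by rewrite /smap /=; apply: TensorDr.
- by rewrite /smap /= fZ; apply: TensorZ.
Qed.
Lemma tensor_oppE s : tensor_opp (tensor_sum s) = tensor_sum (smap -%R s).
Proof.
apply/tensor_sumP; apply: smap_eq; last exact: tensor_reprP.
- by move=> x y; rewrite opprD.
- by move=> r x; rewrite scalerN.
Qed.
Lemma tensor_scaleE a s :
  tensor_scale a (tensor_sum s) = tensor_sum (smap ( *:%R a) s).
Proof.
apply/tensor_sumP; apply: smap_eq; last exact: tensor_reprP.
- exact: scalerBr.
- by move=> r x; rewrite !scalerA alg_central.
Qed.
Fact tensor_addA : associative tensor_add.
Proof.
move=> u v w; rewrite -[u]tensor_repr -[v]tensor_repr -[w]tensor_repr.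
by rewrite !tensor_addE catA.
Qed.
Fact tensor_addC : commutative tensor_add.
Proof.
move=> u v; rewrite -[u]tensor_repr -[v]tensor_repr !tensor_addE.
by apply/tensor_sumP; apply: TensorC.
Qed.
Fact tensor_add0 : left_id (tensor_sum [::]) tensor_add.
Proof. by move=> u; rewrite -[u]tensor_repr !tensor_addE. Qed.
Let tensor_cons p s :
  tensor_sum (p :: s) = tensor_add (tensor_sum [:: p]) (tensor_sum s).
Proof. by rewrite tensor_addE. Qed.
Fact tensor_addN : left_inverse (tensor_sum [::]) tensor_opp tensor_add.
Proof.
move=> u; rewrite -[u]tensor_repr; elim: (repr u) => [|[x c] s IH].
  by rewrite tensor_oppE tensor_addE.
move: IH; rewrite !tensor_oppE /= (tensor_cons (- x, c)) (tensor_cons (x, c)).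
move=> IH.
rewrite -tensor_addA [X in tensor_add _ X]tensor_addA.
rewrite [X in tensor_add _ (tensor_add X _)]tensor_addC -tensor_addA IH.
rewrite [X in tensor_add _ X]tensor_addC tensor_add0 tensor_addE /=.
apply/tensor_sumP; apply: TensorTrans (Tensor0 c).
by rewrite -(addNr x); apply: TensorSym; apply: TensorDl.
Qed.
HB.instance Definition _ := GRing.isZmodule.Build ext_scal
  tensor_addA tensor_addC tensor_add0 tensor_addN.

Lemma tensor_sumD s t : tensor_sum (s ++ t) = tensor_sum s + tensor_sum t.
Proof. by rewrite -tensor_addE. Qed.

Fact tensor_scaleA a b u :
  tensor_scale a (tensor_scale b u) = tensor_scale (a * b) u.
Proof.
rewrite -[u]tensor_repr !tensor_scaleE /smap -map_comp; congr tensor_sum.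
by apply: eq_map => -[x c] /=; rewrite scalerA.
Qed.
Fact tensor_scale1 : left_id 1 tensor_scale.
Proof.
move=> u; rewrite -[u]tensor_repr tensor_scaleE; congr tensor_sum.
by rewrite /smap -[RHS]map_id; apply: eq_map => -[x c] /=; rewrite scale1r.
Qed.
Fact tensor_scaleDr : right_distributive tensor_scale +%R.
Proof.
move=> a u v; rewrite -[u]tensor_repr -[v]tensor_repr -tensor_sumD.
by rewrite !tensor_scaleE /smap map_cat tensor_sumD.
Qed.
Fact tensor_scaleDl u : {morph tensor_scale^~ u : a b / a + b}.
Proof.
move=> a b; rewrite -[u]tensor_repr; elim: (repr u) => [|[x c] s IH].
  by rewrite !tensor_scaleE -tensor_sumD.
rewrite -cat1s; move: IH; rewrite !tensor_scaleE /smap !map_cat !tensor_sumD.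
move=> ->; rewrite addrACA; congr (_ + _); rewrite /= scalerDl -tensor_sumD.
by apply/tensor_sumP; apply: TensorDl.
Qed.
HB.instance Definition _ := GRing.Zmodule_isLmodule.Build A ext_scal
  tensor_scaleA tensor_scale1 tensor_scaleDr tensor_scaleDl.

Definition lattice : {pred ext_scal} :=
  [pred v | `[< exists x, v = pure_tensor x 1 >]].
Fact lattice_closed : GRing.subsemimod_closed lattice.
Proof.
split; [split=> [|v w /asboolP[x ->] /asboolP[y ->]]|move=> a v /asboolP[x ->]];
  apply/asboolP.
- by exists 0; apply/tensor_sumP; apply: TensorSym; apply: Tensor0.
- exists (x + y); rewrite /pure_tensor -tensor_sumD.
  by apply/tensor_sumP; apply: TensorSym; apply: TensorDl.
- by exists (a *: x); rewrite /pure_tensor [LHS]tensor_scaleE.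
Qed.
HB.instance Definition _ :=
  GRing.isSubmodClosed.Build A ext_scal lattice lattice_closed.

Definition semisimple_over (Y : submodClosed ext_scal) :=
  {subset lattice <= Y} /\ semisimple (subquot Y lattice).

(* The sum of all such Y, which is the largest one: see corad_largest. *)
Definition corad : submodClosed ext_scal :=
  gen_submod (fun v => exists2 Y, semisimple_over Y & v \in Y).

Definition cotop : lmodType A := subquot corad lattice.

End ScalarExtension.
Arguments lattice {R A} X v.

Definition rel_cotop (R : idomainType) (A : algebra R) (e : A) (X : lmodType A)
    : lmodType A :=
  submod (ann_by (cotop X) (principal_ideal e)).

Section Images.
Variables (A : pzRingType) (M N : lmodType A) (f : {linear M -> N}).

Definition preim_submod (T : submodClosed N) : {pred M} :=
  [pred x | f x \in T].
Arguments preim_submod : clear implicits.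
Fact preim_submod_closed T : GRing.subsemimod_closed (preim_submod T).
Proof.
split; [split=> [|a b aT bT]|move=> a b bT]; rewrite inE.
- by rewrite raddf0 rpred0.
- by rewrite raddfD rpredD.
- by rewrite linearZ rpredZ.
Qed.
HB.instance Definition _ T :=
  GRing.isSubmodClosed.Build A M (preim_submod T) (preim_submod_closed T).

Definition im_submod (S : submodClosed M) : {pred N} :=
  [pred y | `[< exists2 x, x \in S & f x = y >]].
Arguments im_submod : clear implicits.
Fact im_submod_closed S : GRing.subsemimod_closed (im_submod S).
Proof.
split; [split=> [|_ _ /asboolP[a aS <-] /asboolP[b bS <-]]
       |move=> a _ /asboolP[b bS <-]]; apply/asboolP.
- by exists 0; rewrite ?rpred0 ?raddf0.
- by exists (a + b); rewrite ?rpredD ?raddfD.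
- by exists (a *: b); rewrite ?rpredZ ?linearZ.
Qed.
HB.instance Definition _ S :=
  GRing.isSubmodClosed.Build A N (im_submod S) (im_submod_closed S).

Lemma soc_injective x : injective f -> x \in soc M -> f x \in soc N.
Proof.
move=> finj /asboolP/(_ (preim_submod (soc N))); apply=> {}x.
rename x into y; move=> [S [[z zS z0] Smin] yS].
apply/asboolP => T; apply; exists (im_submod S : submodClosed N); last by apply/asboolP; exists y.
split.
  exists (f z); first by apply/asboolP; exists z.
  by apply: contra z0 => /eqP fz; apply/eqP/finj; rewrite fz raddf0.
move=> U US; have [a aU|U0|SU] := Smin (preim_submod U).
- by have /asboolP[b bS /finj<-] : f a \in im_submod S by apply: US.
- left=> w wU; have /asboolP[b bS wb] := US _ wU.
  by rewrite -wb (U0 b) ?raddf0 // inE wb.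
- by right=> _ /asboolP[b bS <-]; apply: SU.
Qed.
End Images.

Section CoradLargest.
Variables (R : idomainType) (A : algebra R) (X : lmodType A).
Local Notation V := (ext_scal X).
Local Notation L := (lattice X).

Section Inclusion.
Variables (Y C : submodClosed V).
Hypothesis YC : {subset Y <= C}.
Let incl (y : submod Y) : submod C := exist _ (val y) (YC (valP y)).
Let incl_pi (u : subquot Y L) : subquot C L := mod_pi _ (incl (repr u)).
Let incl_piE y : incl_pi (mod_pi _ y) = mod_pi _ (incl y).
Proof.
apply/mod_piP; rewrite inE /= -[_ - _]/(val (repr (mod_pi (submod_inter Y L) y) - y)).
have /mod_piP := mod_repr (mod_pi (submod_inter Y L) y).
by rewrite inE.
Qed.
Lemma subquot_incl : exists f : {linear subquot Y L -> subquot C L},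
  injective f /\ forall (y : submod Y) (c : submod C),
    val y = val c -> f (mod_pi _ y) = mod_pi _ c.
Proof.
have incl_lin : linear incl_pi.
  move=> a u v; rewrite -[u]mod_repr -[v]mod_repr -linearP !incl_piE -linearP.
  by congr (mod_pi _ _); apply: val_inj.
pose f := HB.pack_for {linear subquot Y L -> subquot C L} incl_pi
  (GRing.isLinear.Build A _ _ _ incl_pi incl_lin).
exists f; split=> [u v|y c yc].
  rewrite -[u]mod_repr -[v]mod_repr /= !incl_piE => /mod_piP.
  by rewrite inE /= => uv; apply/mod_piP; rewrite inE.
by rewrite /= incl_piE; congr (mod_pi _ _); apply: val_inj.
Qed.
End Inclusion.

Lemma corad_largest : semisimple_over (corad X) /\
  forall Y, semisimple_over Y -> {subset Y <= corad X}.
Proof.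
have sub_corad Y : semisimple_over Y -> {subset Y <= corad X}.
  by move=> ssY v vY; apply/asboolP => S; apply; exists Y.
have ssL : semisimple_over L.
  split=> // u; suff -> : u = 0 by rewrite rpred0.
  rewrite -[u]mod_repr -(raddf0 (mod_pi _)); apply/mod_piP.
  by rewrite subr0 inE (valP (repr u)).
split=> //; split; first exact: sub_corad.
move=> u; rewrite -[u]mod_repr; set c := repr u.
pose valC : {linear submod (corad X) -> V} := val.
pose PS := im_submod valC (preim_submod (mod_pi _) (soc (cotop X))).
have /asboolP[c' c'S /val_inj <- //] : val c \in PS.
have /asboolP := valP c; apply=> v [Y ssY vY].
have [f [finj fE]] := subquot_incl (sub_corad Y ssY).
apply/asboolP; pose y : submod Y := exist _ v vY.
pose d : submod (corad X) := exist _ v (sub_corad Y ssY v vY).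
have fyS : f (mod_pi _ y) \in soc (cotop X).
  by apply: soc_injective => //; apply: ssY.2.
rewrite (fE y d erefl) in fyS.
by exists d => //; exact: fyS.
Qed.
End CoradLargest.

(* The double quiver of a graph without multiple edges has one arrow i -> j for
   each ordered pair of adjacent vertices, so its paths are the walks
   x_0, x_1, ..., x_m of the graph, encoded as (x_0, [:: x_1; ...; x_m]). *)
Section PathAlgebra.
Variables (k : fieldType) (T : finType) (adj : rel T).
Local Notation walk := (T * seq T)%type.

Record path_algebra := PathAlgebra {
  pa_coef : walk -> k;
  pa_path : forall p, pa_coef p != 0 -> path adj p.1 p.2;
  pa_finite : exists L : seq walk, forall p, pa_coef p != 0 -> p \in L
}.
HB.instance Definition _ := gen_eqMixin path_algebra.
HB.instance Definition _ := gen_choiceMixin path_algebra.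
Implicit Types f g h : path_algebra.

Lemma paP f g : pa_coef f =1 pa_coef g -> f = g.
Proof.
case: f => f f1 f2; case: g => g g1 g2 /= /funext fg; subst g.
by rewrite (Prop_irrelevance f1 g1) (Prop_irrelevance f2 g2).
Qed.

Fact pa_zeroP1 (p : walk) : (0 : k) != 0 -> path adj p.1 p.2.
Proof. by rewrite eqxx. Qed.
Fact pa_zeroP2 : exists L : seq walk, forall p, (0 : k) != 0 -> p \in L.
Proof. by exists [::] => p; rewrite eqxx. Qed.
Definition pa_zero := @PathAlgebra (fun _ => 0) pa_zeroP1 pa_zeroP2.

Fact pa_addP1 f g p : pa_coef f p + pa_coef g p != 0 -> path adj p.1 p.2.
Proof.
have [f0|/pa_path//] := eqVneq (pa_coef f p) 0.
by rewrite f0 add0r; apply: pa_path.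
Qed.
Fact pa_addP2 f g : exists L : seq walk,
  forall p, pa_coef f p + pa_coef g p != 0 -> p \in L.
Proof.
have [[L fL] [M gM]] := (pa_finite f, pa_finite g).
exists (L ++ M) => p; rewrite mem_cat.
have [f0|/fL->//] := eqVneq (pa_coef f p) 0.
by rewrite f0 add0r => /gM ->; rewrite orbT.
Qed.
Definition pa_add f g := PathAlgebra (@pa_addP1 f g) (pa_addP2 f g).

Fact pa_oppP1 f p : - pa_coef f p != 0 -> path adj p.1 p.2.
Proof. by rewrite oppr_eq0; apply: pa_path. Qed.
Fact pa_oppP2 f : exists L : seq walk, forall p, - pa_coef f p != 0 -> p \in L.
Proof. by have [L fL] := pa_finite f; exists L => p; rewrite oppr_eq0 => /fL. Qed.
Definition pa_opp f := PathAlgebra (@pa_oppP1 f) (pa_oppP2 f).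

Definition pa_conv (f g : walk -> k) (p : walk) : k :=
  \sum_(i < (size p.2).+1)
    f (p.1, take i p.2) * g (last p.1 (take i p.2), drop i p.2).

Lemma pa_conv_neq0 f g p : pa_conv (pa_coef f) (pa_coef g) p != 0 ->
  exists i, pa_coef f (p.1, take i p.2) != 0 /\
            pa_coef g (last p.1 (take i p.2), drop i p.2) != 0.
Proof.
move=> nz; apply: contrapT => nex; case/eqP: nz; apply: big1 => i _.
apply: contrapT => /eqP; rewrite mulf_eq0 negb_or => /andP[fi gi].
by apply: nex; exists i.
Qed.
Fact pa_mulP1 f g p :
  pa_conv (pa_coef f) (pa_coef g) p != 0 -> path adj p.1 p.2.
Proof.
case/pa_conv_neq0 => i [/pa_path fi /pa_path gi].
by rewrite -[p.2](cat_take_drop i) cat_path fi gi.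
Qed.
Fact pa_mulP2 f g : exists L : seq walk,
  forall p, pa_conv (pa_coef f) (pa_coef g) p != 0 -> p \in L.
Proof.
have [[L fL] [M gM]] := (pa_finite f, pa_finite g).
exists [seq (p.1, p.2 ++ q.2) | p <- L, q <- M] => p.
case/pa_conv_neq0 => i [/fL Lp /gM Mp]; apply/allpairsP.
by exists ((p.1, take i p.2), (last p.1 (take i p.2), drop i p.2)); split=> //=;
  rewrite cat_take_drop; case: (p).
Qed.
Definition pa_mul f g := PathAlgebra (@pa_mulP1 f g) (pa_mulP2 f g).

Definition walk_coef (c : walk -> k) (p : walk) : k :=
  if p.2 is [::] then c p else 0.
Fact pa_vertP1 c p : walk_coef c p != 0 -> path adj p.1 p.2.
Proof. by case: p => x [|y s] //=; rewrite eqxx. Qed.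
Fact pa_vertP2 c : exists L : seq walk, forall p, walk_coef c p != 0 -> p \in L.
Proof.
exists [seq (x, [::]) | x <- enum T] => -[x [|y s]] /=; last by rewrite eqxx.
by move=> _; apply/mapP; exists x; rewrite ?mem_enum.
Qed.
(* \sum_x c_x e_x, with e_x the trivial path at x. *)
Definition pa_vert (c : T -> k) :=
  PathAlgebra (@pa_vertP1 (c \o fst)) (pa_vertP2 (c \o fst)).

Fact pa_walkP1 p q : (if (q == p) && path adj p.1 p.2 then 1 else 0 : k) != 0 ->
  path adj q.1 q.2.
Proof.
case: (q =P p) => [->|_] /=; last by rewrite eqxx.
by case: ifP => // _; rewrite eqxx.
Qed.
Fact pa_walkP2 p : exists L : seq walk, forall q,
  (if (q == p) && path adj p.1 p.2 then 1 else 0 : k) != 0 -> q \in L.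
Proof.
by exists [:: p] => q; rewrite inE; case: (q =P p) => //= _; rewrite eqxx.
Qed.
(* The basis element given by a walk, and 0 on sequences that are not walks. *)
Definition pa_walk p := PathAlgebra (@pa_walkP1 p) (pa_walkP2 p).

Fact pa_addA : associative pa_add.
Proof. by move=> f g h; apply: paP => p /=; rewrite addrA. Qed.
Fact pa_addC : commutative pa_add.
Proof. by move=> f g; apply: paP => p /=; rewrite addrC. Qed.
Fact pa_add0 : left_id pa_zero pa_add.
Proof. by move=> f; apply: paP => p /=; rewrite add0r. Qed.
Fact pa_addN : left_inverse pa_zero pa_opp pa_add.
Proof. by move=> f; apply: paP => p /=; rewrite addNr. Qed.
Fact pa_mulA : associative pa_mul.
Proof.
move=> f g h; apply: paP => -[x s] /=; rewrite /pa_conv /=.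
set F := fun i j => pa_coef f (x, take i s) *
  (pa_coef g (last x (take i s), take (j - i) (drop i s)) *
   pa_coef h (last x (take j s), drop j s)).
transitivity (\sum_(0 <= i < (size s).+1) \sum_(i <= j < (size s).+1) F i j).
  rewrite big_mkord; apply: eq_bigr => i _; rewrite mulr_sumr.
  have lei : (i <= size s)%N by rewrite -ltnS.
  have -> : \sum_(i <= j < (size s).+1) F i j =
            \sum_(j < (size (drop i s)).+1) F i (j + i)%N.
    by rewrite -{1}[i : nat]add0n big_addn subSn // -size_drop big_mkord.
  apply: eq_bigr => j _; rewrite /F addnK drop_drop.
  by rewrite [(j + i)%N]addnC takeD last_cat.
transitivity (\sum_(0 <= i < (size s).+1)
                \sum_(0 <= j < (size s).+1 | (i <= j)%N) F i j).
  by apply: eq_bigr => i _; rewrite (big_nat_widenl i 0).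
rewrite (exchange_big_dep xpredT) //= big_mkord.
apply: eq_bigr => j _; rewrite mulr_suml.
have lej : (j <= size s)%N by rewrite -ltnS.
transitivity (\sum_(0 <= i < j.+1) F i j).
  by rewrite (big_nat_widen 0 j.+1 (size s).+1) // ltnS.
rewrite big_mkord size_takel //; apply: eq_bigr => -[i /= lti] _.
rewrite ltnS in lti.
by rewrite /F take_takel // take_drop subnK // mulrA.
Qed.
Fact pa_mul1 : left_id (pa_vert (fun=> 1)) pa_mul.
Proof.
move=> f; apply: paP => -[x s] /=; rewrite /pa_conv /= big_ord_recl /=.
rewrite take0 drop0 mul1r big1 ?addr0 // => -[i lti] _.
by case: s lti => [//|y s] _ /=; rewrite mul0r.
Qed.
Fact pa_1mul : right_id (pa_vert (fun=> 1)) pa_mul.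
Proof.
move=> f; apply: paP => -[x s] /=; rewrite /pa_conv /= big_ord_recr /=.
rewrite take_size drop_size mulr1 big1 ?add0r // => -[i lti] _ /=.
rewrite /walk_coef /=; case E: (drop i s) => [|y t]; last by rewrite mulr0.
by have := size_drop i s; rewrite E /= => /esym/eqP; rewrite subn_eq0 leqNgt lti.
Qed.
Fact pa_mulDl : left_distributive pa_mul pa_add.
Proof.
move=> f g h; apply: paP => p /=; rewrite /pa_conv -big_split /=.
by apply: eq_bigr => i _; rewrite mulrDl.
Qed.
Fact pa_mulDr : right_distributive pa_mul pa_add.
Proof.
move=> f g h; apply: paP => p /=; rewrite /pa_conv -big_split /=.
by apply: eq_bigr => i _; rewrite mulrDr.
Qed.
HB.instance Definition _ := GRing.isPzRing.Build path_algebra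
  pa_addA pa_addC pa_add0 pa_addN
  pa_mulA pa_mul1 pa_1mul pa_mulDl pa_mulDr.

Definition pa_scalar (c : k) : path_algebra := pa_vert (fun=> c).
Lemma pa_scalarl c f p : pa_coef (pa_scalar c * f) p = c * pa_coef f p.
Proof.
case: p => x s; rewrite /= /pa_conv /= big_ord_recl /=.
rewrite take0 drop0 big1 ?addr0 // => -[i lti] _.
by case: s lti => [//|y s] _ /=; rewrite mul0r.
Qed.
Lemma pa_scalarr c f p : pa_coef (f * pa_scalar c) p = pa_coef f p * c.
Proof.
case: p => x s; rewrite /= /pa_conv /= big_ord_recr /=.
rewrite take_size drop_size big1 ?add0r // => -[i lti] _ /=.
rewrite /walk_coef /=; case E: (drop i s) => [|y t]; last by rewrite mulr0.
by have := size_drop i s; rewrite E /= => /esym/eqP; rewrite subn_eq0 leqNgt lti.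
Qed.
Fact pa_scalar_zmod : zmod_morphism pa_scalar.
Proof.
move=> c d; apply: paP => -[x [|y s]] //=; by rewrite /walk_coef /= ?subr0.
Qed.
Fact pa_scalar_monoid : monoid_morphism pa_scalar.
Proof.
split=> // c d; apply: paP => p; rewrite pa_scalarl.
by case: p => x [|y s] //=; rewrite /walk_coef /= mulr0.
Qed.
HB.instance Definition _ :=
  GRing.isZmodMorphism.Build k path_algebra pa_scalar pa_scalar_zmod.
HB.instance Definition _ :=
  GRing.isMonoidMorphism.Build k path_algebra pa_scalar pa_scalar_monoid.
Fact pa_central c f : pa_scalar c * f = f * pa_scalar c.
Proof. by apply: paP => p; rewrite pa_scalarl pa_scalarr mulrC. Qed.
Definition path_alg : algebra k := Algebra pa_central.
End PathAlgebra.

(* TypeA n is A_(n+1) and TypeD n is D_(n+4). *)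
Inductive dynkin :=
  TypeA of nat | TypeD of nat | TypeE6 | TypeE7 | TypeE8.

Definition rank (D : dynkin) : nat :=
  match D with
  | TypeA n => n.+1
  | TypeD n => n.+4
  | TypeE6 => 6
  | TypeE7 => 7
  | TypeE8 => 8
  end.

Notation vertex D := 'I_(rank D).

(* The chain 0 - 1 - ... - (r-2), with the vertex r-1 attached at b. *)
Definition fork (r b i j : nat) : bool :=
  ((j == i.+1) && (j < r.-1)%N) || ((i == b) && (j == r.-1)).

(* The edges i - j with i < j, oriented from i to j. *)
Definition dynkin_arrow (D : dynkin) : rel (vertex D) := fun i j =>
  match D with
  | TypeA _ => (j : nat) == i.+1
  | TypeD n => fork n.+4 n.+1 i j
  | TypeE6 => fork 6 2 i j
  | TypeE7 => fork 7 2 i j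
  | TypeE8 => fork 8 2 i j
  end.

Definition dynkin_adj (D : dynkin) : rel (vertex D) := fun i j =>
  dynkin_arrow i j || dynkin_arrow j i.

(* Hom_A(A/I, A), by evaluation at 1: the elements x with I x = 0. *)
Section RightAnnihilator.
Variables (A : pzRingType) (I : ideal A).
Definition right_ann : {pred A} :=
  [pred x | `[< forall b, b \in I -> b * x = 0 >]].
Fact right_ann_zmod : zmod_closed right_ann.
Proof.
split=> [|x y /asboolP xI /asboolP yI]; apply/asboolP => b bI.
  by rewrite mulr0.
by rewrite mulrBr xI ?yI ?subr0.
Qed.
Fact right_annMl a x : x \in right_ann -> a * x \in right_ann.
Proof.
move=> /asboolP xI; apply/asboolP => b bI.
by rewrite mulrA; apply: xI; apply: idealMr.
Qed.
Fact right_annMr a x : x \in right_ann -> x * a \in right_ann.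
Proof.
by move=> /asboolP xI; apply/asboolP => b bI; rewrite mulrA xI ?mul0r.
Qed.
HB.instance Definition _ := GRing.isZmodClosed.Build A right_ann right_ann_zmod.
HB.instance Definition _ := isIdeal.Build A right_ann right_annMl right_annMr.
End RightAnnihilator.

Section Preprojective.
Variables (k : fieldType) (D : dynkin).
Local Notation P := (path_alg k (@dynkin_adj D)).

(* The sum of a a^* - a^* a over the arrows a : i -> j. *)
Definition preproj_relation : P :=
  \sum_(i : vertex D) \sum_(j : vertex D | dynkin_arrow i j)
    (pa_walk k (@dynkin_adj D) (i, [:: j; i])
     - pa_walk k (@dynkin_adj D) (j, [:: i; j])).

Definition preproj : algebra k := quot_alg (principal_ideal preproj_relation).

Definition vertex_idem (j : vertex D) : preproj :=
  quot_pi _ (pa_walk k (@dynkin_adj D) (j, [::])).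

Definition set_idem (J : {set vertex D}) : preproj :=
  \sum_(j in J) vertex_idem j.

Definition ideal_of (J : {set vertex D}) : ideal preproj :=
  right_ann (principal_ideal (set_idem J)).

(* S is the one-dimensional module at j; the arrows act on it by 0 because
   there are no loops. *)
Definition simple_at (j : vertex D) (S : lmodType preproj) :=
  exists v : S, [/\ v != 0, vertex_idem j *: v = v &
    forall w, exists c : k, w = alg_struct preproj c *: v].

Definition indec_injective_at (j : vertex D) (U : lmodType preproj) :=
  [/\ injective_mod U, indecomposable U & simple_at j (submod (soc U))].

(* Q is the internal direct sum of the U j for j in J. *)
Definition is_Q (J : {set vertex D}) (Q : lmodType preproj) :=
  exists U : vertex D -> submodClosed Q,
    (forall j, j \in J -> indec_injective_at j (submod (U j))) /\
    (forall x : Q, exists! u : {ffun vertex D -> Q},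
      [/\ forall j, j \in J -> u j \in U j, forall j, j \notin J -> u j = 0 &
          x = \sum_j u j]).

End Preprojective.

Section Models.
Variables (k : fieldType) (D : dynkin) (J : {set vertex D}).
Variables (A : algebra (fps k)) (e : idem A).
Local Notation Pi := (preproj k D).
Local Notation B := (quot_alg (principal_ideal (idem_val e))).
Local Notation PiJ := (quot_alg (ideal_of k J)).
Local Notation Ae := (submod (left_ideal (idem_val e))).

Definition alg_iso (phi : {rmorphism B -> PiJ}) :=
  bijective phi /\
  forall c : k, phi (alg_struct B (fpsC c)) = alg_struct PiJ c.

(* M is annihilated by (e) and N by I_J; they are isomorphic when B-modules are
   identified with Pi/I_J-modules along phi. *)
Definition iso_along (phi : {rmorphism B -> PiJ}) (M : lmodType A)
    (N : lmodType Pi) :=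
  exists2 f : {additive M -> N}, bijective f &
    forall (a : A) (p : Pi) m,
      phi (quot_pi _ a) = quot_pi _ p -> f (a *: m) = p *: f m.

Definition cotop_bijection (phi : {rmorphism B -> PiJ}) (Q : lmodType Pi) :=
  [/\ forall X, ind Ae X -> exists2 S, ind (submod (soc Q)) S &
        iso_along phi (rel_cotop (idem_val e) X) S,
      forall X X' S, ind Ae X -> ind Ae X' ->
        iso_along phi (rel_cotop (idem_val e) X) S ->
        iso_along phi (rel_cotop (idem_val e) X') S -> lin_iso X X' &
      forall S, ind (submod (soc Q)) S -> exists2 X, ind Ae X &
        iso_along phi (rel_cotop (idem_val e) X) S].

Definition models := exists phi : {rmorphism B -> PiJ},
  [/\ alg_iso phi,
      forall X, CM_ e X -> Ext1_eq0 (@fin_gen A) X Ae,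
      forall X, mod_ e X -> Ext2_eq0 (mod_ e) X Ae &
      exists2 Q, is_Q J Q & cotop_bijection phi Q].

End Models.

(* Main.v *)
(* Let g be the idempotent of J in Pi and Q = Hom_k(g Pi, k), the injective
   module Q_J, whose endomorphism ring is the corner g Pi g. A finite family of
   generators of Q over g Pi g gives a map kap from the first column of a matrix
   ring Ah over (g Pi g)[[t]] onto Q. With e the first diagonal matrix unit, A is
   the ring of the a in Ah for which some b in Pi satisfies kap(a z) = b kap(z)
   for all z. Then a |-> b induces A / (e) = Pi / I_J, since I_J is the
   annihilator of Q, and there is an exact sequence 0 -> A e -> Ah e -> Q -> 0.
   The module Ah e = Hom_(eAe)(eA, eAe) is coinduced from eAe, so that Ext^i(X, Ah e)
   vanishes when eX is projective. Hence Ext^1(X, A e) is the cokernel of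
   Hom(X, Ah e) -> Hom(X, Q), which is 0 when X has no torsion, and Ext^2(X, A e)
   is Ext^1(X, Q), which is 0 because Q is injective over Pi. The summands A e_j
   of A e have relative cotop soc(Ah e_j / A e_j) = soc(Q_j).

   This uses that Pi is finite-dimensional. Let M be a cyclic right Pi-module
   with generator at the vertex i0 and dimension vector alpha, and X the action
   of the arrows on M. The graded maps phi |-> [phi, X] have an isotropic image,
   by the preprojective relations, and kernel End(M) of dimension at most
   alpha_i0. This bounds the Tits form, q(alpha) <= alpha_i0; as q is positive
   definite, the dimensions of the truncations of e_i0 Pi by the length of the
   walks are bounded, so that long walks vanish in Pi. *)

From HB Require Import structures.
From mathcomp Require Import all_boot all_order all_algebra.
From mathcomp Require Import boolp reals complex ring lra zify.
From mathcomp Require classical_sets.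
Require Import Defs.

Set Implicit Arguments.
Unset Strict Implicit.
Unset Printing Implicit Defensive.

Import GRing.Theory.
Local Open Scope ring_scope.

(** * Modules *)

(** The first column of Ah has one generator more than is needed to cover Q, and this generator, [e]
    itself, goes to 0. This puts [e], and even all of e Ah, into A; hence eA = e Ah and E = eAe = e
    Ah e, and the module coinduced from E is visibly Ah e. As t acts by 0 on Q, the order satisfies
    t Ah <= A <= Ah: this bounds torsion and shows that A e and Ah e span the same K-space. An
    element of A determines its action on Q, but b in Pi only modulo I_J, so the map A -> Pi / I_J
    appears as a relation. Besides making A an order, the finite dimension of Pi makes Q finitely
    generated over gPig, makes Pi reflexive, whence End(Q) = gPig, and makes rad Pi nil. Yoneda Ext
    in [mod_] offers no long exact sequence for free. The vanishing is shown directly: every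
    extension has a morphism to one fixed extension. For Ext^2 this fixed one has Q as a middle
    term, which is allowed because eQ = 0. *)

Section Modules.
Variable A : pzRingType.
Implicit Types M N P X Y : lmodType A.

Lemma ex_linear M N (f : M -> N) : linear f ->
  exists g : {linear M -> N}, g = f :> (M -> N).
Proof.
move=> fL; exists (HB.pack_for {linear M -> N} f (GRing.isLinear.Build A M N _ f fL)).
by [].
Qed.

(** Serves to define a map on an image by [Psi x |-> phi x]. A relation closed under linear
    combinations is single-valued as soon as it is so at 0. *)
Lemma linear_of_rel M N (r : M -> N -> Prop) :
  (forall x, exists y, r x y) ->
  (forall y, r 0 y -> y = 0) ->
  (forall a x x' y y', r x y -> r x' y' -> r (a *: x + x') (a *: y + y')) ->
  exists g : {linear M -> N}, forall x y, r x y <-> y = g x.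
Proof.
move=> tot fun0 lin; have [f fP] := choice tot.
have uniq x y y' : r x y -> r x y' -> y = y'.
  move=> rxy rxy'; have := lin (-1) x x y y' rxy rxy'.
  rewrite !scaleN1r addNr => /fun0 /eqP; rewrite addrC subr_eq0.
  by move=> /eqP.
have [|g gE] := @ex_linear M N f.
  by move=> a x y; apply: (uniq (a *: x + y)) => //; apply: lin.
exists g => x y; rewrite gE; split=> [rxy|->//]; exact: uniq (fP x).
Qed.

Lemma linear_inverse M N (f : {linear M -> N}) : bijective f ->
  exists2 g : {linear N -> M}, cancel f g & cancel g f.
Proof.
case=> h fK hK; have [|g gE] := @ex_linear N M h; last by exists g; rewrite gE.
by move=> a x y; apply: (can_inj fK); rewrite linearP !hK.
Qed.

Lemma lin_iso_sym M N : lin_iso M N -> lin_iso N M.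
Proof. by case=> f /linear_inverse[g fK gK]; exists g; exists f. Qed.

Lemma lin_iso_trans M N P : lin_iso M N -> lin_iso N P -> lin_iso M P.
Proof.
by case=> f fb [g gb]; exists (g \o f : {linear M -> P}); apply: bij_comp.
Qed.

Lemma surj_bij (T U : Type) (f : T -> U) :
  injective f -> surjective f -> bijective f.
Proof.
move=> inj /choice[g gK]; exists g => // x; apply: inj; exact: gK.
Qed.

Definition in_sub M (S : submodClosed M) x (xS : x \in S) : submod S :=
  exist (fun y => y \in S) x xS.

Lemma val_submodD M (S : submodClosed M) (x y : submod S) : val (x + y) = val x + val y.
Proof. by []. Qed.

Lemma val_submodZ M (S : submodClosed M) a (x : submod S) : val (a *: x) = a *: val x.
Proof. by []. Qed.

Definition kernel M N (f : {linear M -> N}) : {pred M} := [pred x | f x == 0].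
Fact kernel_closed M N (f : {linear M -> N}) : GRing.subsemimod_closed (kernel f).
Proof.
split; [split=> [|x y /eqP fx /eqP fy]|move=> a x /eqP fx]; apply/eqP.
- exact: linear0.
- by rewrite linearD fx fy addr0.
- by rewrite linearZ_LR fx scaler0.
Qed.
HB.instance Definition _ M N (f : {linear M -> N}) :=
  GRing.isSubmodClosed.Build A M (kernel f) (kernel_closed f).

Lemma split_decomposition X Y (f : {linear X -> Y}) (h : {linear Y -> X}) :
  cancel h f -> lin_iso X (Y * submod (kernel f))%type.
Proof.
move=> hK.
have kerP x : x - h (f x) \in kernel f by rewrite inE linearB hK subrr.
pose g x : (Y * submod (kernel f))%type := (f x, in_sub (kerP x)).
have [|G GE] := @ex_linear X (Y * submod (kernel f))%type g.
  move=> a x y; congr pair; first by rewrite linearP.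
  apply: val_inj; rewrite /= !linearD !linearZ_LR /=.
  by rewrite scalerDr addrACA.
exists G; exists (fun p => h p.1 + val p.2) => x; first by rewrite GE /= addrC subrK.
case: x => y [x xk]; rewrite GE /g /=; have /eqP fx := xk.
have e1 : f (h y + x) = y by rewrite linearD hK fx addr0.
congr pair; first exact: e1.
by apply: val_inj; rewrite /= e1 addrC addrA addNr add0r.
Qed.

(** The kernel of [f] is a complement of the image of [h], so it must vanish. *)
Lemma indecomposable_split X Y (f : {linear X -> Y}) (h : {linear Y -> X}) :
  cancel h f -> indecomposable X -> ~ zero_mod Y -> bijective f.
Proof.
move=> hK [_ indX] nzY.
have [//|ker0] := indX _ _ (split_decomposition hK).
exists h => // x; apply/eqP; rewrite eq_sym -subr_eq0.
have xk : x - h (f x) \in kernel f by rewrite inE linearB hK subrr.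
by have /(congr1 val) /= -> := ker0 (in_sub xk).
Qed.

Lemma indecomposable_iso M N : lin_iso M N -> indecomposable M -> indecomposable N.
Proof.
move=> MN [nzM indM]; split=> [zN|X Y NXY]; last first.
  by apply: indM; apply: lin_iso_trans MN NXY.
by apply: nzM => x; have [f /bij_inj inj] := MN; apply: inj; rewrite [LHS]zN [RHS]zN.
Qed.

Lemma injective_mod_iso M N : lin_iso M N -> injective_mod M -> injective_mod N.
Proof.
move=> [f /linear_inverse[g fK gK]] injM P Q i h inji.
have [k kE] := injM P Q i (g \o h : {linear _ -> _}) inji.
by exists (f \o k : {linear _ -> _}) => x; rewrite /= kE /= gK.
Qed.

(** A decomposition M = N x P yields the projection onto N; if it is 0 then N vanishes, and if it is
    1 then P does. *)
Lemma indecomposable_idempotent M : ~ zero_mod M ->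
  (forall f : {linear M -> M}, (forall x, f (f x) = f x) ->
     (forall x, f x = 0) \/ (forall x, f x = x)) -> indecomposable M.
Proof.
move=> nzM idemM; split=> // N P [f /linear_inverse[g fK gK]].
have [|h hE] := @ex_linear M M (fun x => g ((f x).1, 0)).
  move=> a x y; rewrite -linearP; congr (g _).
  by apply: injective_projections; rewrite /= ?linearP //= scaler0 addr0.
case: (idemM h) => [x|h0|h1]; first by rewrite hE gK.
- left=> n; have := h0 (g (n, 0)); rewrite hE gK /=.
  by move=> /(congr1 f); rewrite gK linear0 => -[].
- right=> p; have := h1 (g (0, p)); rewrite hE gK /=.
  by move=> /(congr1 f); rewrite !gK => -[].
Qed.

(** Finite sums of elements of simple submodules form a submodule, and [soc] is the least submodule
    containing all simple ones. *)
Lemma soc_simple_sum M x : x \in soc M ->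
  exists n (S : 'I_n -> submodClosed M) (s : 'I_n -> M),
    [/\ forall i, simple_submod (S i), forall i, s i \in S i & x = \sum_i s i].
Proof.
pose T : {pred M} := [pred x | `[< exists n (S : 'I_n -> submodClosed M)
  (s : 'I_n -> M), [/\ forall i, simple_submod (S i), forall i, s i \in S i &
  x = \sum_i s i] >]].
have Tc : GRing.subsemimod_closed T.
  split; [split|].
  - apply/asboolP; exists 0%N, (fun=> soc M), (fun=> 0).
    by split=> [[]//|[]//|]; rewrite big_ord0.
  - move=> y z /asboolP[n [S [s [Ss sS ->]]]] /asboolP[m [S' [s' [Ss' sS' ->]]]].
    apply/asboolP; exists (n + m)%N.
    exists (fun i => match split i with inl j => S j | inr j => S' j end).
    exists (fun i => match split i with inl j => s j | inr j => s' j end).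
    split=> [i|i|]; try by case: splitP.
    rewrite big_split_ord /=; congr (_ + _); apply: eq_bigr => i _.
      by rewrite (unsplitK (inl i)).
    by rewrite (unsplitK (inr i)).
  - move=> a y /asboolP[n [S [s [Ss sS ->]]]]; apply/asboolP.
    exists n, S, (fun i => a *: s i); split=> // [i|]; first exact: rpredZ.
    by rewrite scaler_sumr.
pose T' : submodClosed M := HB.pack_for (submodClosed M) T
  (GRing.isSubmodClosed.Build A M T Tc).
move=> /asboolP/(_ T') H; suff /asboolP : x \in T' by [].
apply: H => y [S Ss yS]; apply/asboolP.
exists 1%N, (fun=> S), (fun=> y); split=> //; by rewrite big_ord1.
Qed.

End Modules.

(** * Finite generation and split extensions *)

Section FinGen.
Variable A : pzRingType.
Implicit Types X Y : lmodType A.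

Lemma fin_gen_prod X Y : fin_gen X -> fin_gen Y -> fin_gen (X * Y)%type.
Proof.
move=> [n [b bP]] [m [c cP]]; exists (n + m)%N.
exists (fun i => match split i with inl i => (b i, 0) | inr j => (0, c j) end).
case=> x y; have [a ->] := bP x; have [d ->] := cP y.
exists (fun i => match split i with inl i => a i | inr j => d j end).
rewrite big_split_ord.
have splitl i : split (lshift m i) = inl i :> 'I_n + 'I_m by exact: (unsplitK (inl i)).
have splitr j : split (rshift n j) = inr j :> 'I_n + 'I_m by exact: (unsplitK (inr j)).
under eq_bigr do rewrite splitl.
under [X in _ = _ + X]eq_bigr do rewrite splitr.
rewrite /=.
apply: injective_projections; rewrite /= !raddf_sum /=.
  by rewrite [X in _ = _ + X]big1 ?addr0 // => i _; rewrite scaler0.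
by rewrite [X in _ = X + _]big1 ?add0r // => i _; rewrite scaler0.
Qed.

Lemma pair_linear X Y : exists2 f : {linear X -> (X * Y)%type}, forall x, f x = (x, 0) &
  exists2 g : {linear Y -> (X * Y)%type}, forall y, g y = (0, y) &
  exists h : {linear (X * Y)%type -> Y}, forall z, h z = z.2.
Proof.
have [|f fE] := @ex_linear A X (X * Y)%type (fun x => (x, 0)).
  by move=> a x y; apply: injective_projections; rewrite //= scaler0 addr0.
have [|g gE] := @ex_linear A Y (X * Y)%type (fun x => (0, x)).
  by move=> a x y; apply: injective_projections; rewrite //= scaler0 addr0.
have [|h hE] := @ex_linear A (X * Y)%type Y snd; first by [].
by exists f; [rewrite fE | exists g; [rewrite gE | exists h; rewrite hE]].
Qed.

Lemma pair_short_exact X Y (f : {linear X -> (X * Y)%type}) (h : {linear (X * Y)%type -> Y}) :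
  (forall x, f x = (x, 0)) -> (forall z, h z = z.2) -> short_exact f h.
Proof.
move=> fE hE; split=> [x x'|y|[x y]]; rewrite ?fE //.
- by case.
- by exists (0, y); rewrite hE.
- rewrite hE /=; split=> [->|[x' ]]; first by exists x; rewrite fE.
  by rewrite fE => -[].
Qed.

(** Equivalence of extensions is generated by morphisms, so it suffices to map every extension to
    the split one; a retraction r gives the morphism x |-> (r x, p x). *)
Lemma split_ext1_eq0 (C : lmodType A -> Prop) X Y : C (Y * X)%type ->
  (forall (E : lmodType A) (i : {linear Y -> E}) (p : {linear E -> X}), C E -> short_exact i p ->
     exists r : {linear E -> Y}, cancel i r) ->
  Ext1_eq0 C X Y.
Proof.
move=> CYX splitE; have [f fE [_ _ [h hE]]] := pair_linear Y X.
have fh := pair_short_exact fE hE; pose T := Ext1 CYX fh.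
have toT E : ext1_hom E T.
  case: E => E i p CE ip; have [r rK] := splitE E i p CE ip.
  have [|g gE] := @ex_linear A E (Y * X)%type (fun x => (r x, p x)).
    by move=> a x y; rewrite !linearP.
  exists g => [y|x]; rewrite /= gE ?hE //= fE rK.
  by congr pair; case: ip => _ _ exip; apply/exip; exists y.
move=> E F; apply: Relation_Operators.rst_trans (T) _ _ _.
  exact: Relation_Operators.rst_step.
by apply: Relation_Operators.rst_sym; apply: Relation_Operators.rst_step.
Qed.

End FinGen.

Lemma fin_gen_ext (A : pzRingType) (X Y E : lmodType A) (i : {linear Y -> E}) (p : {linear E -> X}) :
  short_exact i p -> fin_gen Y -> fin_gen X -> fin_gen E.
Proof.
case=> _ surjp exip [n [b bP]] [m [c cP]]; exists (n + m)%N.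
have [c' c'E] := choice (fun j => surjp (c j)).
exists (fun l => match split l with inl l => i (b l) | inr j => c' j end) => x.
have [d dE] := cP (p x).
have /exip[y yE] : p (x - \sum_j d j *: c' j) = 0.
  rewrite linearB linear_sum dE; apply/eqP; rewrite subr_eq0; apply/eqP.
  by apply: eq_bigr => j _; rewrite linearZ_LR c'E.
have [a aE] := bP y.
exists (fun l => match split l with inl l => a l | inr j => d j end).
rewrite big_split_ord -[LHS](subrK (\sum_j d j *: c' j)) -yE aE linear_sum.
congr (_ + _); apply: eq_bigr => l _.
  by rewrite (_ : split _ = inl l) ?linearZ_LR //; apply: (unsplitK (inl l)).
by rewrite (_ : split _ = inr l) //; apply: (unsplitK (inr l)).
Qed.

Section DualBasis.
Variables (A : pzRingType) (e : idem A) (X : lmodType A).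
Local Notation ev := (idem_val e).

(** Concerns the module eX over E = eAe. The forms live on X instead of eX: with a = e, the third
    and fourth clauses give p_i(e x) = p_i(x), so each is determined on eX and no corner type is
    involved. *)
Definition dual_basis n (y : 'I_n -> X) (p : 'I_n -> X -> A) :=
  [/\ forall i, ev *: y i = y i,
      forall i x x', p i (x + x') = p i x + p i x',
      forall i a x, ev * a * ev = a -> p i (a *: x) = a * p i x,
      forall i x, ev * p i x * ev = p i x &
      forall x, ev *: x = \sum_i p i x *: y i].

Fact to_corner_subproof (x : X) : ev *: x \in @corner_pred A e X.
Proof. by rewrite inE scalerA idemP. Qed.
Definition to_corner (x : X) : corner_mod e X :=
  exist (fun x => x \in @corner_pred A e X) _ (to_corner_subproof x).

Lemma to_cornerD x y : to_corner (x + y) = to_corner x + to_corner y.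
Proof. by apply: val_inj; rewrite /= scalerDr. Qed.

Lemma to_cornerZ (a : corner e) x :
  to_corner (corner_val a *: x) = a *: to_corner x.
Proof. by apply: val_inj; rewrite /= !scalerA corner_idl corner_idr. Qed.

Lemma val_cornerE (x : corner_mod e X) : to_corner (val x) = x.
Proof. by apply: val_inj => /=; have /eqP := valP x. Qed.

Lemma val_corner_sum (I : Type) (r : seq I) (F : I -> corner_mod e X) :
  val (\sum_(i <- r) F i) = \sum_(i <- r) val (F i).
Proof. by elim/big_rec2: _ => //= i x y _ <-. Qed.

(** Generators present eX as a quotient of E^n; the coordinates of a section of this quotient map
    are the forms p_i. *)
Lemma proj_dual_basis : proj (corner_mod e X) <->
  exists n (y : 'I_n -> X) (p : 'I_n -> X -> A), dual_basis y p.
Proof.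
split=> [[[n [b bP]] prX]|[n [y [p [ey pD pZ pe xE]]]]].
- pose F : lmodType (corner e) := {ffun 'I_n -> (corner e)^o}.
  have [|q qE] := @ex_linear _ F (corner_mod e X) (fun c => \sum_i c i *: b i).
    move=> a c d; rewrite scaler_sumr -big_split; apply: eq_bigr => i _ /=.
    by rewrite !ffunE scalerDl scalerA.
  have [|g gE] := prX _ _ q (idfun : {linear corner_mod e X -> _}).
    by move=> x; have [c ->] := bP x; exists [ffun i => c i];
      rewrite qE; apply: eq_bigr => i _; rewrite ffunE.
  exists n, (fun i => val (b i)), (fun i x => corner_val (g (to_corner x) i)).
  split=> [i|i x x'|i a x ea|i x|x].
  + by have /eqP := valP (b i).
  + by rewrite to_cornerD linearD ffunE.
  + by rewrite -[a in LHS]/(corner_val (Corner ea)) to_cornerZ linearZ_LR ffunE.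
  + exact: cornerP.
  + have := gE (to_corner x); rewrite qE /= => /(congr1 val).
    by rewrite val_corner_sum /= => <-.
- have pE x : x = \sum_i Corner (pe i (val x)) *: to_corner (y i).
    apply: val_inj; rewrite val_corner_sum -[in LHS](val_cornerE x) /= xE.
    by apply: eq_bigr => i _; rewrite /= ey.
  split=> [|N P q f qS]; first by exists n, (fun i => to_corner (y i)) => x;
    exists (fun i => Corner (pe i (val x))); exact: pE.
  have [m mE] := choice (fun i => qS (f (to_corner (y i)))).
  have [|g gE] := @ex_linear _ (corner_mod e X) N
     (fun x => \sum_i Corner (pe i (val x)) *: m i).
    move=> a x x'; rewrite scaler_sumr -big_split; apply: eq_bigr => i _ /=.
    rewrite scalerA -scalerDl; congr (_ *: _); apply: corner_val_inj => /=.
    by rewrite pD pZ ?cornerP.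
  exists g => x; rewrite gE linear_sum [in RHS](pE x) linear_sum.
  by apply: eq_bigr => i _; rewrite !linearZ_LR mE.
Qed.

End DualBasis.

Section LeftIdeal.
Variables (A : pzRingType) (x : A).
Implicit Types w : submod (left_ideal x).

Lemma val_left_idealD w w' : (val (w + w') : A) = (val w : A) + (val w' : A).
Proof. by []. Qed.

Lemma val_left_idealZ (a : A) w : (val (a *: w) : A) = a * (val w : A).
Proof. by []. Qed.

Lemma val_left_idealP w : exists b, (val w : A) = b * x.
Proof. by have /asboolP := valP w. Qed.

Lemma left_ideal_mem (b : A) : exists w : submod (left_ideal x), (val w : A) = b * x.
Proof.
have bx : (b * x : A^o) \in left_ideal x by apply/asboolP; exists b.
by exists (in_sub bx).
Qed.
End LeftIdeal.

(** * Injectivity of Hom_k(g P, k) *)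

Section FunctionalExtension.
Variables (k : fieldType) (N P : lmodType k).
Variables (i : {linear N -> P}) (f : {linear N -> k^o}).
Hypothesis inj_i : injective i.

Let good (G : P * k -> Prop) :=
  [/\ forall z, G z -> forall x, G (i x, f x),
      forall a z w, G z -> G w -> G (a *: z.1 + w.1, a * z.2 + w.2) &
      forall c, G (0, c) -> c = 0].

Lemma functional_extension : exists g : {linear P -> k^o}, forall x, g (i x) = f x.
Proof.
have base_good : good (fun z => exists x, z = (i x, f x)).
  split=> [z _ x|a _ _ [x ->] [y ->]|c [x [ix ->]]]; first by exists x.
    by exists (a *: x + y); rewrite !linearP.
  by rewrite (_ : x = 0) ?linear0 //; apply: inj_i; rewrite linear0.
have [F Fgood totF|G [[Gbase Glin Gfun] Gmax]] := @classical_sets.Zorn_bigcup _ good.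
- split=> [z [H FH Hz] x|a z w [H FH Hz] [H' FH' Hw]|c [H FH Hc]].
  + by exists H => //; have [/(_ z Hz)] := Fgood _ FH.
  + have [HH|HH] := totF _ _ FH FH'.
      by exists H' => //; have [_ L _] := Fgood _ FH'; apply: L => //; apply: HH.
    by exists H => //; have [_ L _] := Fgood _ FH; apply: L => //; apply: HH.
  + by have [_ _ L] := Fgood _ FH; apply: L.
have maxG H : good H -> (forall z, G z -> H z) -> forall z, H z -> G z.
  move=> gH GH z Hz; apply: contrapT => nGz; apply: (Gmax H) => //.
  by split; [exact: GH | move/(_ z Hz)].
have Gi x : G (i x, f x).
  have [[z /Gbase//]|nG] := pselect (exists z, G z).
  by apply: maxG base_good _ _ _ => [z Gz|]; [case: nG; exists z | exists x].
have G0 : G (0, 0) by have := Gi 0; rewrite !linear0.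
have Gtot x : exists c, G (x, c).
  (* If x were outside the domain of the maximal graph G, adding x with the value 0 would give a
     larger good graph. *)
  pose H z := exists d y, z.1 = y + d *: x /\ G (y, z.2).
  apply: contrapT => nx; case: (nx); exists 0; apply: (maxG H); last first.
  - by exists 1, 0; split; rewrite //= scale1r add0r.
  - by case=> y c Gy; exists 0, y; split=> //; rewrite scale0r addr0.
  split=> [_ _ y|a [z1 z2] [w1 w2] [d [y /= [-> Gy]]] [d' [y' /= [-> Gy']]]|c].
  - by exists 0, (i y); split; rewrite //= scale0r addr0.
  - exists (a * d + d'), (a *: y + y'); split; last exact: (Glin a (y, z2) (y', w2)).
    by rewrite /= scalerDr scalerA addrACA -scalerDl.
  - case=> d [y /= [/eqP]]; rewrite eq_sym addr_eq0 => /eqP -> Gy.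
    have [d0|dn0] := eqVneq d 0; first by apply: Gfun; rewrite d0 scale0r oppr0 in Gy.
    case: nx; exists (- d^-1 * c); have := Glin (- d^-1) _ _ Gy G0.
    by rewrite /= !addr0 scaleNr scalerN opprK scalerA mulVf // scale1r.
have [g gP] := choice Gtot.
have uniq x c c' : G (x, c) -> G (x, c') -> c = c'.
  move=> Gc Gc'; have := Glin (-1) _ _ Gc Gc'.
  by rewrite /= scaleN1r addNr => /Gfun/eqP; rewrite mulN1r addrC subr_eq0 => /eqP.
have [|h hE] := @ex_linear k P k^o g.
  by move=> a x y; apply: (uniq (a *: x + y)); [exact: gP | exact: (Glin a (x, g x) (y, g y))].
by exists h => x; rewrite hE; apply: uniq (gP _) (Gi x).
Qed.

End FunctionalExtension.

Definition restrict (k : comPzRingType) (A : algebra k) (V : lmodType A) : Type := V.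

Section Restrict.
Variables (k : comPzRingType) (A : algebra k) (V : lmodType A).
HB.instance Definition _ := GRing.Zmodule.on (restrict V).
Definition restrict_scale (c : k) (x : restrict V) : restrict V :=
  alg_struct A c *: (x : V).
Fact restrict_scaleA a b x :
  restrict_scale a (restrict_scale b x) = restrict_scale (a * b) x.
Proof. by rewrite /restrict_scale scalerA rmorphM. Qed.
Fact restrict_scale1 : left_id 1 restrict_scale.
Proof. by move=> x; rewrite /restrict_scale rmorph1 scale1r. Qed.
Fact restrict_scaleDr : right_distributive restrict_scale +%R.
Proof. by move=> a x y; apply: scalerDr. Qed.
Fact restrict_scaleDl x : {morph restrict_scale^~ x : a b / a + b}.
Proof. by move=> a b; rewrite /restrict_scale rmorphD scalerDl. Qed.
HB.instance Definition _ := GRing.Zmodule_isLmodule.Build k (restrict V)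
  restrict_scaleA restrict_scale1 restrict_scaleDr restrict_scaleDl.
End Restrict.

Lemma restrict_scaleE (k : comPzRingType) (A : algebra k) (V : lmodType A) c
  (x : V) : alg_struct A c *: x = c *: (x : restrict V).
Proof. by []. Qed.

Section Cofree.
Variables (k : fieldType) (P : algebra k) (g : P).

(* The module Hom_k(g P, k), encoded by the linear forms on P that are
   invariant under left multiplication by g. *)
Record cofree := Cofree {
  cofree_fun :> P -> k;
  cofree_lin : forall c x y,
    cofree_fun (alg_struct P c * x + y) = c * cofree_fun x + cofree_fun y;
  cofree_supp : forall x, cofree_fun (g * x) = cofree_fun x
}.
HB.instance Definition _ := gen_eqMixin cofree.
HB.instance Definition _ := gen_choiceMixin cofree.
Implicit Types f h : cofree.

Lemma cofreeP f h : f =1 h -> f = h.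
Proof.
case: f => f f1 f2; case: h => h h1 h2 /= /funext fh; subst h.
by rewrite (Prop_irrelevance f1 h1) (Prop_irrelevance f2 h2).
Qed.

Lemma cofreeD f : {morph f : x y / x + y}.
Proof. by move=> x y; rewrite -{1}[x]mul1r -(rmorph1 (alg_struct P)) cofree_lin mul1r. Qed.
Lemma cofree0 f : f 0 = 0.
Proof. by apply: (addIr (f 0)); rewrite -cofreeD !add0r. Qed.
Lemma cofreeZ f c x : f (alg_struct P c * x) = c * f x.
Proof. by rewrite -[alg_struct P c * x]addr0 cofree_lin cofree0 addr0. Qed.
Lemma cofree_sum f (I : Type) (r : seq I) (q : pred I) (F : I -> P) :
  f (\sum_(i <- r | q i) F i) = \sum_(i <- r | q i) f (F i).
Proof. by elim/big_rec2: _ => [|i x y _ <-]; rewrite ?cofree0 ?cofreeD. Qed.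

Fact cofree_zero_lin (c : k) (x y : P) : 0 = c * 0 + 0 :> k.
Proof. by rewrite mulr0 addr0. Qed.
Definition cofree_zero := @Cofree (fun=> 0) cofree_zero_lin (fun=> erefl).
Fact cofree_add_lin f h c x y : f (alg_struct P c * x + y) + h (alg_struct P c * x + y)
  = c * (f x + h x) + (f y + h y).
Proof. by rewrite !cofree_lin mulrDr addrACA. Qed.
Fact cofree_add_supp f h x : f (g * x) + h (g * x) = f x + h x.
Proof. by rewrite !cofree_supp. Qed.
Definition cofree_add f h := Cofree (cofree_add_lin f h) (cofree_add_supp f h).
Fact cofree_opp_lin f c x y : - f (alg_struct P c * x + y) = c * - f x + - f y.
Proof. by rewrite cofree_lin opprD mulrN. Qed.
Fact cofree_opp_supp f x : - f (g * x) = - f x.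
Proof. by rewrite cofree_supp. Qed.
Definition cofree_opp f := Cofree (cofree_opp_lin f) (cofree_opp_supp f).
Fact cofree_addA : associative cofree_add.
Proof. by move=> f1 f2 f3; apply: cofreeP => x /=; rewrite addrA. Qed.
Fact cofree_addC : commutative cofree_add.
Proof. by move=> f1 f2; apply: cofreeP => x /=; rewrite addrC. Qed.
Fact cofree_add0 : left_id cofree_zero cofree_add.
Proof. by move=> f1; apply: cofreeP => x /=; rewrite add0r. Qed.
Fact cofree_addN : left_inverse cofree_zero cofree_opp cofree_add.
Proof. by move=> f1; apply: cofreeP => x /=; rewrite addNr. Qed.
HB.instance Definition _ := GRing.isZmodule.Build cofree
  cofree_addA cofree_addC cofree_add0 cofree_addN.

Fact cofree_scale_lin (p : P) f c x y :
  f ((alg_struct P c * x + y) * p) = c * f (x * p) + f (y * p).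
Proof. by rewrite mulrDl -mulrA cofree_lin. Qed.
Fact cofree_scale_supp (p : P) f x : f (g * x * p) = f (x * p).
Proof. by rewrite -mulrA cofree_supp. Qed.
Definition cofree_scale p f := Cofree (cofree_scale_lin p f) (cofree_scale_supp p f).
Fact cofree_scaleA a b f : cofree_scale a (cofree_scale b f) = cofree_scale (a * b) f.
Proof. by apply: cofreeP => x /=; rewrite mulrA. Qed.
Fact cofree_scale1 : left_id 1 cofree_scale.
Proof. by move=> f; apply: cofreeP => x /=; rewrite mulr1. Qed.
Fact cofree_scaleDr : right_distributive cofree_scale +%R.
Proof. by move=> a f h; apply: cofreeP. Qed.
Fact cofree_scaleDl f : {morph cofree_scale^~ f : a b / a + b}.
Proof. by move=> a b; apply: cofreeP => x /=; rewrite mulrDr cofreeD. Qed.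
HB.instance Definition _ := GRing.Zmodule_isLmodule.Build P cofree
  cofree_scaleA cofree_scale1 cofree_scaleDr cofree_scaleDl.

Lemma cofree_scaleE p f x : (p *: f : cofree) x = f (x * p).
Proof. by []. Qed.
Lemma cofree_addE f h x : (f + h : cofree) x = f x + h x.
Proof. by []. Qed.
Lemma cofree_oppE f x : (- f : cofree) x = - f x.
Proof. by []. Qed.
Lemma cofree_sumE (I : Type) (r : seq I) (q : pred I) (F : I -> cofree) x :
  (\sum_(i <- r | q i) F i : cofree) x = \sum_(i <- r | q i) F i x.
Proof. by elim/big_rec2: _ => // i y h _ <-. Qed.
Lemma cofree_algE c f x : (alg_struct P c *: f : cofree) x = c * f x.
Proof. by rewrite cofree_scaleE -alg_central cofreeZ. Qed.

Hypothesis gg : g * g = g.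

(** Evaluation at 1 identifies Hom_P(N, Hom_k(gP, k)) with the linear forms on gN. The form of [f]
    is extended over k to a form l on M, and l gives back the map p |-> (x |-> l(g x p)). *)
Lemma cofree_injective : injective_mod cofree.
Proof.
move=> N M i f inji.
have [|i' i'E] := @ex_linear k (restrict N) (restrict M) i.
  by move=> a x y; rewrite -restrict_scaleE linearP.
have [|f' f'E] := @ex_linear k (restrict N) k^o (fun n => f n 1).
  move=> a x y; rewrite -restrict_scaleE linearP cofree_addE.
  by rewrite cofree_algE.
have [|l lE] := @functional_extension k _ _ i' f'; first by rewrite i'E.
have lD (x y : M) : l (x + y : M) = l x + l y by exact: (linearD l).
have lZ c (x : M) : l (alg_struct P c *: x) = c * l x.
  exact: (linearZ_LR l).
have hlin (p : M) c (x y : P) : l (g * (alg_struct P c * x + y) *: p : M) =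
    c * l (g * x *: p : M) + l (g * y *: p : M).
  rewrite mulrDr scalerDl lD; congr (_ + _).
  by rewrite mulrA -alg_central -mulrA -scalerA lZ.
have hsupp (p : M) x : l (g * (g * x) *: p : M) = l (g * x *: p : M).
  by rewrite mulrA gg.
have [|h hE] := @ex_linear P M cofree (fun p => Cofree (hlin p) (hsupp p)).
  move=> a x y; apply: cofreeP => z /=.
  by rewrite scalerDr lD scalerA mulrA.
exists h => n; apply: cofreeP => x; rewrite hE /=.
rewrite -linearZ_LR -[X in X _ = _]/((l : M -> k)).
have := lE (g * x *: n); rewrite i'E f'E => ->.
by rewrite linearZ_LR cofree_scaleE mul1r cofree_supp.
Qed.

Section FiniteDimensional.
Variables (n : nat) (b : 'I_n -> P) (co : 'I_n -> P -> k).
Hypothesis co_lin : forall i c x y, co i (alg_struct P c * x + y) = c * co i x + co i y.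
Hypothesis coE : forall x, x = \sum_i alg_struct P (co i x) * b i.

Fact cofree_coord_lin i c x y :
  co i (g * (alg_struct P c * x + y)) = c * co i (g * x) + co i (g * y).
Proof. by rewrite mulrDr mulrA -alg_central -mulrA co_lin. Qed.
Fact cofree_coord_supp i x : co i (g * (g * x)) = co i (g * x).
Proof. by rewrite mulrA gg. Qed.
Definition cofree_coord i := Cofree (cofree_coord_lin i) (cofree_coord_supp i).

Lemma cofree_coordE f : f = \sum_i alg_struct P (f (b i)) *: cofree_coord i.
Proof.
apply: cofreeP => x; rewrite cofree_sumE -cofree_supp [in LHS](coE (g * x)).
rewrite cofree_sum; apply: eq_bigr => i _.
by rewrite cofreeZ cofree_algE mulrC.
Qed.

Lemma cofree_separates x : (forall f, f x = 0) -> g * x = 0.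
Proof.
move=> f0; rewrite [LHS]coE big1 // => i _.
by rewrite -[co i _]/(cofree_coord i x) f0 rmorph0 mul0r.
Qed.

(* P is reflexive, and a linear map to Hom_k(g P, k) is determined by its
   composite with evaluation at 1. *)
Lemma cofree_endo (th : {linear cofree -> cofree}) :
  exists2 c, g * c * g = c & forall f x, th f x = f (c * x).
Proof.
pose c0 := \sum_i alg_struct P (th (cofree_coord i) 1) * b i.
have evE f : th f 1 = f c0.
  rewrite [in LHS](cofree_coordE f) linear_sum cofree_sumE cofree_sum.
  by apply: eq_bigr => i _; rewrite linearZ_LR cofree_algE cofreeZ mulrC.
have thE f x : th f x = f (c0 * x).
  by rewrite -[x in LHS]mul1r -cofree_scaleE -linearZ_LR evE.
exists (g * c0 * g) => [|f x]; first by rewrite !mulrA gg -!mulrA gg.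
by rewrite -!mulrA cofree_supp -thE cofree_supp thE.
Qed.

End FiniteDimensional.

(** Forms separate the points of gP, so p kills all of them iff gPp = 0. The w with wPp = 0 form an
    ideal, which takes this from g to the ideal generated by g. *)
Lemma cofree_annihilator n (b : 'I_n -> P) co :
  (forall i c x y, co i (alg_struct P c * x + y) = c * co i x + co i y) ->
  (forall x, x = \sum_i alg_struct P (co i x) * b i) ->
  forall p, p \in right_ann (principal_ideal g) <-> forall f, p *: f = 0.
Proof.
move=> co_lin coE p; split=> [/asboolP pann f|pf].
  apply: cofreeP => x; rewrite cofree_scaleE -cofree_supp mulrA pann ?cofree0 //.
  by apply: idealMr; apply/asboolP => I; apply.
pose I : {pred P} := [pred w | `[< forall y, w * y * p = 0 >]].
have Iz : zmod_closed I.
  split=> [|x y /asboolP xI /asboolP yI]; apply/asboolP => z; first by rewrite !mul0r.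
  by rewrite !mulrBl xI yI subr0.
have Il a x : x \in I -> a * x \in I.
  by move=> /asboolP xI; apply/asboolP => y; rewrite -!mulrA [x * _]mulrA xI mulr0.
have Ir a x : x \in I -> x * a \in I.
  by move=> /asboolP xI; apply/asboolP => y; rewrite -(mulrA x) xI.
pose I1 := HB.pack_for (ideal P) I
  (GRing.isZmodClosed.Build P I Iz) (isIdeal.Build P I Il Ir).
apply/asboolP => w /asboolP/(_ I1) H.
suff /H/asboolP/(_ 1) : forall y, y = g -> y \in I1 by rewrite mulr1.
move=> _ ->; apply/asboolP => y; rewrite -mulrA.
apply: (cofree_separates co_lin coE) => f.
by rewrite -cofree_scaleE pf.
Qed.

End Cofree.

(** * Split basic algebras *)

(* The characters identify P / rad P with k^T, and rad P is nil. *)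
Record basic (k : fieldType) (P : algebra k) (T : finType) := Basic {
  bidem : T -> P;
  bchar : T -> P -> k;
  bidemM : forall i j, bidem i * bidem j = if i == j then bidem i else 0;
  bchar_lin : forall j c x y, bchar j (alg_struct P c * x + y) = c * bchar j x + bchar j y;
  bcharM : forall j x y, bchar j (x * y) = bchar j x * bchar j y;
  bchar_idem : forall i j, bchar i (bidem j) = (i == j)%:R;
  bnil : forall x, (forall j, bchar j x = 0) -> exists n, x ^+ n = 0
}.

Lemma nil_quasiregular (P : pzRingType) (x : P) n : x ^+ n = 0 ->
  exists y, y * (1 - x) = 1.
Proof.
move=> xn; exists (\sum_(i < n) x ^+ i).
rewrite mulr_suml; under eq_bigr do rewrite mulrBr mulr1 -exprSr.
rewrite sumrB; case: n xn => [|n] xn.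
  by rewrite !big_ord0 subr0 -xn expr0.
by rewrite big_ord_recl [in X in _ - X]big_ord_recr /= xn expr0 addr0 addrK.
Qed.

(** The one-dimensional module at j, with P acting through the character j; [bP] and [j] are phantom
    arguments from which the scaling is inferred. *)
Definition bsimple (k : fieldType) (P : algebra k) (T : finType) (bP : basic P T)
  (j : T) : Type := k.

Section Basic.
Variables (k : fieldType) (P : algebra k) (T : finType) (bP : basic P T).
Local Notation ep := (bidem bP).
Local Notation la := (bchar bP).

Lemma bcharD j : {morph la j : x y / x + y}.
Proof. by move=> x y; rewrite -{1}[x]mul1r -(rmorph1 (alg_struct P)) bchar_lin mul1r. Qed.
Lemma bchar0 j : la j 0 = 0.
Proof. by apply: (addIr (la j 0)); rewrite -bcharD !add0r. Qed.
Lemma bcharZ j c x : la j (alg_struct P c * x) = c * la j x.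
Proof. by rewrite -[alg_struct P c * x]addr0 bchar_lin bchar0 addr0. Qed.
Lemma bcharN j x : la j (- x) = - la j x.
Proof. by apply/eqP; rewrite -addr_eq0 -bcharD addNr bchar0. Qed.
Lemma bchar_sum j (I : Type) (r : seq I) (Q : pred I) (F : I -> P) :
  la j (\sum_(i <- r | Q i) F i) = \sum_(i <- r | Q i) la j (F i).
Proof. by elim/big_rec2: _ => [|i x y _ <-]; rewrite ?bchar0 ?bcharD. Qed.
Lemma bchar1 j : la j 1 = 1.
Proof.
have := bcharM bP j 1 (ep j).
by rewrite mul1r bchar_idem eqxx mulr1.
Qed.
Lemma bchar_alg j c : la j (alg_struct P c) = c.
Proof. by rewrite -[alg_struct P c]mulr1 bcharZ bchar1 mulr1. Qed.

Definition brad (x : P) := forall j, la j x = 0.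

Lemma bradM x y : brad y -> brad (x * y).
Proof. by move=> ry j; rewrite bcharM ry mulr0. Qed.

Lemma brad_sub x : brad (x - \sum_j alg_struct P (la j x) * ep j).
Proof.
move=> i; rewrite bcharD bcharN bchar_sum (bigD1 i) //= big1.
  by rewrite bcharZ bchar_idem eqxx mulr1 addr0 subrr.
by move=> j ji; rewrite bcharZ bchar_idem eq_sym (negPf ji) mulr0.
Qed.

Lemma brad_quasiregular x : brad x -> exists y, y * (1 - x) = 1.
Proof. by case/bnil => n /nil_quasiregular. Qed.

(** Let w lie in a simple S with y w nonzero. Then S = P y w, so w = p y w for some p, and w = 0
    because 1 - p y is left invertible. *)
Lemma soc_brad (V : lmodType P) v x : v \in soc V -> brad x -> x *: v = 0.
Proof.
move=> /asboolP vs rx.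
pose U : {pred V} := [pred w | `[< forall y, brad y -> y *: w = 0 >]].
have Uc : GRing.subsemimod_closed U.
  split; [split=> [|w w' /asboolP wU /asboolP w'U]|move=> a w /asboolP wU];
    apply/asboolP => y ry.
  - by rewrite scaler0.
  - by rewrite scalerDr wU ?w'U ?addr0.
  - by rewrite scalerA wU // => j; rewrite bcharM ry mul0r.
pose U1 := HB.pack_for (submodClosed V) U (GRing.isSubmodClosed.Build P V U Uc).
suff /asboolP : v \in U1 by apply.
apply: vs => w [S [[s0 _ _] Smin] wS]; apply/asboolP => y ry.
apply: contrapT => /eqP yw.
pose Y : {pred V} := [pred z | `[< exists p, z = p *: (y *: w) >]].
have Yc : GRing.subsemimod_closed Y.
  split; [split=> [|z z' /asboolP[p ->] /asboolP[p' ->]]|move=> a z /asboolP[p ->]];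
    apply/asboolP.
  - by exists 0; rewrite scale0r.
  - by exists (p + p'); rewrite scalerDl.
  - by exists (a * p); rewrite scalerA.
pose Y1 := HB.pack_for (submodClosed V) Y (GRing.isSubmodClosed.Build P V Y Yc).
have [|Y0|SY] := Smin Y1.
- by move=> z /asboolP[p ->]; rewrite !rpredZ.
- by case/eqP: yw; apply: Y0; apply/asboolP; exists 1; rewrite scale1r.
- have /asboolP[p wp] := SY _ wS.
  have [z zE] := brad_quasiregular (bradM p ry).
  case/eqP: yw; rewrite -[w]scale1r -zE -scalerA scalerBl scale1r -scalerA -wp.
  by rewrite subrr !scaler0.
Qed.

(** The line through [v] is a submodule, and a line is simple. *)
Lemma soc_eigen (V : lmodType P) (v : V) : v != 0 ->
  (forall p, exists c, p *: v = alg_struct P c *: v) -> v \in soc V.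
Proof.
move=> v0 vline.
pose Y : {pred V} := [pred z | `[< exists c, z = alg_struct P c *: v >]].
have Yc : GRing.subsemimod_closed Y.
  split; [split=> [|z z' /asboolP[p ->] /asboolP[p' ->]]|move=> a z /asboolP[c ->]];
    apply/asboolP.
  - by exists 0; rewrite rmorph0 scale0r.
  - by exists (p + p'); rewrite rmorphD scalerDl.
  - have [d ad] := vline a; exists (c * d).
    by rewrite scalerA -alg_central -scalerA ad scalerA -rmorphM.
pose Y1 := HB.pack_for (submodClosed V) Y (GRing.isSubmodClosed.Build P V Y Yc).
have vY : v \in Y1 by apply/asboolP; exists 1; rewrite rmorph1 scale1r.
apply/asboolP => S; apply; exists Y1 => //; split; first by exists v.
move=> U UY; have [[u uU u0]|nU] := pselect (exists2 u, u \in U & u != 0).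
  right=> z /asboolP[c ->]; have /asboolP[d ud] := UY u uU.
  have d0 : d != 0 by apply: contra u0 => /eqP d0; rewrite ud d0 rmorph0 scale0r.
  rewrite -[v]scale1r -(rmorph1 (alg_struct P)) -(mulVf d0) rmorphM -scalerA -ud.
  by rewrite !rpredZ.
by left=> u uU; apply: contrapT => /eqP u0; case: nU; exists u.
Qed.

Definition bset (J : {set T}) : P := \sum_(j in J) ep j.

Lemma bset_idemr (J : {set T}) j : bset J * ep j = if j \in J then ep j else 0.
Proof.
rewrite mulr_suml; case: ifP => [jJ|/negbT jJ].
  rewrite (bigD1 j) //= bidemM eqxx big1 ?addr0 // => i /andP[_ ij].
  by rewrite bidemM (negPf ij).
by rewrite big1 // => i iJ; rewrite bidemM; case: eqP iJ jJ => // -> ->.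
Qed.
Lemma bset_idem (J : {set T}) : bset J * bset J = bset J.
Proof.
by rewrite {2}/bset mulr_sumr; apply: eq_bigr => j jJ; rewrite bset_idemr jJ.
Qed.
Lemma bset_idem_l (J : {set T}) j : ep j * bset J = if j \in J then ep j else 0.
Proof.
rewrite mulr_sumr; case: ifP => [jJ|/negbT jJ].
  rewrite (bigD1 j) //= bidemM eqxx big1 ?addr0 // => i /andP[_ ij].
  by rewrite bidemM eq_sym (negPf ij).
by rewrite big1 // => i iJ; rewrite bidemM; case: eqP jJ iJ => // -> /negPf->.
Qed.
Lemma bset1 j : bset [set j] = ep j.
Proof. by rewrite /bset big_set1. Qed.
Lemma bchar_bset j (J : {set T}) : la j (bset J) = (j \in J)%:R.
Proof.
rewrite bchar_sum; under eq_bigr do rewrite bchar_idem.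
case: (boolP (j \in J)) => jJ.
  rewrite (bigD1 j) //= eqxx big1 ?addr0 // => i /andP[_ ij].
  by rewrite eq_sym (negPf ij).
by rewrite big1 // => i iJ; case: eqP iJ jJ => // -> ->.
Qed.

Lemma brad_corner (J : {set T}) x : bset J * x = x ->
  (forall j, j \in J -> la j x = 0) -> brad x.
Proof.
move=> Jx xJ i; case: (boolP (i \in J)) => [/xJ//|iJ].
by rewrite -Jx bcharM bchar_bset (negPf iJ) mul0r.
Qed.

Section Simple.
Variable j : T.
HB.instance Definition _ := GRing.Zmodule.on (bsimple bP j).
Definition bsimple_scale (p : P) (c : bsimple bP j) : bsimple bP j := la j p * c.
Fact bsimple_scaleA a b c : bsimple_scale a (bsimple_scale b c) = bsimple_scale (a * b) c.
Proof. by rewrite /bsimple_scale bcharM mulrA. Qed.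
Fact bsimple_scale1 : left_id 1 bsimple_scale.
Proof. by move=> c; rewrite /bsimple_scale bchar1 mul1r. Qed.
Fact bsimple_scaleDr : right_distributive bsimple_scale +%R.
Proof. by move=> a x y; apply: mulrDr. Qed.
Fact bsimple_scaleDl c : {morph bsimple_scale^~ c : a b / a + b}.
Proof. by move=> a b; rewrite /bsimple_scale bcharD mulrDl. Qed.
HB.instance Definition _ := GRing.Zmodule_isLmodule.Build P (bsimple bP j)
  bsimple_scaleA bsimple_scale1 bsimple_scaleDr bsimple_scaleDl.
Lemma bsimple_scaleE p (c : bsimple bP j) : p *: c = la j p * c.
Proof. by []. Qed.

Lemma bsimple_indecomposable : indecomposable (bsimple bP j).
Proof.
apply: indecomposable_idempotent => [/(_ (1 : k))/eqP|f ff].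
  by rewrite oner_eq0.
have fE (c : k) : f c = c * f (1 : k).
  by rewrite -[c in LHS]mulr1 -{1}(bchar_alg j c) -bsimple_scaleE linearZ_LR /=
     bsimple_scaleE bchar_alg.
have aa : f (1 : k) * f (1 : k) = f (1 : k) :> k by rewrite -fE ff.
have [a0|a0] := eqVneq (f (1 : k) : k) 0; first by left=> c; rewrite fE a0 mulr0.
by right=> c; rewrite fE (mulfI a0 (etrans aa (esym (mulr1 _)))) mulr1.
Qed.
End Simple.

End Basic.

(** * The socle and the indecomposable summands of Hom_k(g P, k) *)

Section CofreeSocle.
Variables (k : fieldType) (P : algebra k) (T : finType) (bP : basic P T).
Variables (J : {set T}).
Local Notation ep := (bidem bP).
Local Notation la := (bchar bP).
Local Notation Q := (cofree (bset bP J)).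

(** Such a form vanishes on rad P and factors through P / rad P = k^T, whose coordinates are the
    characters. Those outside J drop out because g e_j = 0 there. *)
Lemma cofree_brad (f : Q) : (forall p, brad bP p -> p *: f = 0) ->
  forall x, f x = \sum_(j in J) la j x * f (ep j).
Proof.
move=> rf x; pose y := x - \sum_j alg_struct P (la j x) * ep j.
have fy : f y = 0.
  by have := rf y (brad_sub bP x); move/(congr1 (fun h : Q => h 1)); rewrite cofree_scaleE mul1r.
rewrite -[x](subrK (\sum_j alg_struct P (la j x) * ep j)) cofreeD fy add0r.
rewrite cofree_sum (bigID (mem J)) /= addrC big1 ?add0r => [|j jJ].
  apply: eq_bigr => j _; rewrite cofreeZ; congr (_ * _).
  by rewrite -[la j x]/(la j x) subrK.
by rewrite cofreeZ -cofree_supp bset_idemr (negPf jJ) cofree0 mulr0.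
Qed.

Fact cofree_char_supp j x : j \in J -> la j (bset bP J * x) = la j x.
Proof. by move=> jJ; rewrite bcharM bchar_bset jJ mul1r. Qed.
Definition cofree_char j (jJ : j \in J) : Q :=
  Cofree (bchar_lin bP j) (fun x => cofree_char_supp x jJ).

Lemma cofree_char_scale j (jJ : j \in J) p :
  p *: cofree_char jJ = alg_struct P (la j p) *: cofree_char jJ.
Proof.
by apply: cofreeP => x; rewrite cofree_scaleE cofree_algE /= bcharM mulrC.
Qed.
Lemma cofree_char_neq0 j (jJ : j \in J) : cofree_char jJ != 0.
Proof.
apply/eqP => /(congr1 (fun f : Q => f 1)) /= /eqP.
by rewrite bchar1 oner_eq0.
Qed.

Lemma cofree_soc (f : Q) x : f \in soc Q -> f x = \sum_(j in J) la j x * f (ep j).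
Proof. by move=> fs; apply: cofree_brad => p rp; apply: soc_brad rp. Qed.

Lemma cofree_char_soc j (jJ : j \in J) : cofree_char jJ \in soc Q.
Proof.
apply: soc_eigen; first exact: cofree_char_neq0.
by move=> p; exists (la j p); apply: cofree_char_scale.
Qed.

(** For j in J this is Hom_k(e_j P, k), the injective module with socle at j. *)
Definition cofree_comp (j : T) : {pred Q} := [pred f | `[< forall x, (f : Q) (ep j * x) = f x >]].
Fact cofree_comp_closed j : GRing.subsemimod_closed (cofree_comp j).
Proof.
split; [split=> [|f h /asboolP fj /asboolP hj]|move=> p f /asboolP fj];
  apply/asboolP => x.
- by [].
- by rewrite !cofree_addE fj hj.
- by rewrite !cofree_scaleE -mulrA fj.
Qed.
HB.instance Definition _ j :=
  GRing.isSubmodClosed.Build P Q (cofree_comp j) (cofree_comp_closed j).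

Lemma cofree_compP j (f : Q) : reflect (forall x, f (ep j * x) = f x) (f \in cofree_comp j).
Proof. exact: asboolP. Qed.

Lemma cofree_comp_iso j : j \in J ->
  lin_iso (cofree (bset bP [set j])) (submod (cofree_comp j)).
Proof.
move=> jJ; pose F := cofree (bset bP [set j]).
have epF (f : F) x : f (ep j * x) = f x.
  by rewrite -[RHS]cofree_supp; congr (cofree_fun f (_ * _)); rewrite bset1.
have suppF (f : F) x : f (bset bP J * x) = f x.
  by rewrite -epF mulrA bset_idem_l jJ epF.
pose u (f : F) : Q := Cofree (cofree_lin f) (suppF f).
have uP f : u f \in cofree_comp j.
  by apply/cofree_compP => x /=; rewrite epF.
have [|g gE] := @ex_linear P F (submod (cofree_comp j)) (fun f => in_sub (uP f)).
  by move=> a f h; apply: val_inj; apply: cofreeP.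
exists g; rewrite gE.
have suppG (f : submod (cofree_comp j)) x : (val f : Q) (bset bP [set j] * x) = (val f : Q) x.
  by rewrite bset1; have /cofree_compP := valP f.
exists (fun f => Cofree (cofree_lin (val f)) (suppG f)) => f; first exact: cofreeP.
by apply: val_inj; apply: cofreeP.
Qed.

End CofreeSocle.

(** [b] spans P and the [co] are linear, possibly redundant, coordinates: in this form the property
    passes to corners and matrix algebras without a new choice of basis. *)
Definition finite_dim (k : fieldType) (P : algebra k) :=
  exists n (b : 'I_n -> P) (co : 'I_n -> P -> k),
    (forall i c x y, co i (alg_struct P c * x + y) = c * co i x + co i y) /\
    (forall x, x = \sum_i alg_struct P (co i x) * b i).

Section CofreeComponents.
Variables (k : fieldType) (P : algebra k) (T : finType) (bP : basic P T).
Variables (J : {set T}).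
Hypothesis fdP : finite_dim P.
Local Notation ep := (bidem bP).
Local Notation la := (bchar bP).
Local Notation Q := (cofree (bset bP J)).

(** An idempotent endomorphism f is given by some c in e_j P e_j. If f kills the character j, which
    spans the socle, then c lies in the radical and is nilpotent, so f = 0. Otherwise f fixes the
    character, and the same applies to 1 - f. *)
Lemma cofree_comp_indecomposable j : indecomposable (cofree (bset bP [set j])).
Proof.
set g := bset bP _; have gg : g * g = g by apply: bset_idem.
have jj : j \in [set j] by rewrite inE.
have [n [b [co [co_lin coE]]]] := fdP.
have key (f : {linear cofree g -> cofree g}) : (forall h, f (f h) = f h) ->
    f (cofree_char bP jj) = 0 -> forall h, f h = 0.
  move=> ff fj h; have [c gc fc] := cofree_endo gg co_lin coE f.
  have [|m cm] := @bnil _ _ _ bP c.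
    apply: (@brad_corner _ _ _ bP [set j]) => [|i].
      by rewrite -[in LHS]gc !mulrA gg gc.
    rewrite inE => /eqP ->; have /(congr1 (fun h : cofree g => h 1)) := fj.
    by rewrite fc mulr1.
  have fm l x : f h x = h (c ^+ l.+1 * x).
    elim: l x => [|l IH] x; first by rewrite fc.
    by rewrite -ff fc IH [in RHS]exprSr mulrA.
  apply: cofreeP => x; rewrite (fm m).
  by rewrite exprS cm mulr0 mul0r cofree0.
apply: indecomposable_idempotent => [z|f ff].
  by have /eqP := z (cofree_char bP jj); rewrite (negPf (cofree_char_neq0 _ _)).
have [c gc fc] := cofree_endo gg co_lin coE f.
have fj : f (cofree_char bP jj) = alg_struct P (la j c) *: cofree_char bP jj.
  by apply: cofreeP => x; rewrite fc cofree_algE /= bcharM.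
have /(congr1 (fun h : cofree g => h 1)) := ff (cofree_char bP jj).
rewrite fj linearZ_LR fj !cofree_algE /= bchar1 !mulr1 => cc.
have [c0|c0] := eqVneq (la j c) 0.
  by left; apply: key => //; rewrite fj c0 rmorph0 scale0r.
have c1 : la j c = 1 by apply: (mulfI c0); rewrite cc mulr1.
have [|f' f'E] := @ex_linear P _ _ (fun h => h - f h).
  by move=> a x y; rewrite linearP scalerBr addrACA opprD.
right=> h; apply/eqP; rewrite eq_sym -subr_eq0; apply/eqP.
have := key f'; rewrite f'E; apply=> [{}h|].
  by rewrite linearB ff subrr subr0.
by rewrite fj c1 rmorph1 scale1r subrr.
Qed.

Lemma cofree_comp_soc j (jJ : j \in J) (v : submod (cofree_comp (bP := bP) (J := J) j)) :
  v \in soc _ -> val v = alg_struct P ((val v : Q) (ep j)) *: cofree_char bP jJ.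
Proof.
move=> vs; apply: cofreeP => x; rewrite cofree_algE /=.
rewrite cofree_brad => [|p rp].
  rewrite (bigD1 j) //= big1 ?addr0 => [|i /andP[_ ij]]; first by rewrite mulrC.
  have /cofree_compP <- := valP v.
  by rewrite bidemM eq_sym (negPf ij) cofree0 mulr0.
by have /(congr1 val) := soc_brad vs rp.
Qed.

Lemma cofree_comp_simple_soc j : j \in J ->
  exists v : submod (soc (submod (cofree_comp (bP := bP) (J := J) j))),
  [/\ v != 0, ep j *: v = v & forall w, exists c : k, w = alg_struct P c *: v].
Proof.
move=> jJ.
have cj : cofree_char bP jJ \in cofree_comp (bP := bP) (J := J) j.
  by apply/cofree_compP => x /=; rewrite bcharM bchar_idem eqxx mul1r.
have vline p : p *: in_sub cj = alg_struct P (la j p) *: in_sub cj.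
  by apply: val_inj; rewrite /= cofree_char_scale.
have vs : in_sub cj \in soc (submod (cofree_comp (bP := bP) (J := J) j)).
  apply: soc_eigen => [|p]; last by exists (la j p).
  by apply/eqP => /(congr1 val) /eqP; rewrite (negPf (cofree_char_neq0 bP jJ)).
exists (in_sub vs); split=> [||w].
- by apply/eqP => /(congr1 val) /(congr1 val) /eqP; rewrite (negPf (cofree_char_neq0 bP jJ)).
- by apply: val_inj; rewrite /= vline bchar_idem eqxx rmorph1 scale1r.
- exists ((val (val w) : Q) (ep j)); apply: val_inj; apply: val_inj => /=.
  exact: cofree_comp_soc (valP w).
Qed.

Lemma cofree_decomposition (f : Q) : exists! u : {ffun T -> Q},
  [/\ forall j, j \in J -> u j \in cofree_comp (bP := bP) (J := J) j,
      forall j, j \notin J -> u j = 0 & f = \sum_j u j].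
Proof.
have compD j c x y :
  f (ep j * (alg_struct P c * x + y)) = c * f (ep j * x) + f (ep j * y).
  by rewrite mulrDr mulrA -alg_central -mulrA cofree_lin.
have compJ j : j \in J -> forall x, f (ep j * (bset bP J * x)) = f (ep j * x).
  by move=> jJ x; rewrite mulrA bset_idem_l jJ.
pose comp j : Q := match pselect (j \in J) with
  | left jJ => Cofree (compD j) (compJ j jJ) | right _ => 0 end.
have compE j x : j \in J -> comp j x = f (ep j * x).
  by rewrite /comp; case: pselect.
have comp0 j : j \notin J -> comp j = 0.
  by rewrite /comp; case: pselect => // jJ /negP[].
exists [ffun j => comp j]; split.
  split=> [j jJ|j jJ|].
  - apply/cofree_compP => x; rewrite ffunE !compE // mulrA bidemM eqxx //.
  - by rewrite ffunE comp0.
  - apply: cofreeP => x; rewrite cofree_sumE (bigID (mem J)) /= addrC big1.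
      rewrite add0r -cofree_supp mulr_suml cofree_sum; apply: eq_bigr => j jJ.
      by rewrite ffunE compE.
    by move=> j jJ; rewrite ffunE (comp0 j jJ).
move=> u [uJ uJ' fE]; apply/ffunP => j; rewrite ffunE.
case: (boolP (j \in J)) => jJ; last first.
  by rewrite uJ' // comp0.
apply: cofreeP => x; rewrite compE // fE cofree_sumE (bigD1 j) //= big1 ?addr0.
  by have /cofree_compP -> := uJ j jJ.
move=> i ij; case: (boolP (i \in J)) => iJ; last by rewrite uJ'.
have /cofree_compP <- := uJ i iJ.
by rewrite mulrA bidemM (negPf ij) mul0r cofree0.
Qed.

(** Evaluation at e_j splits the inclusion of the line spanned by the character j. *)
Lemma bsimple_ind_soc j : j \in J -> ind (submod (soc Q)) (bsimple bP j).
Proof.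
move=> jJ; split; first exact: bsimple_indecomposable.
have [|f fE] := @ex_linear P (submod (soc Q)) (bsimple bP j)
    (fun w => (val w : Q) (ep j)).
  move=> p f h; rewrite -[val (p *: f + h)]/(p *: val f + val h).
  rewrite cofree_addE bsimple_scaleE; congr (_ + _).
  rewrite cofree_scaleE (cofree_soc _ (valP f)) (bigD1 j) //= big1 ?addr0.
    by rewrite bcharM bchar_idem eqxx mul1r.
  move=> i /andP[_ ij]; rewrite bcharM bchar_idem (negPf ij) mul0r mul0r //.
have [|h hE] := @ex_linear P (bsimple bP j) (submod (soc Q))
    (fun c => alg_struct P (c : k) *: in_sub (cofree_char_soc bP jJ)).
  move=> p c d; apply: val_inj; set w := cofree_char bP jJ.
  change (alg_struct P (p *: c + d : bsimple bP j) *: w =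
    p *: (alg_struct P (c : k) *: w) + alg_struct P (d : k) *: w).
  have -> : p *: (alg_struct P (c : k) *: w) = alg_struct P (la j p * c) *: w.
    rewrite mulrC rmorphM -scalerA -cofree_char_scale -/w !scalerA.
    by rewrite alg_central.
  by rewrite -scalerDl -rmorphD.
exists (submod (kernel f)); apply: (@split_decomposition _ _ _ f h) => c.
rewrite fE hE.
by rewrite [LHS](cofree_algE _ (cofree_char bP jJ)) /= bchar_idem eqxx mulr1.
Qed.

(** Embed S in soc Q. Some s in S has a nonzero value at some e_j, and e_j s is then a nonzero
    multiple of the character j. So the simple module at j splits off S. *)
Lemma ind_soc_bsimple (S : lmodType P) : ind (submod (soc Q)) S ->
  exists2 j, j \in J & lin_iso S (bsimple bP j).
Proof.
move=> [[nzS indS] [Y /lin_iso_sym[u ub]]].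
have [|m mE] := @ex_linear P S Q (fun s => val (u (s, 0))).
  move=> a x y; rewrite -[RHS]/(val (a *: u (x, 0) + u (y, 0))) -linearP.
  by congr (val (u _)); apply: injective_projections; rewrite //= scaler0 addr0.
have ms s : m s \in soc Q by rewrite mE; apply: valP.
have minj s : m s = 0 -> s = 0.
  rewrite mE => ms0; have /(bij_inj ub)[] // : u (s, 0) = u 0.
  by apply: val_inj; rewrite ms0 linear0.
have [s [j jJ sj]] : exists s, exists2 j, j \in J & m s (ep j) != 0.
  apply: contrapT => nex; apply: nzS => s; apply: minj; apply: cofreeP => x.
  rewrite (cofree_soc _ (ms s)) big1 // => j jJ.
  have [->|mj] := eqVneq (m s (ep j)) 0; first by rewrite mulr0.
  by case: nex; exists s, j.
exists j => //.
have scaleE p f : f \in soc Q -> (p *: f : Q) (ep j) = la j p * f (ep j).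
  move=> fs; rewrite cofree_scaleE (cofree_soc _ fs) (bigD1 j) //= big1 ?addr0.
    by rewrite bcharM bchar_idem eqxx mul1r.
  by move=> i /andP[_ ij]; rewrite bcharM bchar_idem (negPf ij) mul0r mul0r.
have [|f fE] := @ex_linear P S (bsimple bP j) (fun s => m s (ep j)).
  by move=> a x y; rewrite linearP cofree_addE scaleE.
have [s' ms'] : exists s', m s' = cofree_char bP jJ.
  exists (alg_struct P (m s (ep j))^-1 *: (ep j *: s)).
  rewrite !linearZ_LR /=; apply: cofreeP => x.
  rewrite cofree_algE cofree_scaleE (cofree_soc (x * ep j) (ms s)) (bigD1 j) //= big1.
    by rewrite addr0 bcharM bchar_idem eqxx mulr1 mulrCA mulVf ?mulr1.
  by move=> i /andP[_ ij]; rewrite bcharM bchar_idem (negPf ij) mulr0 mul0r.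
have s'line p : p *: s' = alg_struct P (la j p) *: s'.
  apply/eqP; rewrite -subr_eq0; apply/eqP/minj; rewrite linearB.
  by rewrite 2!(linearZ_LR m) ms' -cofree_char_scale subrr.
have [|h hE] := @ex_linear P (bsimple bP j) S (fun c => alg_struct P (c : k) *: s').
  move=> p c d; rewrite rmorphD scalerDl; congr (_ + _).
  by rewrite bsimple_scaleE mulrC rmorphM -scalerA -s'line scalerA alg_central -scalerA.
exists f; apply: (@indecomposable_split _ _ _ f h).
- by move=> c; rewrite fE hE linearZ_LR cofree_algE ms' /= bchar_idem eqxx mulr1.
- by split.
- by case: (bsimple_indecomposable bP j).
Qed.

End CofreeComponents.

(** * The order of a gluing datum *)

(* The data (Ah, e, kap) from which the order A = ord G is cut out: Ah e is a
   right module over E = e Ah e, generated by the u l with dual basis the v l,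
   and kap identifies Ah e / A e with Q as a bimodule over A and E, where E
   acts on Q through the whole of End(Q). *)
Record glue (k : fieldType) (Pi : algebra k) (Q : lmodType Pi) := Glue {
  gring : algebra (fps k);
  gid : gring;
  gkap : {additive gring -> Q};
  grank : nat;
  gu : 'I_grank -> gring;
  gv : 'I_grank -> gring;
  gidP : gid * gid = gid;
  guv : \sum_l gu l * gv l = 1;
  gue : forall l, gu l * gid = gu l;
  gev : forall l, gid * gv l = gv l;
  gkap_id : gkap gid = 0;
  gkap_mulid : forall z, gkap (z * gid) = gkap z;
  gkap_surj : forall q, exists z, gkap z = q;
  gkap_right : forall c, exists th : {linear Q -> Q},
    forall z, gkap (z * gid * c) = th (gkap z);
  gkap_endo : forall th : {linear Q -> Q}, exists c,
    forall z, gkap (z * gid * c) = th (gkap z);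
  gkap_scale : forall r z,
    gkap (alg_struct gring r * z) = alg_struct Pi (fps_coef r 0) *: gkap z;
  gtf : forall r z, alg_struct gring r * z = 0 -> r = 0 \/ z = 0
}.

Arguments gkap_surj {k Pi Q} G q : rename.
Arguments gkap_right {k Pi Q} G c : rename.
Arguments gkap_endo {k Pi Q} G th : rename.
Arguments grank {k Pi Q} G : rename.
Arguments guv {k Pi Q} G : rename.

Definition fpsX (k : fieldType) : fps k := Fps (fun n => (n == 1%N)%:R).

Lemma fpsX_neq0 (k : fieldType) : fpsX k != 0.
Proof.
by apply/eqP => /(congr1 (fun f => fps_coef f 1)) /eqP; rewrite /= oner_eq0.
Qed.

Section Glue.
Variables (k : fieldType) (Pi : algebra k) (Q : lmodType Pi) (G : glue Q).
Local Notation Ah := (gring G).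
Local Notation e := (gid G).
Local Notation kap := (gkap G).
Local Notation u := (@gu _ _ _ G).
Local Notation v := (@gv _ _ _ G).

(** A relation, since [a] determines [b] only modulo the annihilator of Q. *)
Definition acts_as (a : Ah) (b : Pi) := forall z, kap (a * z) = b *: kap z.

Definition stab : {pred Ah} := [pred a | `[< exists b, acts_as a b >]].

Lemma acts_asB a b a' b' : acts_as a b -> acts_as a' b' -> acts_as (a - a') (b - b').
Proof. by move=> ab ab' z; rewrite mulrBl raddfB ab ab' scalerBl. Qed.
Lemma acts_asM a b a' b' : acts_as a b -> acts_as a' b' -> acts_as (a * a') (b * b').
Proof. by move=> ab ab' z; rewrite -mulrA ab ab' scalerA. Qed.
Lemma acts_as1 : acts_as 1 1.
Proof. by move=> z; rewrite mul1r scale1r. Qed.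
Lemma acts_as_alg r : acts_as (alg_struct Ah r) (alg_struct Pi (fps_coef r 0)).
Proof. by move=> z; rewrite gkap_scale. Qed.

Fact stab_closed : subring_closed stab.
Proof.
split=> [|a a' /asboolP[b ab] /asboolP[b' ab']|a a' /asboolP[b ab] /asboolP[b' ab']];
  apply/asboolP.
- by exists 1; apply: acts_as1.
- by exists (b - b'); apply: acts_asB.
- by exists (b * b'); apply: acts_asM.
Qed.
HB.instance Definition _ := GRing.isSubringClosed.Build Ah stab stab_closed.

Definition ord_sort : Type := {a : Ah | a \in stab}.
HB.instance Definition _ := SubChoice.on ord_sort.
HB.instance Definition _ :=
  GRing.SubChoice_isSubPzRing.Build Ah (mem stab) ord_sort stab_closed.

Definition in_ord (a : Ah) (aS : a \in stab) : ord_sort := exist (fun a => a \in stab) a aS.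

Fact ord_alg_subproof r : alg_struct Ah r \in stab.
Proof. by apply/asboolP; exists (alg_struct Pi (fps_coef r 0)); apply: acts_as_alg. Qed.
Definition ord_alg (r : fps k) : ord_sort := in_ord (ord_alg_subproof r).
Fact ord_alg_zmod : zmod_morphism ord_alg.
Proof. by move=> r s; apply: val_inj; rewrite /= rmorphB. Qed.
Fact ord_alg_monoid : monoid_morphism ord_alg.
Proof. by split=> [|r s]; apply: val_inj; rewrite /= ?rmorph1 ?rmorphM. Qed.
HB.instance Definition _ :=
  GRing.isZmodMorphism.Build (fps k) ord_sort ord_alg ord_alg_zmod.
HB.instance Definition _ :=
  GRing.isMonoidMorphism.Build (fps k) ord_sort ord_alg ord_alg_monoid.
Fact ord_central c (x : ord_sort) : ord_alg c * x = x * ord_alg c.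
Proof. by apply: val_inj; apply: (alg_central c (val x)). Qed.
Definition ord : algebra (fps k) := Algebra ord_central.

Implicit Types a : ord.

Definition ov (a : ord) : Ah := val a.
Lemma ov_inj : injective ov. Proof. exact: val_inj. Qed.
Lemma ovM a b : ov (a * b) = ov a * ov b. Proof. by []. Qed.
Lemma ovD a b : ov (a + b) = ov a + ov b. Proof. by []. Qed.
Lemma ovB a b : ov (a - b) = ov a - ov b. Proof. by []. Qed.
Lemma ov0 : ov 0 = 0. Proof. by []. Qed.
Lemma ov1 : ov 1 = 1. Proof. by []. Qed.
Lemma ov_alg r : ov (alg_struct ord r) = alg_struct Ah r. Proof. by []. Qed.
Lemma ov_sum (I : Type) (r : seq I) (q : pred I) (F : I -> ord) :
  ov (\sum_(i <- r | q i) F i) = \sum_(i <- r | q i) ov (F i).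
Proof. by elim/big_rec2: _ => // i x y _ <-. Qed.

Definition is_ord (z : Ah) := exists a, ov a = z.

Lemma ov_acts a : exists b, acts_as (ov a) b.
Proof. by have /asboolP := valP a. Qed.
Lemma acts_ord z b : acts_as z b -> is_ord z.
Proof.
move=> zb; have zS : z \in stab by apply/asboolP; exists b.
by exists (in_ord zS).
Qed.

(** If z in Ah e acts as b, then kap z = kap(z e) = b kap e = 0. Conversely, kap(z e w) depends on
    kap z only, so z acts as 0 once kap z = 0. *)
Lemma is_ord_kap z : z * e = z -> is_ord z <-> kap z = 0.
Proof.
move=> ze; split=> [[a <-]|kz].
  have [b ab] := ov_acts a; rewrite -gkap_mulid ab gkap_id scaler0 //.
apply: (@acts_ord _ 0) => w; have [th thE] := gkap_right G w.
by rewrite scale0r -ze thE kz linear0.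
Qed.

(** The right action of E on Q turns kap e = 0 into kap(e w) = 0 for all w, so e Ah acts as 0. Hence
    eA = e Ah and eAe = e Ah e. *)
Lemma is_ord_left z : e * z = z -> is_ord z.
Proof.
move=> ez; apply: (@acts_ord _ 0) => w.
have [th thE] := gkap_right G (z * w).
by rewrite scale0r -ez -mulrA -{1}gidP -mulrA mulrA thE gkap_id linear0.
Qed.

Lemma gkap_acts_ord a z : acts_as (ov a) 0 -> kap (ov a * z) = 0.
Proof. by move=> ->; rewrite scale0r. Qed.

Lemma is_ord_id : is_ord e.
Proof. by apply: is_ord_left; apply: gidP. Qed.

Fact oid_subproof : exists a : ord, ov a = e.
Proof. exact: is_ord_id. Qed.
Definition oid_elt : ord := sval (cid oid_subproof).
Lemma ov_oid_elt : ov oid_elt = e.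
Proof. exact: (svalP (cid oid_subproof)). Qed.
Fact oid_idem : oid_elt * oid_elt = oid_elt.
Proof. by apply: ov_inj; rewrite ovM ov_oid_elt gidP. Qed.
Definition oid : idem ord := Idem oid_idem.
Local Notation oe := (idem_val oid).
Lemma ov_oid : ov oe = e. Proof. exact: ov_oid_elt. Qed.

Fact ov_gv_subproof : exists w : 'I_(grank G) -> ord, forall l, ov (w l) = v l.
Proof.
have vP l : exists a, ov a = v l by apply: is_ord_left; apply: gev.
by have [w wE] := choice vP; exists w.
Qed.
Definition ogv : 'I_(grank G) -> ord := sval (cid ov_gv_subproof).
Lemma ov_ogv l : ov (ogv l) = v l.
Proof. exact: (svalP (cid ov_gv_subproof)). Qed.

Lemma acts_oid : acts_as (ov oe) 0.
Proof.
move=> z; rewrite scale0r ov_oid; have [th thE] := gkap_right G z.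
by rewrite -{1}gidP thE gkap_id linear0.
Qed.

(* The kernel of the action on Q is the ideal generated by e. *)
Lemma acts_as0 a : acts_as (ov a) 0 <->
  exists x : 'I_(grank G) -> ord, (forall l, x l * oe = x l) /\ a = \sum_l x l * ogv l.
Proof.
split=> [a0|[x [xe ->]] z]; last first.
  rewrite ov_sum mulr_suml raddf_sum big1 ?scale0r // => l _.
  rewrite ovM -xe ovM -!mulrA; have [b ->] := ov_acts (x l).
  by rewrite acts_oid scale0r scaler0.
have xP l : is_ord (ov a * u l).
  by apply/is_ord_kap; rewrite -?mulrA ?gue //; apply: gkap_acts_ord.
have [x xE] := choice xP; exists x; split=> [l|]; apply: ov_inj.
  by rewrite ovM xE ov_oid -mulrA gue.
rewrite ov_sum; under eq_bigr do rewrite ovM xE ov_ogv -mulrA.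
by rewrite -mulr_sumr guv mulr1.
Qed.

(** The action of [b] on Q is E-linear and lifts along kap because Ah e is projective over E: [u l]
    is sent to any preimage of b kap(u_l). *)
Lemma acts_surj (b : Pi) : exists a, acts_as (ov a) b.
Proof.
have [z zE] := choice (fun l => gkap_surj G (b *: kap (u l))).
suff zb : acts_as (\sum_l z l * e * v l) b.
  by have [a aE] := acts_ord zb; exists a; rewrite aE.
move=> w; transitivity (\sum_l b *: kap (u l * (v l * w))); last first.
  rewrite -scaler_sumr -raddf_sum; under eq_bigr do rewrite mulrA.
  by rewrite -mulr_suml guv mul1r.
rewrite mulr_suml raddf_sum; apply: eq_bigr => l _.
have [th thE] := gkap_right G (v l * w).
by rewrite -mulrA thE zE linearZ_LR -thE gue.
Qed.

(** Since t acts by 0 on Q, t Ah e is contained in A e. *)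
Lemma torsion_kap z : z * e = z -> is_ord (alg_struct Ah (fpsX k) * z).
Proof.
move=> ze; apply/is_ord_kap; first by rewrite -mulrA ze.
by rewrite gkap_scale /= rmorph0 scale0r.
Qed.

End Glue.

(** * Vanishing of Ext^1 *)

Section GlueModules.
Variables (k : fieldType) (Pi : algebra k) (Q : lmodType Pi) (G : glue Q).
Local Notation Ah := (gring G).
Local Notation e := (gid G).
Local Notation kap := (gkap G).
Local Notation u := (@gu _ _ _ G).
Local Notation v := (@gv _ _ _ G).
Local Notation A := (ord G).
Local Notation oe := (idem_val (oid G)).
Local Notation t := (alg_struct A (fpsX k)).
Local Notation Ae := (submod (left_ideal oe)).

Definition torsion_free (X : lmodType A) := forall x : X, t *: x = 0 -> x = 0.

(** An E-linear map eX -> E, extended to X through x |-> e x. *)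
Definition corner_linear (X : lmodType A) (rho : X -> A) :=
  [/\ forall x y, rho (x + y) = rho x + rho y,
      forall a x, oe * a * oe = a -> rho (a *: x) = a * rho x &
      forall x, oe * rho x * oe = rho x].

(** A-linearity of a map into Q, where A acts only through the relation [acts_as]. *)
Definition acts_linear (X : lmodType A) (f : X -> Q) :=
  (forall x y, f (x + y) = f x + f y) /\
  forall a b x, acts_as (ov a) b -> f (a *: x) = b *: f x.

Lemma acts_linear0 (X : lmodType A) (f : X -> Q) : acts_linear f -> f 0 = 0.
Proof. by case=> fD _; apply: (addIr (f 0)); rewrite -fD !add0r. Qed.

Lemma acts_linear_oid (X : lmodType A) (f : X -> Q) x :
  acts_linear f -> f (oe *: x) = 0.
Proof. by case=> _ fZ; rewrite (fZ _ _ _ (@acts_oid _ _ _ G)) scale0r. Qed.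

Lemma free_torsion_free (X : lmodType A) : free_of_finite_rank X -> torsion_free X.
Proof.
case=> n [b bP] x tx; have [c [cE _]] := bP x.
have [c0 [_ c0u]] := bP 0.
have c1 : c0 = [ffun=> 0].
  by apply: c0u; rewrite big1 // => i _; rewrite ffunE rmorph0 scale0r.
have c2 : c0 = [ffun i => fpsX k * c i].
  apply: c0u; rewrite -[LHS]tx [in LHS]cE scaler_sumr; apply: eq_bigr => i _.
  by rewrite ffunE rmorphM scalerA.
rewrite cE big1 // => i _; have := congr1 (fun f : {ffun _ -> _} => f i) (etrans (esym c1) c2).
rewrite !ffunE => /esym/eqP; rewrite mulf_eq0 (negPf (fpsX_neq0 k)) /= => /eqP ->.
by rewrite rmorph0 scale0r.
Qed.

(** Every t u_l lies in A, so t = sum_l (t u_l) v_l is a combination of the v_l with coefficients in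
    A. *)
Lemma torsion_of_gv (X : lmodType A) (x : X) :
  (forall l, ogv l *: x = 0) -> t *: x = 0.
Proof.
move=> vx; have tu l : is_ord (alg_struct Ah (fpsX k) * u l).
  by apply: torsion_kap; apply: gue.
have [w wE] := choice tu.
have -> : t = \sum_l w l * ogv l.
  apply: ov_inj; rewrite ov_alg ov_sum.
  under eq_bigr do rewrite ovM wE ov_ogv -mulrA.
  by rewrite -mulr_sumr guv mulr1.
rewrite scaler_suml big1 // => l _; by rewrite -scalerA vx scaler0.
Qed.

Section Lift.
Variables (X : lmodType A) (rho : X -> A).
Hypothesis rhoP : corner_linear rho.

Lemma corner_linear0 : rho 0 = 0.
Proof. by case: rhoP => rD _ _; apply: (addIr (rho 0)); rewrite -rD !add0r. Qed.

Lemma corner_linear_sum (I : Type) (r : seq I) (F : I -> X) :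
  rho (\sum_(i <- r) F i) = \sum_(i <- r) rho (F i).
Proof.
case: (rhoP) => rD _ _.
by elim/big_rec2: _ => [|i x y _ <-]; rewrite ?corner_linear0 ?rD.
Qed.

(* The A-linear map X -> Hom_E(eA, E) = Ah e induced by rho : eX -> E. *)
Definition colift (x : X) : Ah := \sum_l u l * ov (rho (ogv l *: x)).

Lemma coliftD x y : colift (x + y) = colift x + colift y.
Proof.
case: rhoP => rD _ _; rewrite -big_split; apply: eq_bigr => l _ /=.
by rewrite scalerDr rD ovD mulrDr.
Qed.

Lemma colift_id x : colift x * e = colift x.
Proof.
case: rhoP => _ _ re; rewrite mulr_suml; apply: eq_bigr => l _.
by rewrite -(re (ogv l *: x)) !ovM ov_oid -!mulrA gidP.
Qed.

(** As b lies in eA, each b u_l lies in E and b = sum_l (b u_l) v_l; linearity of rho over E moves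
    the b u_l outside. *)
Lemma colift_corner b x : oe * b = b -> ov b * colift x = ov (rho (b *: x)).
Proof.
move=> eb; have [rD rZ re] := rhoP.
have cP l : is_ord (ov b * u l).
  by apply: is_ord_left; rewrite mulrA -[X in X * ov b](ov_oid G) -ovM eb.
have [c cE] := choice cP.
have ec l : oe * c l * oe = c l.
  apply: ov_inj; rewrite !ovM cE ov_oid -!mulrA gue !mulrA.
  by rewrite -[X in X * ov b](ov_oid G) -ovM eb.
have bE : b = \sum_l c l * ogv l.
  apply: ov_inj; rewrite ov_sum; under eq_bigr do rewrite ovM cE ov_ogv -mulrA.
  by rewrite -mulr_sumr guv mulr1.
rewrite [in RHS]bE scaler_suml corner_linear_sum ov_sum mulr_sumr.
by apply: eq_bigr => l _; rewrite -scalerA [in RHS]rZ // ovM cE mulrA.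
Qed.

Lemma ogv_corner l : oe * ogv l = ogv l :> A.
Proof. by apply: ov_inj; rewrite ovM ov_oid ov_ogv gev. Qed.

Lemma colift_linear a x : colift (a *: x) = ov a * colift x.
Proof.
rewrite -[ov a]mul1r -(guv G) !mulr_suml; apply: eq_bigr => l _.
rewrite scalerA -[ov (rho _)]colift_corner; last by rewrite mulrA ogv_corner.
by rewrite ovM ov_ogv !mulrA.
Qed.

End Lift.
End GlueModules.

Section GlueExt1.
Variables (k : fieldType) (Pi : algebra k) (Q : lmodType Pi) (G : glue Q).
Local Notation Ah := (gring G).
Local Notation e := (gid G).
Local Notation kap := (gkap G).
Local Notation A := (ord G).
Local Notation oe := (idem_val (oid G)).
Local Notation Ae := (submod (left_ideal oe)).
Hypothesis injQ : injective_mod Q.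

Lemma left_idealP (w : Ae) : (val w : A) * oe = val w.
Proof. by have [b ->] := val_left_idealP w; rewrite -mulrA idemP. Qed.

Lemma ov_left_ideal (w : Ae) : ov (val w : A) * e = ov (val w : A).
Proof. by rewrite -(ov_oid G) -ovM left_idealP. Qed.

Lemma left_ideal_of (z : Ah) : z * e = z -> kap z = 0 ->
  exists w : Ae, ov (val w : A) = z.
Proof.
move=> ze /(is_ord_kap ze)[a az].
have [w wE] := left_ideal_mem oe a; exists w.
by rewrite wE ovM az ov_oid ze.
Qed.

Lemma kap_left_ideal (w : Ae) : kap (ov (val w : A)) = 0.
Proof. by apply/(is_ord_kap (ov_left_ideal w)); exists (val w). Qed.

Lemma kap_colift_acts (X : lmodType A) (rho : X -> A) : corner_linear rho ->
  acts_linear (fun x => kap (colift rho x)).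
Proof.
move=> rhoP; split=> [x y|a b x ab]; first by rewrite coliftD ?raddfD.
by rewrite colift_linear.
Qed.

Lemma dual_basis_corner_linear (X : lmodType A) n (y : 'I_n -> X) p :
  dual_basis (oid G) y p -> forall i, corner_linear (p i).
Proof. by case=> [ey pD pZ pe xE] i; split; [apply: pD|apply: pZ|apply: pe]. Qed.

Lemma oid_sum (X : lmodType A) n (y : 'I_n -> X) p x : dual_basis (oid G) y p ->
  oe *: x = \sum_i p i x *: y i.
Proof. by case. Qed.

(* The kernel of X -> Q^n lies in A e X because X has no torsion. *)
Lemma acts_linear_kernel (X : lmodType A) n (y : 'I_n -> X) p (phi : X -> Q) :
  torsion_free X -> dual_basis (oid G) y p -> acts_linear phi ->
  forall x, (forall i, kap (colift (p i) x) = 0) -> phi x = 0.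
Proof.
move=> tfX db phiP x kx; have pP := dual_basis_corner_linear db.
have wP i : exists w : A, ov w = colift (p i) x.
  by apply/(is_ord_kap (colift_id (pP i) x)); apply: kx.
have [w wE] := choice wP.
suff -> : x = \sum_i w i *: y i.
  have phi_sum I (r : seq I) F : phi (\sum_(i <- r) F i) = \sum_(i <- r) phi (F i).
    by elim/big_rec2: _ => [|j z z' _ <-]; rewrite ?acts_linear0 //; case: phiP.
  rewrite phi_sum big1 // => i _; have [b wb] := ov_acts (w i).
  have [yE _ _ _ _] := db.
  by rewrite (phiP.2 _ b) // -yE acts_linear_oid ?scaler0.
apply/eqP; rewrite -subr_eq0; apply/eqP/tfX/torsion_of_gv => l.
rewrite scalerBr scaler_sumr -[ogv l]ogv_corner -[X in X - _]scalerA (oid_sum _ db).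
rewrite -sumrB big1 // => i _; rewrite scalerA -scalerBl.
suff -> : oe * ogv l * w i = p i (ogv l *: x) by rewrite subrr scale0r.
by apply: ov_inj; rewrite ogv_corner ovM wE colift_corner ?ogv_corner.
Qed.

(** This lifts phi along kap to Ah e. The maps kap(colift(p_i)) form Psi : X -> Q^n; phi factors
    through the image of Psi by [acts_linear_kernel], and injectivity of Q extends the factor to a
    map g : Q^n -> Q. *)
Lemma acts_linear_factor (X : lmodType A) n (y : 'I_n -> X) p (phi : X -> Q) :
  torsion_free X -> dual_basis (oid G) y p -> acts_linear phi ->
  exists c : 'I_n -> Ah, forall x, phi x = \sum_i kap (colift (p i) x * e * c i).
Proof.
move=> tfX db phiP; have pP := dual_basis_corner_linear db.
pose F : lmodType Pi := {ffun 'I_n -> Q}.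
pose Psi x : F := [ffun i => kap (colift (p i) x)].
have PsiD x x' : Psi (x + x') = Psi x + Psi x'.
  by apply/ffunP => i; rewrite !ffunE (kap_colift_acts (pP i)).1.
have PsiZ a b x : acts_as (ov a) b -> Psi (a *: x) = b *: Psi x.
  by move=> ab; apply/ffunP => i; rewrite !ffunE ((kap_colift_acts (pP i)).2 _ _ _ ab).
have Psi0 : Psi 0 = 0 by apply: (addIr (Psi 0)); rewrite -PsiD !add0r.
pose im : {pred F} := [pred z | `[< exists x, z = Psi x >]].
have imc : GRing.subsemimod_closed im.
  split; [split=> [|z z' /asboolP[x ->] /asboolP[x' ->]]|move=> b z /asboolP[x ->]];
    apply/asboolP.
  - by exists 0.
  - by exists (x + x').
  - by have [a ab] := acts_surj G b; exists (a *: x); rewrite (PsiZ a b).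
pose Im := HB.pack_for (submodClosed F) im (GRing.isSubmodClosed.Build Pi F im imc).
pose r (z : submod Im) (q : Q) := exists x, val z = Psi x /\ q = phi x.
have [|q [x [zx ->]]|b z z' q q' [x [zx ->]] [x' [zx' ->]]|th thP] := linear_of_rel (r := r).
- by move=> z; have /asboolP[x zx] := valP z; exists (phi x), x.
- apply: (acts_linear_kernel tfX db phiP) => i.
  by have /(congr1 (fun f : F => f i)) := zx; rewrite !ffunE => <-.
- have [a ab] := acts_surj G b; exists (a *: x + x'); split.
    by rewrite PsiD (PsiZ a b) // -zx -zx'.
  by rewrite phiP.1 (phiP.2 a b).
have [g gE] := @injQ (submod Im) F (val : {linear submod Im -> F}) th val_inj.
pose inc i (q : Q) : F := [ffun j => if j == i then q else 0].
(* The restrictions of g to the n factors are endomorphisms of Q, hence induced by right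
   multiplications in Ah. *)
have [th' th'E] : exists th' : 'I_n -> {linear Q -> Q}, forall i q, th' i q = g (inc i q).
  suff H i : exists f : {linear Q -> Q}, forall q, f q = g (inc i q).
    by have [f fE] := choice H; exists f.
  have [|f fE] := @ex_linear Pi Q Q (fun q => g (inc i q)); last by exists f; rewrite fE.
  move=> b q q'; rewrite -linearP; congr (g _); apply/ffunP => j; rewrite !ffunE.
  by case: ifP => // _; rewrite scaler0 addr0.
have [c cE] := choice (fun i => gkap_endo G (th' i)).
exists c => x; have xIm : Psi x \in Im by apply/asboolP; exists x.
have -> : phi x = th (in_sub xIm) by apply/thP; exists x.
rewrite -gE; change (g (Psi x) = \sum_i kap (colift (p i) x * e * c i)).
rewrite (_ : Psi x = \sum_i inc i (kap (colift (p i) x))).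
  by rewrite linear_sum; apply: eq_bigr => i _; rewrite cE th'E.
apply/ffunP => j; rewrite sum_ffunE ffunE (bigD1 j) //= big1 ?addr0.
  by rewrite ffunE eqxx.
by move=> i ij; rewrite ffunE eq_sym (negPf ij).
Qed.

Section Retraction.
Variables (X E : lmodType A) (i : {linear Ae -> E}) (p : {linear E -> X}).
Hypothesis ip : short_exact i p.
Variables (n : nat) (y : 'I_n -> X) (q : 'I_n -> X -> A).
Hypothesis db : dual_basis (oid G) y q.

(** Multiplication by e keeps the sequence exact, and it then splits because eX is projective over
    E. *)
Lemma corner_retraction : exists2 rho : E -> A, corner_linear rho &
  forall w, rho (i w) = oe * val w.
Proof.
have [inji surjp exip] := ip; have [ey qD qZ qe xE] := db.
have [y' y'E] := choice (fun j => surjp (y j)).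
(* The map x |-> e p(x), followed by a section of eE -> eX. *)
pose s x := \sum_j q j (p x) *: (oe *: y' j).
have r0P x : exists w, i w = oe *: x - s x.
  apply/exip; rewrite linearB linearZ_LR xE linear_sum.
  by rewrite -sumrB big1 // => j _; rewrite !(linearZ_LR p) y'E ey subrr.
have [r0 r0E] := choice r0P.
have sD x x' : s (x + x') = s x + s x'.
  by rewrite -big_split; apply: eq_bigr => j _ /=; rewrite linearD qD scalerDl.
have sZ a x : oe * a * oe = a -> s (a *: x) = a *: s x.
  move=> ea; rewrite scaler_sumr; apply: eq_bigr => j _.
  by rewrite (linearZ_LR p) qZ // [RHS]scalerA.
have ea_l a : oe * a * oe = a -> oe * a = a by move=> <-; rewrite !mulrA idemP.
have ea_r a : oe * a * oe = a -> a * oe = a by move=> <-; rewrite -!mulrA idemP.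
have se x : oe *: s x = s x.
  rewrite scaler_sumr; apply: eq_bigr => j _.
  by rewrite [LHS]scalerA ea_l.
have si w : s (i w) = 0.
  rewrite /s big1 // => j _; have -> : p (i w) = 0 by apply/exip; exists w.
  by rewrite (corner_linear0 (dual_basis_corner_linear db j)) scale0r.
move: r0E sD sZ se si; clear r0P; move: s => s r0E sD sZ se si.
exists (fun x => val (r0 x)); first split.
- move=> x x'; rewrite -val_left_idealD; congr val; apply: inji.
  by rewrite linearD !r0E sD scalerDr addrACA opprD.
- move=> a x ea; rewrite -val_left_idealZ; congr val; apply: inji.
  rewrite (linearZ_LR i) 2!r0E (sZ a x ea) scalerBr.
  by rewrite [oe *: (a *: x)]scalerA [a *: (oe *: x)]scalerA (ea_l a ea) (ea_r a ea).
- move=> x; rewrite -mulrA left_idealP -val_left_idealZ; congr val; apply: inji.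
  by rewrite (linearZ_LR i) r0E scalerBr scalerA idemP se.
- move=> w; rewrite -val_left_idealZ; congr val; apply: inji.
  by rewrite r0E (linearZ_LR i) si subr0.
Qed.

(** The lift of the retraction restricts on A e to the inclusion into Ah e. *)
Lemma retraction_val rho : corner_linear rho -> (forall w, rho (i w) = oe * val w) ->
  forall w, colift rho (i w) = ov (val w : A).
Proof.
move=> rhoP rhoE w; rewrite -[RHS]mul1r -(guv G) mulr_suml.
apply: eq_bigr => l _; rewrite -mulrA; congr (_ * _).
rewrite -(linearZ_LR i) rhoE -(ov_ogv l) -ovM; congr ov.
by rewrite val_left_idealZ mulrA ogv_corner.
Qed.

End Retraction.
End GlueExt1.

Section GlueExt1Vanishing.
Variables (k : fieldType) (Pi : algebra k) (Q : lmodType Pi) (G : glue Q).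
Local Notation Ah := (gring G).
Local Notation e := (gid G).
Local Notation kap := (gkap G).
Local Notation A := (ord G).
Local Notation oe := (idem_val (oid G)).
Local Notation Ae := (submod (left_ideal oe)).
Hypothesis injQ : injective_mod Q.

Lemma ov_left_ideal_inj (w w' : Ae) : ov (val w : A) = ov (val w' : A) -> w = w'.
Proof. by move=> /ov_inj /val_inj. Qed.

Lemma linear_to_left_ideal (X : lmodType A) (F : X -> Ah) :
  (forall x y, F (x + y) = F x + F y) -> (forall a x, F (a *: x) = ov a * F x) ->
  (forall x, F x * e = F x) -> (forall x, kap (F x) = 0) ->
  exists r : {linear X -> Ae}, forall x, ov (val (r x) : A) = F x.
Proof.
move=> FD FZ Fe Fk.
have [r rE] := choice (fun x => left_ideal_of (Fe x) (Fk x)).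
have [|f fE] := @ex_linear A X Ae r; last by exists f; rewrite fE.
move=> a x y; apply: ov_left_ideal_inj.
by rewrite val_left_idealD val_left_idealZ ovD ovM !rE FD FZ.
Qed.

(** The map colift(rho) : E -> Ah e extends the inclusion of A e, so kap of it descends to phi : X
    -> Q. Subtracting a lift of phi to Ah e leaves a map with values in A e. *)
Lemma ext1_retraction (X E : lmodType A) (i : {linear Ae -> E}) (p : {linear E -> X})
    n (y : 'I_n -> X) (q : 'I_n -> X -> A) :
  short_exact i p -> torsion_free X -> dual_basis (oid G) y q ->
  exists r : {linear E -> Ae}, cancel i r.
Proof.
move=> ip tfX db; have qP := dual_basis_corner_linear db.
have [rho rhoP rhoE] := corner_retraction ip db.
have liftE := retraction_val rhoP rhoE.
have [inji surjp exip] := ip.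
have [sec secK] := choice surjp.
pose phi x := kap (colift rho (sec x)).
have phi_p x : phi (p x) = kap (colift rho x).
  have /exip[w wE] : p (sec (p x) - x) = 0 by rewrite linearB secK subrr.
  rewrite /phi -[sec (p x)](subrK x) -wE (coliftD rhoP) raddfD liftE.
  by rewrite kap_left_ideal add0r.
have phiP : acts_linear phi.
  have [kD kZ] := kap_colift_acts rhoP.
  split=> [x x'|a b x ab].
    by rewrite -[x]secK -[x']secK -linearD !phi_p kD.
  by rewrite -[x]secK -(linearZ_LR p) !phi_p (kZ a b).
have [c cE] := acts_linear_factor injQ tfX db phiP.
(* The last factor e keeps the subtracted terms in Ah e without changing their image under kap. *)
pose F x := colift rho x - \sum_j colift (q j) (p x) * e * c j * e.
have [x x'|a x|x|x|r rE] := @linear_to_left_ideal E F.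
- rewrite /F (coliftD rhoP) linearD.
  under eq_bigr do rewrite (coliftD (qP _)) !mulrDl.
  by rewrite big_split opprD addrACA.
- rewrite /F (colift_linear rhoP) (linearZ_LR p) mulrBr mulr_sumr.
  by under eq_bigr do rewrite (colift_linear (qP _)) -!mulrA;
    under [in RHS]eq_bigr do rewrite -!mulrA.
- rewrite /F mulrBl (colift_id rhoP) mulr_suml.
  by under eq_bigr do rewrite -[_ * e * e]mulrA gidP.
- rewrite /F raddfB /= -phi_p cE raddf_sum -sumrB big1 // => j _.
  by rewrite gkap_mulid subrr.
exists r => w; apply: ov_left_ideal_inj; rewrite rE /F liftE.
have -> : p (i w) = 0 by apply/exip; exists w.
rewrite big1 ?subr0 // => j _; suff -> : colift (q j) 0 = 0 by rewrite !mul0r.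
by apply: (addIr (colift (q j) 0)); rewrite -(coliftD (qP j)) !add0r.
Qed.

Lemma fin_gen_left_ideal : fin_gen Ae.
Proof.
have [w wE] := left_ideal_mem oe (1 : A); rewrite mul1r in wE.
exists 1%N, (fun=> w) => x; have [b xb] := val_left_idealP x.
exists (fun=> b); rewrite big_ord1; apply: val_inj.
apply: etrans (xb) _; apply: etrans (esym (val_left_idealZ b w)).
by rewrite wE.
Qed.

Lemma glue_Ext1_eq0 (X : lmodType A) : CM_ (oid G) X -> Ext1_eq0 (@fin_gen A) X Ae.
Proof.
case=> /free_torsion_free tfX [fgX /proj_dual_basis[n [y [q db]]]].
apply: split_ext1_eq0 => [|E i p _ ip].
  by apply: fin_gen_prod => //; apply: fin_gen_left_ideal.
exact: ext1_retraction ip tfX db.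
Qed.

End GlueExt1Vanishing.

(** * Vanishing of Ext^2 *)

Section GlueDescent.
Variables (k : fieldType) (Pi : algebra k) (Q : lmodType Pi) (G : glue Q).
Local Notation A := (ord G).
Local Notation kap := (gkap G).
Local Notation oe := (idem_val (oid G)).

Lemma acts_ex (a : A) : exists b, acts_as (ov a) b.
Proof. exact: ov_acts. Qed.
Definition acts_val (a : A) : Pi := sval (cid (acts_ex a)).
Lemma acts_valP a : acts_as (ov a) (acts_val a).
Proof. exact: (svalP (cid (acts_ex a))). Qed.
Lemma acts_val_scale a b (q : Q) : acts_as (ov a) b -> acts_val a *: q = b *: q.
Proof. by move=> ab; have [z <-] := gkap_surj G q; rewrite -ab acts_valP. Qed.

(** Q as an A-module; the argument serves only to fix the order that acts. *)
Definition pull (H : glue Q) : Type := Q.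
HB.instance Definition _ := GRing.Zmodule.on (pull G).
Definition pull_scale (a : A) (q : pull G) : pull G := acts_val a *: (q : Q).
Fact pull_scaleA a b q : pull_scale a (pull_scale b q) = pull_scale (a * b) q.
Proof.
rewrite /pull_scale scalerA; apply/esym; apply: acts_val_scale.
by rewrite ovM; apply: acts_asM; apply: acts_valP.
Qed.
Fact pull_scale1 : left_id 1 pull_scale.
Proof.
move=> q; rewrite /pull_scale (@acts_val_scale _ 1) ?scale1r //; exact: acts_as1.
Qed.
Fact pull_scaleDr : right_distributive pull_scale +%R.
Proof. by move=> a x y; apply: scalerDr. Qed.
Fact pull_scaleDl q : {morph pull_scale^~ q : a b / a + b}.
Proof.
move=> a b; rewrite /pull_scale -scalerDl; apply: acts_val_scale => z.
by rewrite ovD mulrDl raddfD !acts_valP scalerDl.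
Qed.
HB.instance Definition _ := GRing.Zmodule_isLmodule.Build A (pull G)
  pull_scaleA pull_scale1 pull_scaleDr pull_scaleDl.

Lemma pull_scaleE (a : A) b (q : Q) : acts_as (ov a) b ->
  a *: (q : pull G) = b *: q :> Q.
Proof. exact: acts_val_scale. Qed.

Lemma acts_linear_pull (X : lmodType A) (f : X -> Q) : acts_linear f ->
  exists g : {linear X -> pull G}, forall x, g x = f x :> Q.
Proof.
case=> fD fZ; have [|g gE] := @ex_linear A X (pull G) f; last by exists g; rewrite gE.
by move=> a x y; rewrite fD (fZ a _ _ (acts_valP a)).
Qed.

(* An A-module killed by e is a Pi-module. *)
Section Descend.
Variable (V : lmodType A).
Hypothesis Vkill : forall a (x : V), acts_as (ov a) 0 -> a *: x = 0.

Definition lift_scalar (p : Pi) : A := sval (cid (acts_surj G p)).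
Lemma lift_scalarP p : acts_as (ov (lift_scalar p)) p.
Proof. exact: (svalP (cid (acts_surj G p))). Qed.

Lemma lift_scalarE a p (x : V) : acts_as (ov a) p -> lift_scalar p *: x = a *: x.
Proof.
move=> ap; apply/eqP; rewrite -subr_eq0 -scalerBl; apply/eqP/Vkill.
by rewrite ovB -(subrr p); apply: acts_asB => //; apply: lift_scalarP.
Qed.

(** The proof is an argument of the type because the scaling by Pi depends on it. *)
Definition descend of (forall a (x : V), acts_as (ov a) 0 -> a *: x = 0) : Type := V.
Local Notation D := (descend Vkill).
HB.instance Definition _ := GRing.Zmodule.on D.
Definition descend_scale (p : Pi) (x : D) : D := lift_scalar p *: (x : V).
Fact descend_scaleA a b x : descend_scale a (descend_scale b x) = descend_scale (a * b) x.
Proof.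
rewrite /descend_scale scalerA; apply/esym; apply: lift_scalarE.
by rewrite ovM; apply: acts_asM; apply: lift_scalarP.
Qed.
Fact descend_scale1 : left_id 1 descend_scale.
Proof.
move=> x; rewrite /descend_scale (@lift_scalarE 1) ?scale1r //; exact: acts_as1.
Qed.
Fact descend_scaleDr : right_distributive descend_scale +%R.
Proof. by move=> a x y; apply: scalerDr. Qed.
Fact descend_scaleDl x : {morph descend_scale^~ x : a b / a + b}.
Proof.
move=> a b; rewrite /descend_scale -scalerDl; apply: lift_scalarE => z.
by rewrite ovD mulrDl raddfD !lift_scalarP scalerDl.
Qed.
HB.instance Definition _ := GRing.Zmodule_isLmodule.Build Pi D
  descend_scaleA descend_scale1 descend_scaleDr descend_scaleDl.

Lemma descend_extension (M : lmodType A) (i : {linear M -> V}) (h : M -> Q) :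
  injective_mod Q -> acts_linear h -> (forall m, i m = 0 -> h m = 0) ->
  exists g : V -> Q, acts_linear g /\ forall m, g (i m) = h m.
Proof.
move=> injQ hP hi.
pose im : {pred D} := [pred z | `[< exists m, z = i m >]].
have imc : GRing.subsemimod_closed im.
  split; [split=> [|_ _ /asboolP[m ->] /asboolP[m' ->]]|move=> p _ /asboolP[m ->]];
    apply/asboolP.
  - by exists 0; rewrite linear0.
  - by exists (m + m'); rewrite linearD.
  - by exists (lift_scalar p *: m); rewrite (linearZ_LR i).
pose Im := HB.pack_for (submodClosed D) im (GRing.isSubmodClosed.Build Pi D im imc).
pose r (z : submod Im) (q : Q) := exists m, val z = i m /\ q = h m.
have [|q [m [zm ->]]|p z z' q q' [m [zm ->]] [m' [zm' ->]]|th thP] := linear_of_rel (r := r).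
- by move=> z; have /asboolP[m zm] := valP z; exists (h m), m.
- by apply: hi; rewrite -zm.
- exists (lift_scalar p *: m + m'); split.
    by rewrite val_submodD val_submodZ zm zm' (linearD i) (linearZ_LR i).
  by rewrite hP.1 (hP.2 _ _ _ (lift_scalarP p)).
have [g gE] := @injQ (submod Im) D (val : {linear submod Im -> D}) th val_inj.
exists g; split; first split=> [x y|a b x ab]; first exact: (linearD g).
  by rewrite -(linearZ_LR g); congr (g _); rewrite -(lift_scalarE x ab).
move=> m; have mIm : (i m : D) \in Im by apply/asboolP; exists m.
have -> : h m = th (in_sub mIm) by apply/thP; exists m.
by rewrite -gE.
Qed.
End Descend.

Section Extension.
Variables (M N X : lmodType A) (i : {linear M -> N}) (p : {linear N -> X}).
Hypothesis ip : short_exact i p.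
Variables (n : nat) (y : 'I_n -> X) (q : 'I_n -> X -> A).
Hypothesis db : dual_basis (oid G) y q.
Hypothesis injQ : injective_mod Q.

(** The submodule A e N: the quotient by it is the largest one killed by e, and so a Pi-module. *)
Definition trace_sub : {pred N} :=
  [pred x | `[< exists s : seq (A * N), x = \sum_(z <- s) (z.1 * oe) *: z.2 >]].
Fact trace_sub_closed : GRing.subsemimod_closed trace_sub.
Proof.
split; [split=> [|_ _ /asboolP[s ->] /asboolP[s' ->]]|move=> a _ /asboolP[s ->]];
  apply/asboolP.
- by exists [::]; rewrite big_nil.
- by exists (s ++ s'); rewrite big_cat.
- exists [seq (a * z.1, z.2) | z <- s]; rewrite big_map scaler_sumr.
  by apply: eq_bigr => z _; rewrite scalerA mulrA.
Qed.
HB.instance Definition _ :=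
  GRing.isSubmodClosed.Build A N trace_sub trace_sub_closed.

Lemma quot_trace_kill a (w : quot_mod trace_sub) : acts_as (ov a) 0 -> a *: w = 0.
Proof.
move=> /acts_as0[x [xe ->]]; rewrite -[w]mod_repr -[LHS]linearZ_LR -[RHS](linear0 (mod_pi _)).
apply/mod_piP; rewrite subr0; apply/asboolP.
exists [seq (x l, ogv l *: repr w) | l <- enum 'I_(grank G)].
rewrite big_map scaler_suml big_enum /=.
by apply: eq_bigr => l _; rewrite xe scalerA.
Qed.

(* A e M = M \cap A e N because X is projective over E. *)
Lemma acts_linear_trace (h : M -> Q) m : acts_linear h -> i m \in trace_sub -> h m = 0.
Proof.
move=> hP /asboolP[s imE]; have [inji surjp exip] := ip; have [ey qD qZ qe xE] := db.
have [y' y'E] := choice (fun j => surjp (y j)).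
have mxP x : exists m, i m = oe *: x - \sum_j q j (p x) *: y' j.
  apply/exip; rewrite linearB (linearZ_LR p) xE linear_sum -sumrB big1 // => j _.
  by rewrite (linearZ_LR p) y'E subrr.
have [mx mxE] := choice mxP.
have qe_l j x : oe * q j x = q j x by rewrite -qe !mulrA idemP.
(* Multiplied by v_l on the left, the sum becomes q_j(v_l p(i m)) = 0, and 1 = sum_l u_l v_l
   recovers the sum itself. *)
have c0 j : \sum_(z <- s) z.1 * q j (p z.2) = 0.
  suff c0l l : ogv l * (\sum_(z <- s) z.1 * q j (p z.2)) = 0.
    apply: ov_inj; rewrite -[ov _]mul1r -(guv G) mulr_suml ov0 big1 // => l _.
    by rewrite -mulrA -(ov_ogv l) -ovM c0l ov0 mulr0.
  have qP := dual_basis_corner_linear db j.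
  transitivity (q j (ogv l *: p (i m))); last first.
    have -> : p (i m) = 0 by apply/exip; exists m.
    by rewrite scaler0 (corner_linear0 qP).
  rewrite imE linear_sum scaler_sumr (corner_linear_sum qP) mulr_sumr.
  apply: eq_bigr => z _; rewrite (linearZ_LR p) scalerA qZ; last first.
    by rewrite !mulrA ogv_corner -!mulrA idemP.
  by rewrite -!mulrA qe_l.
have mE : m = \sum_(z <- s) (z.1 * oe) *: mx z.2.
  apply: inji; rewrite imE linear_sum.
  have s0 : \sum_j (\sum_(z <- s) z.1 * q j (p z.2)) *: y' j = 0.
    by rewrite big1 // => j _; rewrite c0 scale0r.
  rewrite -[LHS]subr0 -[X in _ - X = _]s0.
  under [X in _ - X]eq_bigr do rewrite scaler_suml.
  rewrite exchange_big -sumrB; apply: eq_bigr => z _.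
  rewrite (linearZ_LR i) mxE scalerBr scalerA -mulrA idemP scaler_sumr.
  congr (_ - _); apply: eq_bigr => j _; rewrite scalerA -mulrA.
  by rewrite qe_l.
have h_sum I (r : seq I) F : h (\sum_(z <- r) F z) = \sum_(z <- r) h (F z).
  by elim/big_rec2: _ => [|z w w' _ <-]; rewrite ?acts_linear0 //; case: hP.
rewrite mE h_sum big1 // => z _; rewrite -scalerA (hP.2 _ _ _ (acts_valP _)).
by rewrite acts_linear_oid ?scaler0.
Qed.

(** The map h kills the intersection of M with A e N, so it is defined on the image of M in the
    Pi-module N / A e N, from where injectivity of Q extends it. *)
Lemma acts_linear_extension (h : M -> Q) : acts_linear h ->
  exists g : N -> Q, acts_linear g /\ forall m, g (i m) = h m.
Proof.
move=> hP.
have [m /= im0|g [[gD gZ] gE]] := descend_extension quot_trace_kill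
  (i := (mod_pi trace_sub \o i : {linear M -> quot_mod trace_sub})) injQ hP.
  apply: acts_linear_trace => //; apply: contrapT => nim.
  by apply: nim; have /mod_piP : mod_pi trace_sub (i m) = mod_pi trace_sub 0;
    rewrite ?subr0 // im0 linear0.
exists (fun x => g (mod_pi _ x)); split=> //; split=> [x x'|a b x ab].
  by rewrite linearD gD.
by rewrite linearZ_LR (gZ a b).
Qed.
End Extension.
End GlueDescent.

Section GlueExt2.
Variables (k : fieldType) (Pi : algebra k) (Q : lmodType Pi) (G : glue Q).
Local Notation Ah := (gring G).
Local Notation e := (gid G).
Local Notation kap := (gkap G).
Local Notation A := (ord G).
Local Notation oe := (idem_val (oid G)).
Local Notation Ae := (submod (left_ideal oe)).
Hypothesis injQ : injective_mod Q.
Hypothesis fgQ : fin_gen Q.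

Definition over_mod (H : glue Q) : Type := gring H.
HB.instance Definition _ := GRing.Zmodule.on (over_mod G).
Definition over_scale (a : A) (z : over_mod G) : over_mod G := ov a * z.
Fact over_scaleA a b z : over_scale a (over_scale b z) = over_scale (a * b) z.
Proof. by rewrite /over_scale ovM mulrA. Qed.
Fact over_scale1 : left_id 1 over_scale.
Proof. by move=> z; rewrite /over_scale ov1 mul1r. Qed.
Fact over_scaleDr : right_distributive over_scale +%R.
Proof. by move=> a x y; apply: mulrDr. Qed.
Fact over_scaleDl z : {morph over_scale^~ z : a b / a + b}.
Proof. by move=> a b; rewrite /over_scale ovD mulrDl. Qed.
HB.instance Definition _ := GRing.Zmodule_isLmodule.Build A (over_mod G)
  over_scaleA over_scale1 over_scaleDr over_scaleDl.

Lemma over_scaleE a (z : over_mod G) : a *: z = ov a * (z : Ah) :> Ah.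
Proof. by []. Qed.

Definition over_e : {pred over_mod G} := [pred z | (z : Ah) * e == z].
Fact over_e_closed : GRing.subsemimod_closed over_e.
Proof.
split; [split=> [|x y /eqP xe /eqP ye]|move=> a x /eqP xe]; apply/eqP.
- exact: mul0r.
- by rewrite mulrDl xe ye.
- by rewrite over_scaleE -mulrA xe.
Qed.
HB.instance Definition _ := GRing.isSubmodClosed.Build A (over_mod G) over_e over_e_closed.
Local Notation I := (submod over_e).

Lemma over_eP (z : I) : (val z : Ah) * e = (val z : Ah).
Proof. exact: (eqP (valP z)). Qed.

Lemma val_overD (x y : I) : (val (x + y) : Ah) = (val x : Ah) + (val y : Ah).
Proof. by []. Qed.
Lemma val_overZ a (x : I) : (val (a *: x) : Ah) = ov a * (val x : Ah).
Proof. by []. Qed.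

Lemma over_of (z : Ah) : z * e = z -> exists w : I, (val w : Ah) = z.
Proof.
move=> ze; have zI : (z : over_mod G) \in over_e by apply/eqP.
by exists (in_sub zI).
Qed.

Lemma over_inj (x y : I) : (val x : Ah) = (val y : Ah) -> x = y.
Proof. exact: val_inj. Qed.

Lemma kap_acts_over : acts_linear (fun z : I => kap (val z : Ah)).
Proof.
split=> [x y|a b x ab]; first by rewrite val_overD raddfD.
by rewrite val_overZ ab.
Qed.

Lemma over_short_exact : exists (i : {linear Ae -> I}) (p : {linear I -> pull G}),
  [/\ short_exact i p, forall w, (val (i w) : Ah) = ov (val w : A) &
      forall z, p z = kap (val z : Ah) :> Q].
Proof.
have [p pE] := acts_linear_pull kap_acts_over.
have [r rE] := choice (fun w : Ae => over_of (ov_left_ideal w)).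
have [|i iE] := @ex_linear A Ae I r.
  move=> a x y; apply: over_inj; rewrite val_overD val_overZ !rE.
  by rewrite val_left_idealD val_left_idealZ ovD ovM.
exists i, p; split=> [|w|//]; last by rewrite iE rE.
split=> [x y xy|q|z].
- by apply: ov_left_ideal_inj; rewrite -!rE -iE xy.
- have [z zq] := gkap_surj G q.
  have ze : z * e * e = z * e by rewrite -mulrA gidP.
  by have [w wE] := over_of ze; exists w; rewrite pE wE gkap_mulid.
- split=> [pz|[w <-]]; last first.
    by apply: etrans (pE _) _; rewrite iE rE kap_left_ideal.
  have [w wE] := left_ideal_of (over_eP z) (etrans (esym (pE z)) pz).
  by exists w; apply: over_inj; rewrite iE rE wE.
Qed.

Lemma fin_gen_pull : fin_gen (pull G).
Proof.
have [n [b bP]] := fgQ; exists n, b => q; have [c cE] := bP q.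
have [a aE] := choice (fun i => acts_surj G (c i)).
exists a; rewrite [LHS]cE; apply: eq_bigr => i _.
by rewrite (pull_scaleE _ (aE i)).
Qed.

Lemma fin_gen_over : fin_gen I.
Proof.
have [i [p [ip _ _]]] := over_short_exact.
apply: (fin_gen_ext ip); [exact: fin_gen_left_ideal | exact: fin_gen_pull].
Qed.

(** e Ah e is E itself, free on e. *)
Lemma mod_over : mod_ (oid G) I.
Proof.
split; first exact: fin_gen_over.
apply/proj_dual_basis.
have [y yE] := over_of (gidP G).
have pP (z : I) : exists a : A, ov a = e * (val z : Ah).
  by apply: is_ord_left; rewrite mulrA gidP.
have [p pE] := choice pP.
exists 1%N, (fun=> y), (fun=> p); split=> [_|_ x x'|_ a x ea|_ x|x].
- by apply: over_inj; rewrite val_overZ ov_oid yE gidP.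
- by apply: ov_inj; rewrite ovD !pE val_overD mulrDr.
- apply: ov_inj; rewrite ovM !pE val_overZ -ea !ovM ov_oid -!mulrA.
  by rewrite [e * (e * _)]mulrA gidP [e * (e * _)]mulrA gidP.
- by apply: ov_inj; rewrite !ovM ov_oid pE mulrA gidP -mulrA over_eP.
- by rewrite big_ord1; apply: over_inj; rewrite !val_overZ yE pE ov_oid -mulrA over_eP.
Qed.

Lemma pull_oid (q : pull G) : oe *: q = 0.
Proof. by have := pull_scaleE (q : Q) (@acts_oid _ _ _ G); rewrite scale0r. Qed.

(** e kills Q, so eQ = 0 is projective, although Q itself is torsion. *)
Lemma mod_pull : mod_ (oid G) (pull G).
Proof.
split; first exact: fin_gen_pull.
apply/proj_dual_basis; exists 0%N, (fun=> 0), (fun _ _ => 0).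
by split=> [[]|[]|[]|[]|x] //; rewrite big_ord0 pull_oid.
Qed.

Lemma mod_pull_prod (X : lmodType A) : mod_ (oid G) X -> mod_ (oid G) (pull G * X)%type.
Proof.
case=> fgX /proj_dual_basis[n [y [p [ey pD pZ pe xE]]]].
split; first exact: fin_gen_prod fin_gen_pull fgX.
apply/proj_dual_basis; exists n, (fun i => (0, y i)), (fun i z => p i z.2).
split=> [i|i z z'|i a z ea|i z|z].
- by apply: injective_projections; rewrite /= ?ey // pull_oid.
- exact: pD.
- exact: pZ.
- exact: pe.
- apply: injective_projections; rewrite /= raddf_sum /=.
    by rewrite pull_oid big1 // => i _; rewrite scaler0.
  by rewrite xE.
Qed.

(** Every 2-extension maps to the splice of 0 -> A e -> Ah e -> Q -> 0 with the split sequence 0 ->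
    Q -> Q x X -> X -> 0. Projectivity of eM gives L -> Ah e, which induces M -> Q; projectivity of
    eX and injectivity of Q extend the latter to N. *)
Lemma glue_Ext2_eq0 (X : lmodType A) : mod_ (oid G) X -> Ext2_eq0 (mod_ (oid G)) X Ae.
Proof.
move=> modX; have [i [p [ip iE pE]]] := over_short_exact.
have [j jE [_ _ [s sE]]] := pair_linear (pull G) X.
have js := pair_short_exact jE sE.
pose T := Ext2 (And3 mod_over mod_pull (mod_pull_prod modX)) ip js.
suff toT E : ext2_hom E T.
  move=> E F; apply: Relation_Operators.rst_trans (T) _ _ _.
    exact: Relation_Operators.rst_step.
  by apply: Relation_Operators.rst_sym; apply: Relation_Operators.rst_step.
case: E => L M N il lp ri pr [modL modM modN] exL exN.
have [_ /proj_dual_basis[n [y [q db]]]] := modM.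
have [_ /proj_dual_basis[n' [y' [q' db']]]] := modX.
have [rho rhoP rhoE] := corner_retraction exL db.
have liftE := retraction_val rhoP rhoE.
have [f0 f0E] := choice (fun x => over_of (colift_id rhoP x)).
have [|f fE] := @ex_linear A L I f0.
  move=> a x x'; apply: over_inj.
  by rewrite val_overD val_overZ !f0E (coliftD rhoP) (colift_linear rhoP).
have [inj_il surj_lp ex_lp] := exL; have [inj_ri surj_pr ex_pr] := exN.
have fil w : f (il w) = i w by apply: over_inj; rewrite fE f0E liftE iE.
have [sec secK] := choice surj_lp.
(* The composite of [f] and [p] vanishes on A e, so it descends along [lp]; [h] is the induced
   map. *)
have pf x : p (f (sec (lp x))) = p (f x).
  have /ex_lp[w wE] : lp (sec (lp x) - x) = 0 by rewrite linearB secK subrr.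
  rewrite -[sec (lp x)](subrK x) -wE linearD fil linearD.
  have -> : p (i w) = 0 by have [_ _ exip] := ip; apply/exip; exists w.
  by rewrite add0r.
have [|h hE] := @ex_linear A M (pull G) (fun m => p (f (sec m))).
  by move=> a m m'; rewrite -[m]secK -[m']secK -(linearP lp) !pf !linearP.
have hP : acts_linear (h : M -> Q).
  split=> [m m'|a b m ab]; first exact: (linearD h).
  by rewrite linearZ_LR; apply: pull_scaleE.
have [g1 [g1P g1E]] := acts_linear_extension exN db' injQ hP.
have [g2 g2E] := acts_linear_pull g1P.
have [|g gE] := @ex_linear A N (pull G * X)%type (fun x => (g2 x, pr x)).
  by move=> a x x'; rewrite !linearP.
exists f, h, g; split=> /= [w|x|m|x].
- exact: fil.
- by rewrite hE pf.
- rewrite gE jE; congr pair; last by apply/ex_pr; exists m.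
  exact: etrans (g2E _) (g1E m).
- by rewrite gE sE.
Qed.

End GlueExt2.

(** * Cotops *)

Lemma frac_denominator (R : idomainType) (c : {fraction R}) :
  exists a b : R, b != 0 /\ tofrac b * c = tofrac a.
Proof.
elim/quotW: c => x; exists \n_x, \d_x; split; first exact: denom_ratioP.
rewrite -[_ * _]/(FracField.mul (tofrac \d_x) (\pi x)%qT) !piE.
apply/eqmodP; rewrite /= FracField.equivfE /FracField.mulf.
rewrite !numden_Ratio ?mulf_neq0 ?oner_eq0 ?denom_ratioP //.
by rewrite mulr1 mul1r mulrC.
Qed.

(** * The module of fractions of a torsion-free module *)

Section Tensor.
Variables (R : idomainType) (A : algebra R) (X : lmodType A).
Local Notation K := {fraction R}.
Local Notation al := (alg_struct A).
Hypothesis tfX : forall r (x : X), al r *: x = 0 -> r = 0 \/ x = 0.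
Implicit Types (s : seq (X * K)) (x y : X) (r : R).

(* r clears the denominators of the formal sum s, and r s = x \otimes 1. *)
Fixpoint clears s r x : Prop :=
  if s is (y, c) :: s' then
    exists a x', [/\ tofrac a = tofrac r * c, x = al a *: y + x' & clears s' r x']
  else x = 0.

Lemma clears_fun s r x x' : clears s r x -> clears s r x' -> x = x'.
Proof.
elim: s x x' => [|[y c] s IH] x x' /=; first by move=> -> ->.
move=> [a [w [ac -> sw]]] [a' [w' [ac' -> sw']]].
by rewrite (IH _ _ sw sw') (_ : a = a') //; apply/eqP; rewrite -tofrac_eq ac ac'.
Qed.

Lemma clears_cat s s' r x : clears (s ++ s') r x <->
  exists x1 x2, [/\ clears s r x1, clears s' r x2 & x = x1 + x2].
Proof.
elim: s x => [|[y c] s IH] x /=.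
  split=> [sx|[_ [x2 [-> s2 ->]]]]; last by rewrite add0r.
  by exists 0, x; rewrite add0r.
split=> [[a [w [ac -> /IH[x1 [x2 [s1 s2 ->]]]]]]|[_ [x2 [[a [w [ac -> sw]]] s2 ->]]]].
  by exists (al a *: y + x1), x2; split=> //; [exists a, x1 | rewrite addrA].
exists a, (w + x2); split=> //; first by rewrite addrA.
by apply/IH; exists w, x2.
Qed.

Lemma clears_scale s r x r' : clears s r x -> clears s (r' * r) (al r' *: x).
Proof.
elim: s x => [|[y c] s IH] x /=; first by move=> ->; rewrite scaler0.
move=> [a [w [ac -> sw]]]; exists (r' * a), (al r' *: w); split; last exact: IH.
  by rewrite !tofracM ac mulrA.
by rewrite scalerDr scalerA rmorphM.
Qed.

Lemma clears_ex s : exists r x, r != 0 /\ clears s r x.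
Proof.
elim: s => [|[y c] s [r [x [r0 sx]]]]; first by exists 1, 0; rewrite oner_eq0.
have [a [b [b0 ba]]] := frac_denominator c.
exists (b * r), (al (r * a) *: y + al b *: x); split; first by rewrite mulf_neq0.
exists (r * a), (al b *: x); split=> //; last exact: clears_scale.
by rewrite !tofracM mulrAC ba mulrC.
Qed.

(** Cleared denominators give an invariant of the tensor relations; this is what makes X embed in
    its tensor product with K. *)
Lemma tensor_eq_clears s s' : tensor_eq s s' ->
  forall r x x', clears s r x -> clears s' r x' -> x = x'.
Proof.
elim=> {s s'} 
    [s|s s' _ IH|s s' s'' _ IH1 _ IH2|s1 s2 t1 t2 _ IH1 _ IH2|s s'|c|y z c|y c d|r0 y c] r x x'.
- exact: clears_fun.
- by move=> sx s'x'; rewrite (IH r x' x).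
(* The middle sum may need a further denominator r0; torsion-freeness cancels it again. *)
- have [r0 [z [r00 s'z]]] := clears_ex s' => sx s''x'.
  have s'z' : clears s' (r0 * r) (al r *: z) by rewrite mulrC; apply: clears_scale.
  have xx' : al r0 *: x = al r0 *: x'.
    rewrite (IH1 _ _ _ (clears_scale r0 sx) s'z').
    exact: IH2 s'z' (clears_scale r0 s''x').
  have [|r00'|/eqP] := @tfX r0 (x - x'); first by rewrite scalerBr xx' subrr.
    by rewrite r00' eqxx in r00.
  by rewrite subr_eq0 => /eqP.
- move=> /clears_cat[x1 [x2 [s1x s2x ->]]] /clears_cat[x3 [x4 [s3x s4x ->]]].
  by rewrite (IH1 _ _ _ s1x s3x) (IH2 _ _ _ s2x s4x).
- move=> /clears_cat[x1 [x2 [s1x s2x ->]]] /clears_cat[x3 [x4 [s3x s4x ->]]].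
  by rewrite (clears_fun s1x s4x) (clears_fun s2x s3x) addrC.
- by move=> [a [w [_ -> ->]]] ->; rewrite scaler0 addr0.
- move=> [a [w [ac -> ->]]] [a1 [w1 [ac1 -> [a2 [w2 [ac2 -> ->]]]]]].
  have -> : a1 = a by apply/eqP; rewrite -tofrac_eq ac ac1.
  have -> : a2 = a by apply/eqP; rewrite -tofrac_eq ac ac2.
  by rewrite scalerDr !addr0.
- move=> [a [w [ac -> ->]]] [a1 [w1 [ac1 -> [a2 [w2 [ac2 -> ->]]]]]].
  have -> : a = a1 + a2 by apply/eqP; rewrite -tofrac_eq tofracD ac ac1 ac2 mulrDr.
  by rewrite rmorphD scalerDl !addr0.
- move=> [a [w [ac -> ->]]] [a1 [w1 [ac1 -> ->]]].
  have -> : a1 = a * r0.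
    by apply/eqP; rewrite -tofrac_eq tofracM ac ac1 mulrCA mulrC.
  by rewrite rmorphM scalerA.
Qed.

Lemma pure_tensorD x y c : pure_tensor (x + y) c = pure_tensor x c + pure_tensor y c.
Proof.
by rewrite /pure_tensor -tensor_sumD; apply/tensor_sumP; apply: TensorDl.
Qed.

Lemma pure_tensorZ (a : A) x c : a *: pure_tensor x c = pure_tensor (a *: x) c.
Proof. exact: tensor_scaleE. Qed.

Lemma pure_tensor_frac r x c : pure_tensor (al r *: x) c = pure_tensor x (tofrac r * c).
Proof. by apply/tensor_sumP; apply: TensorZ. Qed.

Lemma pure_tensor_ex (w : ext_scal X) :
  exists r x, r != 0 /\ w = pure_tensor x (tofrac r)^-1.
Proof.
rewrite -[w]tensor_repr; have [r [x [r0 sx]]] := clears_ex (repr w).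
exists r, x; split=> //; elim: (repr w) x sx => [|[y c] s IH] x /=.
  by move=> ->; apply/esym/tensor_sumP; apply: Tensor0.
move=> [a [x' [ac -> sx]]]; rewrite pure_tensorD -(IH _ sx) -cat1s tensor_sumD.
congr (_ + _); rewrite pure_tensor_frac ac mulrC mulKf //.
by rewrite tofrac_eq0.
Qed.

(** Equality of fractions, read off from the common denominator r r'. *)
Lemma pure_tensor_eq r r' x x' : r != 0 -> r' != 0 ->
  pure_tensor x (tofrac r)^-1 = pure_tensor x' (tofrac r')^-1 <->
  al r' *: x = al r *: x'.
Proof.
move=> r0 r'0; have [fr fr'] : tofrac r != 0 /\ tofrac r' != 0 by rewrite !tofrac_eq0.
split=> [/tensor_sumP/tensor_eq_clears eq|xx'].
  apply: (eq (r * r')).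
    exists r', 0; rewrite addr0; split=> //.
    by rewrite tofracM mulrAC mulfV // mul1r.
  exists r, 0; rewrite addr0; split=> //.
  by rewrite tofracM mulfK.
have -> : (tofrac r)^-1 = tofrac r' * (tofrac r' * tofrac r)^-1.
  by rewrite invfM mulVKf.
have -> : (tofrac r')^-1 = tofrac r * (tofrac r' * tofrac r)^-1.
  by rewrite [tofrac r' * _]mulrC invfM mulVKf.
by rewrite -!pure_tensor_frac xx'.
Qed.

End Tensor.

(** Every nonzero element generates V, so V is zero or simple. *)
Lemma semisimple_of_cyclic (A : pzRingType) (V : lmodType A) :
  (forall x y : V, x != 0 -> exists a, y = a *: x) -> semisimple V.
Proof.
move=> cyc x; have [->|x0] := eqVneq x 0; first exact: rpred0.
pose all_V : {pred V} := fun=> true.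
have allc : GRing.subsemimod_closed all_V by [].
pose full := HB.pack_for (submodClosed V) all_V (GRing.isSubmodClosed.Build A V all_V allc).
apply/asboolP => S; apply; exists full => //; split; first by exists x.
move=> U _; have [[u uU u0]|nU] := pselect (exists2 u, u \in U & u != 0).
  by right=> y _; have [a ->] := cyc u y u0; apply: rpredZ.
by left=> u uU; apply: contrapT => /eqP u0; case: nU; exists u.
Qed.

Lemma bij_additive_inverse (U V : zmodType) (h : U -> V) :
  {morph h : x y / x + y} -> bijective h ->
  exists f : {additive V -> U}, cancel h f /\ cancel f h.
Proof.
move=> hD [g hK gK].
have gB : zmod_morphism g.
  move=> x y; apply: (can_inj hK); rewrite gK -[X in _ = h (_ X)]opprK.
  have hN z : h (- z) = - h z.
    apply/eqP; rewrite -addr_eq0 -hD addNr; apply/eqP.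
    by apply: (addIr (h 0)); rewrite -hD !add0r.
  by rewrite opprK hD hN !gK.
exists (HB.pack_for {additive V -> U} g (GRing.isZmodMorphism.Build V U g gB)).
by split.
Qed.

(** * Elements of a socle that are killed by the ideal of e *)

Section KilledSocle.
Variables (k : fieldType) (P : algebra k) (T : finType) (bP : basic P T).
Variables (Q : lmodType P) (G : glue Q) (V : lmodType (ord G)).
Local Notation A := (ord G).

Definition killed (x : V) := forall a, acts_as (ov a) 0 -> a *: x = 0.

Lemma killedD x y : killed x -> killed y -> killed (x + y).
Proof. by move=> kx ky a a0; rewrite scalerDr kx ?ky ?addr0. Qed.
Lemma killedB x y : killed x -> killed y -> killed (x - y).
Proof. by move=> kx ky a a0; rewrite scalerBr kx ?ky ?subrr. Qed.

(** The killed elements of S form a submodule of S. *)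
Lemma simple_killed (S : submodClosed V) : simple_submod S ->
  (forall x, x \in S -> killed x) \/ (forall x, x \in S -> killed x -> x = 0).
Proof.
move=> [_ Smin].
pose U : {pred V} := [pred x | `[< x \in S /\ killed x >]].
have Uc : GRing.subsemimod_closed U.
  split; [split=> [|x y /asboolP[xS kx] /asboolP[yS ky]]|move=> a x /asboolP[xS kx]];
    apply/asboolP; split.
  - exact: rpred0.
  - by move=> a _; rewrite scaler0.
  - exact: rpredD.
  - exact: killedD.
  - exact: rpredZ.
  - move=> b b0; rewrite scalerA kx // ovM; have [c ac] := ov_acts a.
    by rewrite -(mul0r c); apply: acts_asM.
pose U1 := HB.pack_for (submodClosed V) U (GRing.isSubmodClosed.Build A V U Uc).
have [|U0|SU] := Smin U1; first by move=> x /asboolP[].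
  by right=> x xS kx; apply: U0; apply/asboolP.
by left=> x /SU/asboolP[].
Qed.

(** As for Nakayama's lemma: otherwise x = c a x, where c a acts on Q as an element d b of the
    radical. A left inverse of 1 - d b lifts to A, and x = 0 because S is killed. *)
Lemma simple_killed_brad (S : submodClosed V) : simple_submod S ->
  (forall x, x \in S -> killed x) -> forall x, x \in S ->
  forall a b, acts_as (ov a) b -> brad bP b -> a *: x = 0.
Proof.
move=> [_ Smin] Sk x xS a b ab rb; apply: contrapT => /eqP ax0.
pose U : {pred V} := [pred y | `[< exists c, y = c *: (a *: x) >]].
have Uc : GRing.subsemimod_closed U.
  split; [split=> [|y z /asboolP[c ->] /asboolP[d ->]]|move=> c y /asboolP[d ->]];
    apply/asboolP.
  - by exists 0; rewrite scale0r.
  - by exists (c + d); rewrite scalerDl.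
  - by exists (c * d); rewrite scalerA.
pose U1 := HB.pack_for (submodClosed V) U (GRing.isSubmodClosed.Build A V U Uc).
have [|U0|SU] := Smin U1.
- by move=> y /asboolP[c ->]; rewrite !rpredZ.
- by case/eqP: ax0; apply: U0; apply/asboolP; exists 1; rewrite scale1r.
have /asboolP[c xc] := SU _ xS; have [d cd] := ov_acts c.
have rdb : brad bP (d * b) by apply: bradM.
have [y yE] := brad_quasiregular rdb.
have [y' y'y] := acts_surj G y.
have inv : acts_as (ov (1 - y' * (1 - c * a))) 0.
  have -> : 0 = 1 - y * (1 - d * b) by rewrite yE subrr.
  rewrite ovB; apply: acts_asB; first exact: acts_as1.
  rewrite ovM; apply: acts_asM => //; rewrite ovB; apply: acts_asB; first exact: acts_as1.
  by rewrite ovM; apply: acts_asM.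
have := Sk _ xS _ inv; rewrite scalerBl scale1r -scalerA scalerBl scale1r -scalerA -xc.
rewrite subrr scaler0 subr0 => x0.
by case/eqP: ax0; rewrite x0 scaler0.
Qed.

(** Induction on n. The last simple module lies in the sum of the others or meets it in 0; in the
    second case, if the whole sum is killed, then so is its last term, which therefore vanishes. *)
Lemma unkilled_sum n (S : 'I_n -> submodClosed V) (s : 'I_n -> V) :
  (forall i, simple_submod (S i)) ->
  (forall i x, x \in S i -> killed x -> x = 0) ->
  (forall i, s i \in S i) -> killed (\sum_i s i) -> \sum_i s i = 0.
Proof.
elim: n S s => [|n IH] S s simS unS sS kS; first by rewrite big_ord0.
pose S' i := S (widen_ord (leqnSn n) i).
pose U : {pred V} := [pred x | `[< exists r : 'I_n -> V,
  (forall i, r i \in S' i) /\ x = \sum_i r i >]].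
have Uc : GRing.subsemimod_closed U.
  split; [split=> [|x y /asboolP[r [rS ->]] /asboolP[r' [rS' ->]]]|move=> a x /asboolP[r [rS ->]]];
    apply/asboolP.
  - by exists (fun=> 0); split=> [i|]; [apply: rpred0 | rewrite big1].
  - exists (fun i => r i + r' i); split=> [i|]; [exact: rpredD | by rewrite big_split].
  - by exists (fun i => a *: r i); split=> [i|]; [exact: rpredZ | rewrite scaler_sumr].
pose U1 := HB.pack_for (submodClosed V) U (GRing.isSubmodClosed.Build A V U Uc).
have IHU x : x \in U1 -> killed x -> x = 0.
  by move=> /asboolP[r [rS ->]] kx; apply: IH kx => // i; [apply: simS | apply: unS].
have [_ Smin] := simS ord_max.
pose W : {pred V} := [pred x | (x \in S ord_max) && (x \in U1)].
have Wc : GRing.subsemimod_closed W.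
  split; [split=> [|x y /andP[xS xU] /andP[yS yU]]|move=> a x /andP[xS xU]]; apply/andP; split;
   rewrite ?rpred0 //; by [apply: rpredD | apply: rpredZ].
pose W1 := HB.pack_for (submodClosed V) W (GRing.isSubmodClosed.Build A V W Wc).
have restU : \sum_(i < n) s (widen_ord (leqnSn n) i) \in U1.
  by apply/asboolP; exists (fun i => s (widen_ord (leqnSn n) i)); split=> // i; apply: sS.
rewrite big_ord_recr in kS *.
have [|W0|SW] := Smin W1; first by move=> x /andP[].
  have ks : killed (s ord_max).
    move=> a a0; apply: W0; apply/andP; split; first by rewrite rpredZ.
    have /eqP := kS a a0; rewrite scalerDr addrC addr_eq0 => /eqP ->.
    by rewrite -scaleN1r !rpredZ.
  have s0 := unS _ _ (sS ord_max) ks.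
  by rewrite /= s0 addr0 in kS *; apply: IHU.
apply: IHU => //; apply: rpredD => //.
by have /andP[] := SW _ (sS ord_max).
Qed.

(** The socle may also contain simple modules not killed by e. The terms of [x] in them add up to a
    killed element, hence to 0, and on the remaining ones [simple_killed_brad] applies. *)
Lemma killed_soc_brad x : x \in soc V -> killed x ->
  forall a b, acts_as (ov a) b -> brad bP b -> a *: x = 0.
Proof.
move=> /soc_simple_sum[n [S [s [simS sS ->]]]] kx a b ab rb.
pose K i := `[< forall y, y \in S i -> killed y >].
have K1 i : K i -> forall y, y \in S i -> killed y by move/asboolP.
have sumE : \sum_i s i = \sum_(i | K i) s i + \sum_(i | ~~ K i) s i by rewrite (bigID K).
have k1 : killed (\sum_(i | K i) s i).
  by apply: (big_ind killed) => [c _|y z|i Ki]; [rewrite scaler0|apply: killedD|apply: K1 Ki _ _].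
have s2 : \sum_(i | ~~ K i) s i = 0.
  have k2 : killed (\sum_(i | ~~ K i) s i).
    by have := killedB kx k1; rewrite sumE addrC addKr.
  rewrite -big_filter in k2 *.
  move: (filter _ _) (filter_all (fun i => ~~ K i) (index_enum 'I_n)) k2 => l lK.
  pose o := tnth (in_tuple l).
  rewrite big_tnth => k2.
  apply: (unkilled_sum (S := fun i => S (o i))) k2 => // i y yS ky.
  have /asboolP nK : ~~ K (o i) by apply: (allP lK); apply: mem_tnth.
  by have [kS|] := simple_killed (simS (o i)); [case: nK | apply].
rewrite sumE s2 addr0 scaler_sumr big1 // => i Ki.
by apply: (simple_killed_brad (simS i) (K1 i Ki) (sS i) ab rb).
Qed.

End KilledSocle.

Section PrincipalIdeal.
Variables (k : fieldType) (Pi : algebra k) (Q : lmodType Pi) (G : glue Q).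
Local Notation A := (ord G).
Local Notation oe := (idem_val (oid G)).

Lemma acts0_principal (a : A) : acts_as (ov a) 0 -> a \in principal_ideal oe.
Proof.
move=> /acts_as0[x [xe ->]]; apply: rpred_sum => l _; rewrite -xe.
by apply: idealMr; apply: idealMl; apply/asboolP => I; apply.
Qed.

Lemma principal_acts0 (a : A) : a \in principal_ideal oe -> acts_as (ov a) 0.
Proof.
pose K : {pred A} := [pred a | `[< acts_as (ov a) 0 >]].
have Kz : zmod_closed K.
  split=> [|x y /asboolP x0 /asboolP y0]; apply/asboolP.
    by move=> z; rewrite ov0 mul0r raddf0 scale0r.
  by rewrite ovB -(subr0 0); apply: acts_asB.
have Kl x y : y \in K -> x * y \in K.
  move=> /asboolP y0; apply/asboolP; have [b xb] := ov_acts x.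
  by rewrite ovM -(mulr0 b); apply: acts_asM.
have Kr x y : y \in K -> y * x \in K.
  move=> /asboolP y0; apply/asboolP; have [b xb] := ov_acts x.
  by rewrite ovM -(mul0r b); apply: acts_asM.
pose K1 := HB.pack_for (ideal A) K (GRing.isZmodClosed.Build A K Kz)
  (isIdeal.Build A K Kl Kr).
move=> /asboolP/(_ K1) H; suff /asboolP : a \in K1 by [].
by apply: H => _ ->; apply/asboolP; apply: acts_oid.
Qed.

End PrincipalIdeal.

(** * The relative cotop of a module X isomorphic to A e_j *)

Section GlueCotop.
Variables (k : fieldType) (P : algebra k) (T : finType) (bP : basic P T).
Variables (J : {set T}) (G : glue (cofree (bset bP J))).
Variables (j : T) (jJ : j \in J).
Local Notation Q := (cofree (bset bP J)).
Local Notation R := (fps k).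
Local Notation Ah := (gring G).
Local Notation e := (gid G).
Local Notation kap := (gkap G).
Local Notation A := (ord G).
Local Notation oe := (idem_val (oid G)).
Local Notation al := (alg_struct A).
Local Notation alh := (alg_struct Ah).

Variable ej : Ah.
Hypothesis ej_e : ej * e = ej.
Hypothesis ej_idem : ej * ej = ej.
Hypothesis kap_ej : forall z x, (kap (z * ej) : Q) x = (kap z : Q) (bidem bP j * x).

Variables (X : lmodType A) (io : {linear X -> over_mod G}).
Hypothesis io_inj : injective io.
Hypothesis io_ej : forall x, (io x : Ah) * ej = (io x : Ah).
Hypothesis io_ord : forall x, is_ord (io x : Ah).
Hypothesis io_surj : forall z : Ah, is_ord z -> z * ej = z -> exists x, (io x : Ah) = z.

Lemma ioD x y : (io (x + y) : Ah) = (io x : Ah) + (io y : Ah).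
Proof. exact: linearD. Qed.
Lemma ioZ a x : (io (a *: x) : Ah) = ov a * (io x : Ah).
Proof. exact: linearZ_LR. Qed.

Lemma alhK r (y z : Ah) : r != 0 -> alh r * y = alh r * z -> y = z.
Proof.
move=> r0 yz; have [|r0'|/eqP] := @gtf _ _ _ G r (y - z).
- by rewrite mulrBr yz subrr.
- by rewrite r0' eqxx in r0.
- by rewrite subr_eq0 => /eqP.
Qed.

Lemma tfX r (x : X) : al r *: x = 0 -> r = 0 \/ x = 0.
Proof.
move=> rx; have [|r0|x0] := @gtf _ _ _ G r (io x); [|by left|right].
  by rewrite -(ov_alg G) -ioZ rx; exact: linear0.
by apply: io_inj; rewrite linear0; exact: x0.
Qed.

(* w is the element z of Ah ej, via X \otimes K = Ah ej \otimes K. *)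
Definition denotes (w : ext_scal X) (z : Ah) :=
  exists r x, [/\ r != 0, w = pure_tensor x (tofrac r)^-1 & (io x : Ah) = alh r * z].

Lemma denotes_ej w z : denotes w z -> z * ej = z.
Proof.
by move=> [r [x [r0 _ xz]]]; apply: (alhK r0); rewrite mulrA -xz io_ej.
Qed.

Lemma denotes_fun w z z' : denotes w z -> denotes w z' -> z = z'.
Proof.
move=> [r [x [r0 -> xz]]] [r' [x' [r'0 xx' x'z']]].
move: xx' => /(pure_tensor_eq tfX x x' r0 r'0) /(congr1 (fun y => io y : Ah)).
rewrite !ioZ !ov_alg xz x'z' !mulrA -!rmorphM [r' * r]mulrC.
by apply: alhK; rewrite mulf_neq0.
Qed.

Lemma denotes_inj w w' z : denotes w z -> denotes w' z -> w = w'.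
Proof.
move=> [r [x [r0 -> xz]]] [r' [x' [r'0 -> x'z]]].
apply/(pure_tensor_eq tfX x x' r0 r'0)/io_inj.
by apply: etrans (ioZ _ _) _; apply: etrans _ (esym (ioZ _ _));
  rewrite !ov_alg xz x'z !mulrA -!rmorphM mulrC.
Qed.

Lemma denotesD w w' z z' : denotes w z -> denotes w' z' -> denotes (w + w') (z + z').
Proof.
move=> [r [x [r0 -> xz]]] [r' [x' [r'0 -> x'z']]].
exists (r * r'), (al r' *: x + al r *: x'); split; first by rewrite mulf_neq0.
  rewrite pure_tensorD; congr (_ + _); apply/(pure_tensor_eq tfX) => //;
    by rewrite ?mulf_neq0 // scalerA -rmorphM mulrC.
by rewrite ioD !ioZ !ov_alg xz x'z' !mulrA -!rmorphM mulrDr [r' * r]mulrC.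
Qed.

Lemma denotesZ a w z : denotes w z -> denotes (a *: w) (ov a * z).
Proof.
move=> [r [x [r0 -> xz]]]; exists r, (a *: x); split=> //.
  by rewrite pure_tensorZ.
by rewrite ioZ xz !mulrA (alg_central r (ov a)).
Qed.

Lemma denotesB w w' z z' : denotes w z -> denotes w' z' -> denotes (w - w') (z - z').
Proof.
move=> wz wz'; apply: denotesD => //; have := denotesZ (-1) wz'.
by rewrite scaleN1r -[ov (-1) * z']/(- 1 * z') mulN1r.
Qed.

Lemma denotes_io x : denotes (pure_tensor x 1) (io x : Ah).
Proof.
exists 1, x; rewrite oner_eq0; split=> //.
  by rewrite tofrac1 invr1.
by rewrite rmorph1 mul1r.
Qed.

Lemma denotes_ex z : z * ej = z -> exists w, denotes w z.
Proof.
move=> zej; have ze : z * e = z by rewrite -zej -mulrA ej_e.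
have [x xE] : exists x, (io x : Ah) = alh (fpsX k) * z.
  by apply: io_surj; [apply: torsion_kap | rewrite -mulrA zej].
by exists (pure_tensor x (tofrac (fpsX k))^-1), (fpsX k), x; rewrite fpsX_neq0.
Qed.

Lemma latticeP w : w \in lattice X <-> exists x, w = pure_tensor x 1.
Proof. by split=> [/asboolP|xw]; last apply/asboolP. Qed.

Lemma denotes_lattice w z : denotes w z -> w \in lattice X <-> kap z = 0.
Proof.
move=> wz; have zej := denotes_ej wz; have ze : z * e = z by rewrite -zej -mulrA ej_e.
split=> [/latticeP[x wx]|].
  apply/(is_ord_kap ze); rewrite (denotes_fun wz (z' := io x)) //.
  by rewrite wx; apply: denotes_io.
move=> /(is_ord_kap ze)/io_surj/(_ zej)[x xz]; apply/latticeP; exists x.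
by apply: denotes_inj wz _; rewrite -xz; apply: denotes_io.
Qed.

(** If y_l = v_l w lies in X for all l, then w = sum_l u_l v_l w is the element sum_l u_l y_l of Ah.
    This confines the part of the cotop killed by e to Ah e_j / A e_j. *)
Lemma denotes_conductor w : (forall l, ogv l *: w \in lattice X) -> exists z, denotes w z.
Proof.
have [r [x [r0 ->]]] := pure_tensor_ex w => vw.
have yP l : exists y, ogv l *: x = al r *: y.
  have /latticeP[y yE] := vw l; exists y.
  move: yE; rewrite pure_tensorZ -[1]invr1 -tofrac1.
  by move=> /(pure_tensor_eq tfX _ _ r0 (oner_neq0 _)); rewrite rmorph1 scale1r.
have [y yE] := choice yP.
exists (\sum_l gu l * (io (y l) : Ah)), r, x; split=> //.
rewrite mulr_sumr -[LHS]mul1r -(guv G) mulr_suml; apply: eq_bigr => l _.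
by rewrite -mulrA -(ov_ogv l) -ioZ yE ioZ ov_alg !mulrA alg_central.
Qed.

Lemma kap_comp z : z * ej = z -> (kap z : Q) \in cofree_comp (bP := bP) (J := J) j.
Proof. by move=> zej; apply/cofree_compP => x; rewrite -kap_ej zej. Qed.

Lemma comp_brad (f : Q) : f \in cofree_comp (bP := bP) (J := J) j ->
  (forall p, brad bP p -> p *: f = 0) ->
  f = alg_struct P (f (bidem bP j)) *: cofree_char bP jJ.
Proof.
move=> /cofree_compP fj rf; apply: cofreeP => x; rewrite cofree_algE /=.
rewrite cofree_brad // (bigD1 j) //= big1 ?addr0 => [|i /andP[_ ij]]; first by rewrite mulrC.
by rewrite -fj bidemM eq_sym (negPf ij) cofree0 mulr0.
Qed.

Lemma char_lift : exists2 z, z * ej = z & kap z = cofree_char bP jJ.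
Proof.
have [z zE] := gkap_surj G (cofree_char bP jJ).
exists (z * ej); first by rewrite -mulrA ej_idem.
apply: cofreeP => x; rewrite kap_ej zE /= bcharM bchar_idem eqxx mul1r //.
Qed.

Lemma kap_algC c z : kap (alh (fpsC c) * z) = alg_struct P c *: (kap z : Q).
Proof. by rewrite gkap_scale. Qed.

(** The preimage in Ah e_j of the socle line of Q_j, viewed inside X \otimes K. *)
Definition char_sub : {pred ext_scal X} := [pred w | `[< exists z c,
  denotes w z /\ kap z = alg_struct P c *: cofree_char bP jJ >]].
Fact char_sub_closed : GRing.subsemimod_closed char_sub.
Proof.
split; [split=> [|w w' /asboolP[z [c [wz zc]]] /asboolP[z' [c' [wz' zc']]]]
       |move=> a w /asboolP[z [c [wz zc]]]]; apply/asboolP.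
- exists 0, 0; split; last by rewrite raddf0 rmorph0 scale0r.
  have := denotes_io 0; rewrite linear0; congr denotes.
  by apply/tensor_sumP; apply: Tensor0.
- exists (z + z'), (c + c'); split; first exact: denotesD.
  by rewrite raddfD /= zc zc' rmorphD scalerDl.
- have [b ab] := ov_acts a; exists (ov a * z), (c * bchar bP j b).
  split; first exact: denotesZ.
  by rewrite ab zc scalerA -alg_central -scalerA (cofree_char_scale bP jJ b) scalerA -rmorphM.
Qed.
HB.instance Definition _ :=
  GRing.isSubmodClosed.Build A (ext_scal X) char_sub char_sub_closed.

(** Modulo X it embeds by kap in the line of the character j, on which the constants act
    transitively enough to make every nonzero element a generator. *)
Lemma char_sub_semisimple : semisimple_over char_sub.
Proof.
split=> [w wl|].
  have /latticeP[x wx] := wl; apply/asboolP; exists (io x), 0.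
  have wz : denotes w (io x) by rewrite wx; apply: denotes_io.
  by split=> //; rewrite rmorph0 scale0r; apply/(denotes_lattice wz).
apply: semisimple_of_cyclic => u u'; rewrite -[u]mod_repr -[u']mod_repr => u0.
have /asboolP[z [c [wz zc]]] := valP (repr u).
have /asboolP[z' [c' [wz' zc']]] := valP (repr u').
have c0 : c != 0.
  apply: contra u0 => /eqP c0; apply/eqP; rewrite -(raddf0 (mod_pi _)).
  apply/mod_piP; rewrite subr0 inE; apply/(denotes_lattice wz).
  by rewrite zc c0 rmorph0 scale0r.
exists (al (fpsC (c' / c))); rewrite -linearZ_LR; apply/mod_piP; rewrite inE.
have wz'' := denotesB wz' (denotesZ (al (fpsC (c' / c))) wz).
apply/(denotes_lattice wz''); rewrite raddfB /= ov_alg kap_algC zc zc'.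
by rewrite scalerA -rmorphM divfK // subrr.
Qed.

Lemma char_sub_corad w z c : denotes w z ->
  kap z = alg_struct P c *: cofree_char bP jJ -> w \in corad X.
Proof.
move=> wz zc; apply: (corad_largest X).2 char_sub_semisimple _ _.
by apply/asboolP; exists z, c.
Qed.

Lemma rel_cotop_bsimple : exists h : bsimple bP j -> rel_cotop oe X,
  [/\ {morph h : x y / x + y}, bijective h &
      forall a b c, acts_as (ov a) b -> h (b *: c) = a *: h c].
Proof.
have [z0 z0ej z0E] := char_lift.
have [w0 w0z] := denotes_ex z0ej.
pose w (c : k) := al (fpsC c) *: w0.
have wz c : denotes (w c) (alh (fpsC c) * z0) by apply: denotesZ.
have kapw c : kap (alh (fpsC c) * z0) = alg_struct P c *: cofree_char bP jJ.
  by rewrite kap_algC z0E.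
have wcorad c : w c \in corad X by apply: char_sub_corad (wz c) (kapw c).
pose q (c : k) : cotop X := mod_pi _ (in_sub (wcorad c)).
have qker c : q c \in ann_by (cotop X) (principal_ideal oe).
  apply/asboolP => a /principal_acts0 a0; rewrite -linearZ_LR -(raddf0 (mod_pi _)).
  apply/mod_piP; rewrite subr0 inE.
  by apply/(denotes_lattice (denotesZ a (wz c))); rewrite a0 scale0r.
pose h (c : bsimple bP j) : rel_cotop oe X := in_sub (qker c).
have hD c d : h (c + d) = h c + h d.
  apply: val_inj; change (q (c + d) = q c + q d); rewrite /q -linearD.
  apply: (congr1 (mod_pi _)).
  by apply: val_inj; rewrite val_submodD /= /w !rmorphD scalerDl.
have hZ a b c : acts_as (ov a) b -> h (b *: c) = a *: h c.
  move=> ab; apply: val_inj; change (q (b *: c) = a *: q c).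
  rewrite /q -linearZ_LR; apply/mod_piP.
  rewrite inE; apply/(denotes_lattice (denotesB (wz _) (denotesZ a (wz c)))).
  rewrite raddfB /= ab !kapw scalerA -alg_central -scalerA (cofree_char_scale bP jJ b) scalerA.
  by rewrite -rmorphM bsimple_scaleE mulrC subrr.
exists h; split=> //; apply: surj_bij => [c d /(congr1 val) /= /mod_piP|u].
  rewrite inE => /(denotes_lattice (denotesB (wz c) (wz d))).
  rewrite raddfB /= !kapw => /(congr1 (fun f : Q => f 1)).
  rewrite cofree_addE cofree_oppE !cofree_algE /= bchar1 !mulr1 => /eqP.
  by rewrite subr_eq0 => /eqP.
have /asboolP uker := valP u; set y := repr (val u : cotop X).
have yE : mod_pi _ y = val u by apply: mod_repr.
have lat a : a *: val u = 0 -> a *: val y \in lattice X.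
  by rewrite -yE -linearZ_LR -(raddf0 (mod_pi _)) => /mod_piP; rewrite subr0 inE.
(* The v_l lie in the ideal of e, so they send a representative of the class into X. *)
have [z yz] : exists z, denotes (val y) z.
  apply: denotes_conductor => l; apply/lat/uker/acts0_principal.
  by rewrite -ogv_corner ovM -(mul0r (acts_val (ogv l))); apply: acts_asM;
    [apply: acts_oid | apply: acts_valP].
(* Radical elements of P kill a killed element of the socle, so kap z is killed by rad P. *)
have kz : kap z = alg_struct P ((kap z : Q) (bidem bP j)) *: cofree_char bP jJ.
  apply: comp_brad; first by apply/kap_comp/(denotes_ej yz).
  move=> p rp; have [a ap] := acts_surj G p.
  rewrite -(ap z); apply/(denotes_lattice (denotesZ a yz))/lat.
  apply: (killed_soc_brad (bP := bP)) ap rp.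
    exact: (corad_largest X).1.2.
  by move=> b /acts0_principal; apply: uker.
exists ((kap z : Q) (bidem bP j)); apply: val_inj; rewrite /= -yE; apply/mod_piP.
rewrite inE; apply/(denotes_lattice (denotesB (wz _) yz)).
by rewrite raddfB /= kapw -kz subrr.
Qed.

End GlueCotop.

(** * Indecomposable summands of A e *)

Section LeftIdealMaps.
Variable A : pzRingType.

Lemma left_ideal_mulr (a b c : A) : a * c * b = a * c ->
  exists f : {linear submod (left_ideal a) -> submod (left_ideal b)},
    forall w, (val (f w) : A) = (val w : A) * c.
Proof.
move=> acb; have fP (w : submod (left_ideal a)) :
    exists z : submod (left_ideal b), (val z : A) = (val w : A) * c.
  have [d wd] := val_left_idealP w.
  have [z zE] := left_ideal_mem b (d * (a * c)); exists z.
  by rewrite zE wd -mulrA acb mulrA.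
have [f fE] := choice fP.
have [|g gE] := @ex_linear A _ _ f; last by exists g; rewrite gE.
move=> d w w'; apply: val_inj.
have fD : (val (d *: f w + f w') : A) = d * (val (f w) : A) + (val (f w') : A).
  by rewrite val_left_idealD val_left_idealZ.
apply: etrans (fE _) _; apply: etrans _ (esym fD).
by rewrite val_left_idealD val_left_idealZ mulrDl -mulrA !fE.
Qed.

Variable e : A.
Hypothesis ee : e * e = e.

Lemma left_ideal_idr (w : submod (left_ideal e)) : (val w : A) * e = (val w : A).
Proof. by have [d ->] := val_left_idealP w; rewrite -mulrA ee. Qed.

Lemma left_ideal_gen : exists w : submod (left_ideal e), (val w : A) = e.
Proof. by have [w wE] := left_ideal_mem e 1; exists w; rewrite wE mul1r. Qed.

Lemma left_ideal_endo (f : {linear submod (left_ideal e) -> submod (left_ideal e)}) :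
  exists2 c, e * c * e = c & forall w, (val (f w) : A) = (val w : A) * c.
Proof.
have [g gE] := left_ideal_gen.
have fE w : (val (f w) : A) = (val w : A) * (val (f g) : A).
  rewrite -val_left_idealZ -(linearZ_LR f); apply: (congr1 (fun z => val (f z) : A)).
  by apply: val_inj; rewrite [RHS]val_left_idealZ gE left_ideal_idr.
exists (val (f g)) => //.
by rewrite -{1}gE -fE left_ideal_idr.
Qed.
End LeftIdealMaps.

Section KrullSchmidt.
Variables (k : fieldType) (P : algebra k) (Q : lmodType P) (G : glue Q).
Variables (T : finType) (J : {set T}).
Local Notation Ah := (gring G).
Local Notation e := (gid G).
Local Notation A := (ord G).
Local Notation oe := (idem_val (oid G)).
Local Notation Ae := (submod (left_ideal oe)).
Local Notation alh := (alg_struct Ah).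

Variables (ej : T -> Ah) (chi : T -> Ah -> k).
Hypothesis ej_l : forall j, e * ej j = ej j.
Hypothesis ej_r : forall j, ej j * e = ej j.
Hypothesis ej_idem : forall j, ej j * ej j = ej j.
Hypothesis chiB : forall j x y, chi j (x - y) = chi j x - chi j y.
Hypothesis chiM : forall j x y, e * x * e = x -> e * y * e = y ->
  chi j (x * y) = chi j x * chi j y.
Hypothesis chiZ : forall j c x, chi j (alh (fpsC c) * x) = c * chi j x.
Hypothesis chi_ej : forall i j, i \in J -> j \in J -> chi i (ej j) = (i == j)%:R.
Hypothesis chi_unit : forall x, e * x * e = x -> (forall j, j \in J -> chi j x = 0) ->
  exists y, y * (1 - x) = 1.

Fact oej_subproof : exists f : T -> A, forall j, ov (f j) = ej j.
Proof.
have fP j : exists a : A, ov a = ej j by apply: is_ord_left; apply: ej_l.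
by have [f fE] := choice fP; exists f.
Qed.
Definition oej : T -> A := sval (cid oej_subproof).
Lemma ov_oej j : ov (oej j) = ej j.
Proof. exact: (svalP (cid oej_subproof)). Qed.
Local Notation Aej j := (submod (left_ideal (oej j))).

Lemma oej_idem j : oej j * oej j = oej j.
Proof. by apply: ov_inj; rewrite ovM !ov_oej ej_idem. Qed.
Lemma oej_l j : oe * oej j = oej j.
Proof. by apply: ov_inj; rewrite ovM ov_oid !ov_oej ej_l. Qed.

Lemma chi0 j : chi j 0 = 0.
Proof. by rewrite -(subrr 0) chiB subrr. Qed.

(** An idempotent satisfies (1 - x) x = 0, and here 1 - x is left invertible. *)
Lemma chi_idem_eq0 x : e * x * e = x -> x * x = x ->
  (forall j, j \in J -> chi j x = 0) -> x = 0.
Proof.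
move=> exe xx cx; have [y yx] := chi_unit exe cx.
by rewrite -[x]mul1r -yx -mulrA mulrBl mul1r xx subrr mulr0.
Qed.

Lemma ej_corner j x : ej j * x * ej j = x -> e * x * e = x.
Proof. by move=> <-; rewrite !mulrA ej_l -!mulrA ej_r. Qed.

Lemma chi_ej_corner i j x : ej j * x * ej j = x -> i \in J -> j \in J -> i != j ->
  chi i x = 0.
Proof.
move=> xj iJ jJ ij; have xl : x = ej j * x by rewrite -xj !mulrA ej_idem.
rewrite xl chiM ?chi_ej // ?(negPf ij) ?mul0r //; first by rewrite ej_l ej_r.
exact: ej_corner xj.
Qed.

Lemma Aej_nonzero j : j \in J -> ~ zero_mod (Aej j).
Proof.
move=> jJ z; have [w wE] := left_ideal_gen (oej j).
have /(congr1 (fun w : Aej j => chi j (ov (val w : A)))) := z w.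
by rewrite wE ov_oej chi_ej // eqxx [RHS]chi0 => /eqP; rewrite oner_eq0.
Qed.

(** Idempotent endomorphisms correspond to idempotents c of e_j E e_j, where chi_j is the only
    character of E that can be nonzero. Its value at c is 0 or 1, so [chi_idem_eq0] applies to c or
    to e_j - c. *)
Lemma Aej_indecomposable j : j \in J -> indecomposable (Aej j).
Proof.
move=> jJ; apply: indecomposable_idempotent => [|f ff]; first exact: Aej_nonzero.
have [c cj fE] := left_ideal_endo (oej_idem j) f.
have cc : c * c = c.
  have [w wE] := left_ideal_gen (oej j).
  have jc : oej j * c = c by rewrite -cj !mulrA oej_idem.
  by have /(congr1 (fun w : Aej j => val w : A)) := ff w; rewrite !fE wE jc.
have ocj : ej j * ov c * ej j = ov c by rewrite -ov_oej -!ovM cj.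
have key x : ej j * x * ej j = x -> x * x = x -> chi j x = 0 -> x = 0.
  move=> xj xx x0; apply: chi_idem_eq0 => //; first exact: ej_corner xj.
  by move=> i iJ; have [->//|ij] := eqVneq i j; apply: chi_ej_corner xj _ _ ij.
have cs : chi j (ov c) * chi j (ov c) = chi j (ov c).
  by rewrite -chiM ?(ej_corner ocj) // -ovM cc.
have [c0|c0] := eqVneq (chi j (ov c)) 0.
  left=> w; apply: val_inj; apply: etrans (fE w) _.
  by rewrite (_ : c = 0) ?mulr0 //; apply: ov_inj; apply: key; rewrite -?ovM ?cc.
right=> w; apply: val_inj; apply: etrans (fE w) _.
suff -> : c = oej j by apply: left_ideal_idr; apply: oej_idem.
apply: ov_inj; apply/eqP; rewrite -subr_eq0 -oppr_eq0 opprB ov_oej; apply/eqP.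
have jc : ej j * ov c = ov c by rewrite -ocj !mulrA ej_idem.
have cjr : ov c * ej j = ov c by rewrite -ocj -!mulrA ej_idem.
apply: key.
- by rewrite mulrBr mulrBl ej_idem ej_idem ocj.
- by rewrite mulrBr !mulrBl ej_idem jc cjr -ovM cc subrr subr0.
- rewrite chiB chi_ej // eqxx; apply/eqP; rewrite subr_eq0; apply/eqP.
  by apply: (mulfI c0); rewrite cs mulr1.
Qed.

Lemma Aej_ind j : j \in J -> ind Ae (Aej j).
Proof.
move=> jJ; split; first exact: Aej_indecomposable.
have [|f fE] := @left_ideal_mulr A oe (oej j) (oej j); first by rewrite -mulrA oej_idem.
have [|h hE] := @left_ideal_mulr A (oej j) oe oe; first by rewrite -mulrA oid_idem.
exists (submod (kernel f)); apply: (split_decomposition (h := h)) => w.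
apply: val_inj; apply: etrans (fE _) _; rewrite hE.
by rewrite -mulrA oej_l; apply: left_ideal_idr; apply: oej_idem.
Qed.

(** The summand X is cut out by an idempotent c of E. It is not in the radical, so some chi_j(c) is
    nonzero and e_j c e_j is left invertible in e_j E e_j. Thus A e_j splits off the indecomposable
    X. *)
Lemma ind_Aej (X : lmodType A) : ind Ae X -> exists2 j, j \in J & lin_iso X (Aej j).
Proof.
move=> [indX [Y AeXY]].
have [i pK] : exists iX : {linear X -> Ae}, exists pX : {linear Ae -> X}, cancel iX pX.
  have [f /linear_inverse[g fK gK]] := AeXY.
  have [|i iE] := @ex_linear A X Ae (fun x => g (x, 0)).
    move=> a x y; rewrite -linearP; congr (g _).
    by apply: injective_projections; rewrite //= scaler0 addr0.
  have [|p pE] := @ex_linear A Ae X (fun w => (f w).1); first by move=> a x y; rewrite linearP.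
  by exists i, p => x; rewrite iE pE gK.
move: pK => [p pK].
have [c ce cE] := left_ideal_endo (oid_idem G) (i \o p : {linear Ae -> Ae}).
have ovce : e * ov c * e = ov c by rewrite -ov_oid -!ovM ce.
have cc : c * c = c.
  have [w wE] := left_ideal_gen oe.
  have ec : oe * c = c by rewrite -ce !mulrA oid_idem.
  have := cE (i (p w)); rewrite /= pK => /esym.
  by rewrite [in X in X = _]cE /= wE ec -[X in _ = X]/(val ((i \o p) w)) cE wE ec.
have [j jJ cj] : exists2 j, j \in J & chi j (ov c) != 0.
  apply: contrapT => nex.
  have c0 : c = 0.
    apply: ov_inj; apply: chi_idem_eq0 => //; first by rewrite -ovM cc.
    by move=> j jJ; apply: contrapT => /eqP cj; apply: nex; exists j.
  case: indX => nzX _; apply: nzX => x; rewrite -(pK x).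
  suff -> : i x = 0 by rewrite linear0.
  apply: val_inj; rewrite -[x in LHS]pK; apply: etrans (cE (i x)) _.
  by rewrite c0 mulr0.
exists j => //.
pose a := chi j (ov c).
(* The choice of a gives chi_j(y) = 0, so 1 - y is left invertible, and (1 - y) e_j = a^-1 e_j c
   e_j. *)
pose y := ej j - alh (fpsC a^-1) * (ej j * ov c * ej j).
have cl : ej j * (ej j * ov c * ej j) = ej j * ov c * ej j by rewrite !mulrA ej_idem.
have cr : ej j * ov c * ej j * ej j = ej j * ov c * ej j by rewrite -!mulrA ej_idem.
have ycor : ej j * y * ej j = y.
  rewrite /y mulrBr mulrBl ej_idem ej_idem; congr (_ - _).
  move: (_ * ov c * _) cl cr => w cl cr.
  by rewrite mulrA -alg_central -[_ * ej j * w]mulrA cl -mulrA cr.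
have ejcor : e * ej j * e = ej j by rewrite ej_l ej_r.
have chiu : chi j (ej j * ov c * ej j) = a.
  rewrite chiM // ?chiM // ?chi_ej // ?eqxx ?mul1r ?mulr1 //.
  by rewrite !mulrA ej_l -mulrA (_ : ov c * e = ov c) // -ovce -!mulrA gidP.
have [z zy] : exists z, z * (1 - y) = 1.
  apply: chi_unit => [|i' i'J]; first exact: ej_corner ycor.
  have [->|ij] := eqVneq i' j; last exact: chi_ej_corner ycor _ _ ij.
  by rewrite chiB chiZ chiu chi_ej // eqxx mulVf // subrr.
pose z' := ej j * z * alh (fpsC a^-1) * ej j.
have z'c : z' * ov c * ej j = ej j.
  have yj : (1 - y) * ej j = alh (fpsC a^-1) * (ej j * ov c * ej j).
    by rewrite mulrBl mul1r mulrBl ej_idem -(mulrA (alh _) _ (ej j)) cr subKr.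
  have : ej j * (z * ((1 - y) * ej j)) = ej j.
    by rewrite [z * _]mulrA zy mul1r ej_idem.
  by rewrite yj /z' !mulrA.
have [z0 z0E] : is_ord z' by apply: is_ord_left; rewrite /z' !mulrA ej_l.
have z0j : oej j * z0 = z0.
  by apply: ov_inj; rewrite ovM ov_oej z0E /z' !mulrA ej_idem.
have z0e : z0 * oe = z0.
  by apply: ov_inj; rewrite ovM ov_oid z0E /z' -!mulrA ej_r.
have [|f fE] := @left_ideal_mulr A oe (oej j) (oej j); first by rewrite -mulrA oej_idem.
have [|h hE] := @left_ideal_mulr A (oej j) oe z0; first by rewrite -mulrA z0e.
exists (f \o i : {linear X -> Aej j}).
apply: (indecomposable_split (h := (p \o h : {linear Aej j -> X}))) => //; last first.
  exact: Aej_nonzero.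
move=> w; apply: val_inj; apply: etrans (fE _) _.
rewrite -[i _]/((i \o p) (h w)) cE hE -!mulrA.
suff -> : z0 * (c * oej j) = oej j by apply: left_ideal_idr; apply: oej_idem.
by apply: ov_inj; rewrite !ovM z0E ov_oej mulrA z'c.
Qed.

End KrullSchmidt.

(** * Gluing data over power series *)

(** [fps] has coefficients in a field; the coefficients needed here are matrices over gPig. *)
Record series (M : Type) := Series { scoef : nat -> M }.
HB.instance Definition _ (M : Type) := gen_eqMixin (series M).
HB.instance Definition _ (M : Type) := gen_choiceMixin (series M).

Section Series.
Variable M : pzRingType.
Implicit Types f g h : series M.

Lemma seriesP f g : scoef f =1 scoef g -> f = g.
Proof. by case: f; case: g => f g /= /funext ->. Qed.

Definition ser_zero : series M := Series (fun=> 0).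
Definition ser_add f g := Series (fun n => scoef f n + scoef g n).
Definition ser_opp f := Series (fun n => - scoef f n).
Definition serC (c : M) : series M := Series (fun n => if n is 0%N then c else 0).
Definition ser_mul f g :=
  Series (fun n => \sum_(i < n.+1) scoef f i * scoef g (n - i)).

Fact ser_addA : associative ser_add.
Proof. by move=> f g h; apply: seriesP => n /=; rewrite addrA. Qed.
Fact ser_addC : commutative ser_add.
Proof. by move=> f g; apply: seriesP => n /=; rewrite addrC. Qed.
Fact ser_add0 : left_id ser_zero ser_add.
Proof. by move=> f; apply: seriesP => n /=; rewrite add0r. Qed.
Fact ser_addN : left_inverse ser_zero ser_opp ser_add.
Proof. by move=> f; apply: seriesP => n /=; rewrite addNr. Qed.
Fact ser_mulA : associative ser_mul.
Proof.
move=> f g h; apply: seriesP => n /=.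
pose F i j := scoef f i * (scoef g (j - i) * scoef h (n - j)).
transitivity (\sum_(0 <= i < n.+1) \sum_(i <= j < n.+1) F i j).
  rewrite big_mkord; apply: eq_bigr => i _; rewrite mulr_sumr.
  have -> : \sum_(i <= j < n.+1) F i j = \sum_(j < (n - i).+1) F i (j + i)%N.
    by rewrite -{1}[i : nat]add0n big_addn subSn -1?ltnS // big_mkord.
  by apply: eq_bigr => j _; rewrite /F addnK addnC subnDA.
transitivity (\sum_(0 <= i < n.+1) \sum_(0 <= j < n.+1 | (i <= j)%N) F i j).
  by apply: eq_bigr => i _; rewrite (big_nat_widenl i 0).
rewrite (exchange_big_dep xpredT) //= big_mkord; apply: eq_bigr => j _.
rewrite mulr_suml; transitivity (\sum_(0 <= i < j.+1) F i j).
  by rewrite (big_nat_widen 0 j.+1 n.+1) //; apply: eq_bigl => i; rewrite ltnS.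
by rewrite big_mkord; apply: eq_bigr => i _; rewrite /F mulrA.
Qed.
Fact ser_mul1 : left_id (serC 1) ser_mul.
Proof.
move=> f; apply: seriesP => n /=; rewrite big_ord_recl /= mul1r subn0.
by rewrite big1 ?addr0 // => i _; rewrite mul0r.
Qed.
Fact ser_1mul : right_id (serC 1) ser_mul.
Proof.
move=> f; apply: seriesP => n /=; rewrite big_ord_recr /= subnn mulr1.
rewrite big1 ?add0r // => -[i lti] _ /=.
by rewrite -(subnSK lti) mulr0.
Qed.
Fact ser_mulDl : left_distributive ser_mul ser_add.
Proof.
move=> f g h; apply: seriesP => n /=; rewrite -big_split /=.
by apply: eq_bigr => i _; rewrite mulrDl.
Qed.
Fact ser_mulDr : right_distributive ser_mul ser_add.
Proof.
move=> f g h; apply: seriesP => n /=; rewrite -big_split /=.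
by apply: eq_bigr => i _; rewrite mulrDr.
Qed.
HB.instance Definition _ := GRing.isPzRing.Build (series M)
  ser_addA ser_addC ser_add0 ser_addN
  ser_mulA ser_mul1 ser_1mul ser_mulDl ser_mulDr.

Lemma scoefM f g n : scoef (f * g) n = \sum_(i < n.+1) scoef f i * scoef g (n - i).
Proof. by []. Qed.
Lemma scoefM0 f g : scoef (f * g) 0 = scoef f 0 * scoef g 0.
Proof. by rewrite scoefM big_ord1. Qed.
Lemma scoefB f g n : scoef (f - g) n = scoef f n - scoef g n.
Proof. by []. Qed.
Lemma scoef_sum (I : Type) (r : seq I) (q : pred I) (F : I -> series M) n :
  scoef (\sum_(i <- r | q i) F i) n = \sum_(i <- r | q i) scoef (F i) n.
Proof. by elim/big_rec2: _ => // i x y _ <-. Qed.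
Lemma scoef1 n : scoef 1 n = (n == 0%N)%:R.
Proof. by case: n. Qed.
Lemma serCM a b : serC (a * b) = serC a * serC b.
Proof.
apply: seriesP => -[|n]; first by rewrite scoefM0.
rewrite scoefM big1 // => -[[|i] lti] _ /=; last by rewrite mul0r.
by rewrite mulr0.
Qed.
Lemma serCD a b : serC (a + b) = serC a + serC b.
Proof. by apply: seriesP => -[|n] /=; rewrite ?addr0. Qed.
Lemma serC_sum (I : Type) (r : seq I) (q : pred I) (F : I -> M) :
  serC (\sum_(i <- r | q i) F i) = \sum_(i <- r | q i) serC (F i).
Proof.
elim/big_rec2: _ => [|i x y _ <-]; last exact: serCD.
by apply: seriesP => -[|n].
Qed.

Lemma scoefX_eq0 f n m : scoef f 0 = 0 -> (m < n)%N -> scoef (f ^+ n) m = 0.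
Proof.
move=> f0; elim: n m => // n IH m ltmn; rewrite exprS scoefM big1 // => -[[|i] lti] _ /=.
  by rewrite f0 mul0r.
rewrite IH ?mulr0 //; rewrite ltnS in lti.
apply: (@leq_trans m); last by rewrite -ltnS.
by rewrite ltn_subrL /= (leq_trans _ lti).
Qed.

(** The geometric series of h = 1 - a f converges coefficientwise because h has no constant term; it
    inverts a f. *)
Lemma series_left_inverse f a : a * scoef f 0 = 1 -> exists g, g * f = 1.
Proof.
move=> af; pose h := 1 - serC a * f.
have h0 : scoef h 0 = 0 by rewrite scoefB scoefM0 scoef1 /= af subrr.
(* In degree m only the powers h^n with n <= m contribute. *)
pose s := Series (fun m => scoef (\sum_(n < m.+1) h ^+ n) m).
exists (s * serC a); rewrite -mulrA -[serC a * f](subKr 1) -/h.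
apply: seriesP => m.
transitivity (scoef ((\sum_(n < m.+1) h ^+ n) * (1 - h)) m).
  rewrite !scoefM; apply: eq_bigr => -[i lti] _ /=; congr (_ * _).
  rewrite !scoef_sum -(big_mkord xpredT (fun n => scoef (h ^+ n) i)).
  rewrite -[RHS](big_mkord xpredT (fun n => scoef (h ^+ n) i)).
  rewrite [RHS](@big_cat_nat _ _ _ i.+1) //= [X in _ + X]big_nat_cond [X in _ + X]big1 ?addr0 //.
  by move=> n /andP[/andP[ltin _] _]; apply: scoefX_eq0.
have -> : (\sum_(n < m.+1) h ^+ n) * (1 - h) = 1 - h ^+ m.+1.
  rewrite mulr_suml; under eq_bigr do rewrite mulrBr mulr1 -exprSr.
  rewrite sumrB big_ord_recl expr0 [X in _ - X]big_ord_recr /= -addrA; congr (_ + _).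
  by rewrite opprD addrA subrr add0r.
by rewrite scoefB scoefX_eq0 // subr0.
Qed.

End Series.

Section SeriesAlgebra.
Variables (k : fieldType) (M : algebra k).
Local Notation al := (alg_struct M).

Definition ser_alg (r : fps k) : series M := Series (fun n => al (fps_coef r n)).
Fact ser_alg_zmod : zmod_morphism ser_alg.
Proof. by move=> r s; apply: seriesP => n /=; rewrite rmorphB. Qed.
Fact ser_alg_monoid : monoid_morphism ser_alg.
Proof.
split=> [|r s]; apply: seriesP => n /=.
  by case: n => [|n]; rewrite ?rmorph1 ?rmorph0.
by rewrite rmorph_sum; apply: eq_bigr => i _; rewrite rmorphM.
Qed.
HB.instance Definition _ :=
  GRing.isZmodMorphism.Build (fps k) (series M) ser_alg ser_alg_zmod.
HB.instance Definition _ :=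
  GRing.isMonoidMorphism.Build (fps k) (series M) ser_alg ser_alg_monoid.
Fact ser_central c (x : series M) : ser_alg c * x = x * ser_alg c.
Proof.
apply: seriesP => n; rewrite !scoefM (reindex_inj rev_ord_inj) /=.
by apply: eq_bigr => -[i lti] _ /=; rewrite subSS subKn // alg_central.
Qed.
Definition series_alg : algebra (fps k) := Algebra ser_central.

Lemma series_torsion_free r (z : series M) : ser_alg r * z = 0 -> r = 0 \/ z = 0.
Proof.
move=> rz; have [->|r0] := eqVneq r 0; [by left | right].
apply: contrapT => /eqP z0.
have [n rn nmin] : exists2 n, fps_coef r n != 0 & forall i, (i < n)%N -> fps_coef r i = 0.
  have ex : exists n, fps_coef r n != 0.
    apply: contrapT => nex; case/eqP: r0; apply: fpsP => n.
    by apply: contrapT => /eqP rn; apply: nex; exists n.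
  have [n rn nmin] := ex_minnP ex; exists n => // i ltin.
  by apply: contraTeq ltin => /nmin; rewrite -leqNgt.
have [m zm mmin] : exists2 m, scoef z m != 0 & forall i, (i < m)%N -> scoef z i = 0.
  have ex : exists n, scoef z n != 0.
    apply: contrapT => nex; case/eqP: z0; apply: seriesP => i.
    by apply: contrapT => /eqP zn; apply: nex; exists i.
  have [m zm mmin] := ex_minnP ex; exists m => // i ltin.
  by apply: contraTeq ltin => /mmin; rewrite -leqNgt.
have := congr1 (fun f => scoef f (n + m)) rz; rewrite scoefM.
have ltn : (n < (n + m).+1)%N by rewrite ltnS leq_addr.
rewrite (bigD1 (Ordinal ltn)) //= addKn big1 ?addr0 => [|i neq].
  move=> /(congr1 (fun x => al (fps_coef r n)^-1 * x)).
  by rewrite mulrA -rmorphM mulVf // rmorph1 mul1r mulr0 => /eqP; rewrite (negPf zm).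
have [ltin|ltni|eqin] := ltngtP i n; last by case/eqP: neq; apply: val_inj.
  by rewrite nmin // rmorph0 mul0r.
rewrite mmin ?mulr0 //; have := ltn_ord i; rewrite ltnS => lei.
by rewrite ltn_subLR // ltn_add2r.
Qed.

End SeriesAlgebra.

(** Among the subspaces contained in S, one of maximal dimension contains every v in S, since adding
    the line of v does not leave S. *)
Lemma vspace_of_prop (k : fieldType) (vT : vectType k) (S : vT -> Prop) :
  S 0 -> (forall a x y, S x -> S y -> S (a *: x + y)) ->
  exists U : {vspace vT}, forall v, v \in U <-> S v.
Proof.
move=> S0 SD.
pose good n := `[< exists U : {vspace vT}, \dim U = n /\ forall v, v \in U -> S v >].
have good0 : exists n, good n.
  exists 0%N; apply/asboolP; exists 0%VS; split; first exact: dimv0.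
  by move=> v; rewrite memv0 => /eqP ->.
have bound n : good n -> (n <= \dim {:vT})%N.
  by move=> /asboolP[U [<- _]]; apply: dimvS; apply: subvf.
case: (ex_maxnP good0 bound) => n /asboolP[U [Un US]] nmax.
exists U => v; split=> [/US//|Sv].
have : good (\dim (U + <[v]>)).
  apply/asboolP; exists (U + <[v]>)%VS; split=> // w /memv_addP[u uU [v' /vlineP[c ->] ->]].
  by rewrite addrC; apply: SD => //; apply: US.
move=> /nmax; rewrite -Un => le.
have sub : (U <= U + <[v]>)%VS by apply: addvSl.
have /eqP -> : U == (U + <[v]>)%VS by rewrite eqEdim sub.
by apply: (subvP (addvSr U _)); apply: memv_line.
Qed.

(** * A basis adapted to a subspace of a finite-dimensional algebra *)

Section AdaptedBasis.
Variables (k : fieldType) (M : algebra k).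
Local Notation al := (alg_struct M).

Lemma adapted_basis (S : M -> Prop) : finite_dim M ->
  S 0 -> (forall c x y, S x -> S y -> S (al c * x + y)) ->
  exists N (b : 'I_N -> M) (q : 'I_N -> bool),
    (forall x, exists! c : {ffun 'I_N -> k}, x = \sum_i al (c i) * b i) /\
    (forall c : 'I_N -> k, S (\sum_i al (c i) * b i) <-> forall i, ~~ q i -> c i = 0).
Proof.
case=> n [b0 [co [co_lin coE]]] S0 SD.
pose vT : vectType k := 'rV[k]_n.
pose phi (x : M) : vT := \row_i co i x.
pose psi (v : vT) : M := \sum_i al (v 0 i) * b0 i.
have phiK x : psi (phi x) = x.
  by rewrite [RHS]coE; apply: eq_bigr => i _; rewrite mxE.
have psiP a v w : psi (a *: v + w) = al a * psi v + psi w.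
  rewrite mulr_sumr -big_split; apply: eq_bigr => i _ /=.
  by rewrite !mxE rmorphD rmorphM mulrDl mulrA.
have phiP a x y : phi (al a * x + y) = a *: phi x + phi y.
  by apply/rowP => i; rewrite !mxE co_lin.
have psi0 : psi 0 = 0 by rewrite /psi big1 // => i _; rewrite mxE rmorph0 mul0r.
have phi0 : phi 0 = 0.
  by apply: (addIr (phi 0)); rewrite add0r -[X in X + _]scale1r -phiP mulr0 addr0.
have psi_sum I (r : seq I) c (F : I -> vT) :
    psi (\sum_(i <- r) c i *: F i) = \sum_(i <- r) al (c i) * psi (F i).
  by elim: r => [|i r IH]; rewrite ?big_nil // !big_cons psiP IH.
(* The coordinates [co] may be redundant, so M is identified with the image V of [phi], the fixed
   space of [phi \o psi], and not with all of k^n. *)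
have [V VP] : exists V : {vspace vT}, forall v, v \in V <-> phi (psi v) = v.
  apply: vspace_of_prop; first by rewrite psi0 phi0.
  by move=> a x y xE yE; rewrite psiP phiP xE yE.
have [W WP] : exists W : {vspace vT}, forall v, v \in W <-> phi (psi v) = v /\ S (psi v).
  apply: vspace_of_prop; first by rewrite psi0 phi0.
  move=> a x y [xE xS] [yE yS]; rewrite psiP phiP xE yE; split=> //; exact: SD.
have WV : (W <= V)%VS by apply/subvP => v /WP[vE _]; apply/VP.
pose D := (V :\: W)%VS.
have DWV : (W + D)%VS = V by rewrite addvC addv_diff; apply/addv_idPl.
have dWD : directv (W + D) by apply/directv_addP; rewrite capvC capv_diff.
pose X := vbasis W; pose Y := vbasis D.
pose N := (\dim W + \dim D)%N.
pose Z : N.-tuple vT := [tuple of X ++ Y].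
have Zb : basis_of V Z by rewrite -DWV; apply: cat_basis => //; apply: vbasisP.
have Zfree := basis_free Zb.
have ZV (i : 'I_N) : Z`_i \in V.
  by apply: (basis_mem Zb); apply: mem_nth; rewrite size_tuple ltn_ord.
have sumV (c : 'I_N -> k) : \sum_(i < N) c i *: Z`_i \in V.
  by rewrite memv_suml // => i _; rewrite memvZ.
have Zl (i : 'I_(\dim W)) : Z`_(lshift (\dim D) i) = X`_i.
  by rewrite nth_cat size_tuple /= ltn_ord.
pose q (i : 'I_N) := (i < \dim W)%N.
have inW (c : 'I_N -> k) : \sum_(i < N) c i *: Z`_i \in W <-> forall i, ~~ q i -> c i = 0.
  split=> [cW i qi|c0].
    move: (coord_sum_free c i Zfree); set w := \sum_(i < N) c i *: Z`_i in cW * => <-.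
    pose d (i : 'I_N) := match split i with inl l => coord X l w | inr _ => 0 end.
    have -> : w = \sum_(i < N) d i *: Z`_i.
      rewrite [LHS](coord_basis (vbasisP W) cW) big_split_ord /=.
      rewrite [X in _ = _ + X]big1 ?addr0 => [|l _]; last first.
        by rewrite /d (_ : split _ = inr l) ?scale0r //; apply: (unsplitK (inr l)).
      apply: eq_bigr => l _; rewrite /d (_ : split _ = inl l); last exact: (unsplitK (inl l)).
      by have := Zl l => /= ->.
    by rewrite coord_sum_free // /d; case: splitP qi => // l; rewrite /q => ->; rewrite ltn_ord.
  rewrite memv_suml // => i _; have [qi|qi] := boolP (q i); last by rewrite c0 // scale0r mem0v.
  rewrite memvZ // /Z /= nth_cat size_tuple -/(q i) qi.
  by apply: (basis_mem (vbasisP W)); apply: mem_nth; rewrite size_tuple.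
exists N, (fun i => psi Z`_i), q; split=> [x|c].
  have xV : phi x \in V by apply/VP; rewrite phiK.
  exists [ffun i => coord Z i (phi x)]; split.
    rewrite -[LHS]phiK (coord_basis Zb xV) psi_sum.
    by apply: eq_bigr => i _; rewrite ffunE -(coord_basis Zb xV).
  move=> c xc; apply/ffunP => i; rewrite ffunE xc -psi_sum.
  have /VP -> := sumV c; exact: coord_sum_free.
rewrite -psi_sum -inW; split=> [Sc|/WP[]//].
by apply/WP; split=> //; apply/VP.
Qed.

End AdaptedBasis.

Section SeriesGlue.
Variables (k : fieldType) (Pi : algebra k) (Q : lmodType Pi) (M : algebra k).
Variables (e : M) (kap : {additive M -> Q}) (m : nat) (u v : 'I_m -> M).
Hypothesis ee : e * e = e.
Hypothesis uv : \sum_l u l * v l = 1.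
Hypothesis ue : forall l, u l * e = u l.
Hypothesis ev : forall l, e * v l = v l.
Hypothesis kap_id : kap e = 0.
Hypothesis kap_mulid : forall z, kap (z * e) = kap z.
Hypothesis kap_surj : forall q, exists z, kap z = q.
Hypothesis kap_right : forall c, exists th : {linear Q -> Q},
  forall z, kap (z * e * c) = th (kap z).
Hypothesis kap_endo : forall th : {linear Q -> Q}, exists c,
  forall z, kap (z * e * c) = th (kap z).
Hypothesis kap_scale : forall c z,
  kap (alg_struct M c * z) = alg_struct Pi c *: kap z.

(** Uses the constant coefficient only, so that t acts on Q by 0. *)
Definition skap (z : series_alg M) : Q := kap (scoef z 0).
Fact skap_zmod : zmod_morphism skap.
Proof. by move=> x y; rewrite /skap scoefB raddfB. Qed.
HB.instance Definition _ := GRing.isZmodMorphism.Build (series_alg M) Q skap skap_zmod.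

Fact sg_id : serC e * serC e = serC e.
Proof. by rewrite -serCM ee. Qed.
Fact sg_uv : \sum_l serC (u l) * serC (v l) = 1.
Proof. by under eq_bigr do rewrite -serCM; rewrite -serC_sum uv. Qed.
Fact sg_ue l : serC (u l) * serC e = serC (u l).
Proof. by rewrite -serCM ue. Qed.
Fact sg_ev l : serC e * serC (v l) = serC (v l).
Proof. by rewrite -serCM ev. Qed.
Fact sg_kap_mulid z : skap (z * serC e) = skap z.
Proof. by rewrite /skap scoefM0 kap_mulid. Qed.
Fact sg_kap_surj q : exists z, skap z = q.
Proof. by have [z zq] := kap_surj q; exists (serC z). Qed.
Fact sg_kap_right c : exists th : {linear Q -> Q}, forall z, skap (z * serC e * c) = th (skap z).
Proof.
have [th thE] := kap_right (scoef c 0); exists th => z.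
by rewrite /skap !scoefM0 thE.
Qed.
Fact sg_kap_endo (th : {linear Q -> Q}) : exists c, forall z, skap (z * serC e * c) = th (skap z).
Proof.
have [c cE] := kap_endo th; exists (serC c) => z.
by rewrite /skap !scoefM0 cE.
Qed.
Fact sg_kap_scale r z :
  skap (alg_struct (series_alg M) r * z) = alg_struct Pi (fps_coef r 0) *: skap z.
Proof. by rewrite /skap scoefM0 kap_scale. Qed.
Definition series_glue : glue Q := @Glue k Pi Q (series_alg M) (serC e) skap m
  (fun l => serC (u l)) (fun l => serC (v l)) sg_id sg_uv sg_ue sg_ev kap_id
  sg_kap_mulid sg_kap_surj sg_kap_right sg_kap_endo sg_kap_scale
  (@series_torsion_free k M).

Local Notation al := (alg_struct M).
Local Notation A := (ord series_glue).

Definition mstab (x : M) := exists b, forall w, kap (x * w) = b *: kap w.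

Lemma is_ord_series (x : series_alg M) : is_ord (G := series_glue) x <-> mstab (scoef x 0).
Proof.
split=> [[a <-]|[b xb]].
  have [b ab] := ov_acts a; exists b => w.
  by have := ab (serC w); rewrite [in LHS]/gkap /= /skap scoefM0.
by apply: (@acts_ord _ _ _ series_glue _ b) => z; rewrite /= /skap scoefM0 xb.
Qed.

Hypothesis fdM : finite_dim M.

(** With S the space of [mstab] elements, A consists of the series whose constant coefficient is in
    S. For a basis of M adapted to S, the b_i in S and the t b_i for the other i form a basis of A
    over R; [tp i] is the exponent of t. *)
Lemma series_is_order : is_order A.
Proof.
have S0 : mstab 0 by exists 0 => w; rewrite mul0r raddf0 scale0r.
have SD c x y : mstab x -> mstab y -> mstab (al c * x + y).
  move=> [b xb] [b' yb']; exists (alg_struct Pi c * b + b') => w.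
  by rewrite mulrDl raddfD /= -mulrA kap_scale xb yb' scalerDl scalerA.
have [N [b [q [bP qP]]]] := adapted_basis fdM S0 SD.
pose tp (i : 'I_N) : nat := if q i then 0%N else 1%N.
pose mono (n : nat) (x : M) : series_alg M := Series (fun i => if i == n then x else 0).
have ordP i : is_ord (G := series_glue) (mono (tp i) (b i)).
  apply/is_ord_series; rewrite /tp; case: (boolP (q i)) => qi //=.
  have -> : b i = \sum_j al ((j == i)%:R) * b j.
    rewrite (bigD1 i) //= eqxx rmorph1 mul1r big1 ?addr0 // => j ji.
    by rewrite (negPf ji) rmorph0 mul0r.
  by apply/qP => j qj; case: eqP qj => // ->; rewrite qi.
have [B BE] := choice ordP.
have sumE (c : 'I_N -> fps k) n : scoef (\sum_i ov (alg_struct A (c i) * B i)) n =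
    \sum_i al (if (tp i <= n)%N then fps_coef (c i) (n - tp i) else 0) * b i.
  rewrite scoef_sum; apply: eq_bigr => i _; rewrite ovM ov_alg BE [LHS]scoefM.
  case: leqP => [le|lt].
    have lt : (n - tp i < n.+1)%N by rewrite ltnS leq_subr.
    rewrite (bigD1 (Ordinal lt)) //= subKn // eqxx big1 ?addr0 // => j ji.
    case: eqP => // jE; last by rewrite mulr0.
    by case/eqP: ji; apply: val_inj; rewrite /= -jE subKn // -ltnS.
  rewrite rmorph0 mul0r big1 // => j _ /=; case: eqP => [jE|]; last by rewrite mulr0.
  by move: lt; rewrite -jE ltnNge leq_subr.
have sumB (c : {ffun 'I_N -> fps k}) (x : A^o) :
    x = \sum_i alg_struct A (c i) *: (B i : A^o) <->
    forall n, scoef (ov x) n =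
      \sum_i al (if (tp i <= n)%N then fps_coef (c i) (n - tp i) else 0) * b i.
  split=> [-> n|xn]; first by rewrite -sumE -ov_sum.
  by apply: ov_inj; apply: seriesP => n; rewrite xn -sumE -ov_sum.
exists N, (fun i => B i : A^o) => x.
have [co coP] := choice (fun n => bP (scoef (ov x) n)).
(* For b_i outside S the coordinate of an element of A has no constant term, so it is divisible by
   t. *)
have co0 : forall i, ~~ q i -> co 0%N i = 0.
  apply/(qP (fun i => co 0%N i)); rewrite -(coP 0%N).1.
  by apply/is_ord_series; exists x.
exists [ffun i => Fps (fun n => co (n + tp i)%N i)]; split.
  apply/sumB => n; rewrite [LHS](coP n).1; apply: eq_bigr => i _; congr (al _ * _).
  rewrite ffunE /=; case: leqP => [le|]; first by rewrite subnK.
  by rewrite /tp; case: (boolP (q i)) => // qi; rewrite ltnS leqn0 => /eqP ->; apply: co0.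
move=> c /sumB xc; apply/ffunP => i; rewrite ffunE; apply: fpsP => n /=.
have := (coP (n + tp i)%N).2 [ffun i' => if (tp i' <= n + tp i)%N
  then fps_coef (c i') (n + tp i - tp i') else 0].
move=> -> ; first by rewrite ffunE leq_addl addnK.
by rewrite [LHS]xc; apply: eq_bigr => j _; rewrite ffunE.
Qed.

End SeriesGlue.

Lemma finite_dim_fin (k : fieldType) (P : algebra k) (I : finType) (b : I -> P) (co : I -> P -> k) :
  (forall i c x y, co i (alg_struct P c * x + y) = c * co i x + co i y) ->
  (forall x, x = \sum_i alg_struct P (co i x) * b i) -> finite_dim P.
Proof.
move=> co_lin coE; exists #|I|, (fun i => b (enum_val i)), (fun i => co (enum_val i)).
split=> [i|x]; first exact: co_lin.
rewrite [LHS]coE (reindex (fun i : 'I_#|I| => enum_val i)) //=.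
by exists enum_rank => i _; [exact: enum_valK | exact: enum_rankK].
Qed.

(** * Corners and matrix algebras over k *)

Section CornerAlgebra.
Variables (k : fieldType) (P : algebra k) (g : idem P).
Local Notation gv := (idem_val g).
Fact corner_alg_subproof c : gv * (alg_struct P c * gv) * gv = alg_struct P c * gv.
Proof. by rewrite mulrA -alg_central -!mulrA !idemP. Qed.
Definition corner_alg_fun c : corner g := Corner (corner_alg_subproof c).
Fact corner_alg_zmod : zmod_morphism corner_alg_fun.
Proof. by move=> c d; apply: corner_val_inj; rewrite /= rmorphB mulrBl. Qed.
Fact corner_alg_monoid : monoid_morphism corner_alg_fun.
Proof.
split=> [|c d]; apply: corner_val_inj; rewrite /= ?rmorph1 ?mul1r //.
by rewrite rmorphM -!mulrA [gv * _]mulrA -[gv * _]alg_central -!mulrA idemP.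
Qed.
HB.instance Definition _ :=
  GRing.isZmodMorphism.Build k (corner g) corner_alg_fun corner_alg_zmod.
HB.instance Definition _ :=
  GRing.isMonoidMorphism.Build k (corner g) corner_alg_fun corner_alg_monoid.
Fact corner_alg_central c (x : corner g) : corner_alg_fun c * x = x * corner_alg_fun c.
Proof.
apply: corner_val_inj; rewrite /= -mulrA corner_idl.
by rewrite mulrA -alg_central -mulrA corner_idr.
Qed.
Definition corner_alg : algebra k := Algebra corner_alg_central.

Lemma corner_finite_dim : finite_dim P -> finite_dim corner_alg.
Proof.
case=> n [b [co [co_lin coE]]].
have bP i : gv * (gv * b i * gv) * gv = gv * b i * gv.
  by rewrite !mulrA idemP -!mulrA idemP.
exists n, (fun i => Corner (bP i)), (fun i x => co i (corner_val x)); split=> [i c x y|x].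
  by rewrite /= -mulrA corner_idl co_lin.
have cs (I : Type) (r : seq I) (F : I -> corner g) :
    corner_val (\sum_(i <- r) F i) = \sum_(i <- r) corner_val (F i).
  by elim/big_rec2: _ => // i y z _ <-.
apply: corner_val_inj; rewrite cs -[in LHS](cornerP x) {1}(coE (corner_val x)).
rewrite mulr_sumr mulr_suml; apply: eq_bigr => i _ /=.
by rewrite mulrA -alg_central -!mulrA [gv * (gv * _)]mulrA idemP.
Qed.
End CornerAlgebra.

Section MatrixAlgebra.
Variables (k : fieldType) (C : algebra k) (n : nat).
Local Notation M := 'M[C]_n.+1.

Definition umx (i j : 'I_n.+1) (a : C) : M :=
  \matrix_(p, q) (if (p == i) && (q == j) then a else 0).

Lemma mul_umx (z : M) i j a p q : (z * umx i j a) p q = if q == j then z p i * a else 0.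
Proof.
rewrite mxE (bigD1 i) //= big1 ?addr0 => [|r ri].
  by rewrite mxE eqxx /=; case: ifP => //; rewrite mulr0.
by rewrite mxE (negPf ri) mulr0.
Qed.
Lemma umx_mul (z : M) i j a p q : (umx i j a * z) p q = if p == i then a * z j q else 0.
Proof.
rewrite mxE (bigD1 j) //= big1 ?addr0 => [|r ri].
  by rewrite mxE eqxx andbT; case: ifP => //; rewrite mul0r.
by rewrite mxE (negPf ri) andbF mul0r.
Qed.
Lemma umxM i j j' l a b : umx i j a * umx j' l b = if j == j' then umx i l (a * b) else 0.
Proof.
apply/matrixP => p q; rewrite mul_umx mxE [j' == j]eq_sym.
case: (j == j'); rewrite !mxE ?andbT ?andbF ?mul0r ?if_same //.
by rewrite andbC; case: (q == l); case: (p == i); rewrite ?mul0r.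
Qed.
Lemma umx_sum : \sum_i umx i ord0 1 * umx ord0 i 1 = 1.
Proof.
apply/matrixP => p q; rewrite summxE (bigD1 p) //= big1 ?addr0 => [|i ip].
  by rewrite umxM eqxx !mxE eqxx /= mulr1 eq_sym; case: eqP.
by rewrite umxM eqxx mxE eq_sym (negPf ip).
Qed.
Lemma umx_corner (z : M) i a b : umx i i a * z * umx i i b = umx i i (a * z i i * b).
Proof.
apply/matrixP => p q; rewrite mul_umx umx_mul mxE andbC.
by case: (q == i); case: (p == i); rewrite ?mul0r.
Qed.

Definition mx_alg_fun (c : k) : M := (alg_struct C c)%:M.
Fact mx_alg_zmod : zmod_morphism mx_alg_fun.
Proof. by move=> c d; apply/matrixP => i j; rewrite !mxE rmorphB mulrnBl. Qed.
Fact mx_alg_monoid : monoid_morphism mx_alg_fun.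
Proof.
by split=> [|c d]; rewrite /mx_alg_fun ?rmorph1 // rmorphM scalar_mxM.
Qed.
HB.instance Definition _ :=
  GRing.isZmodMorphism.Build k M mx_alg_fun mx_alg_zmod.
HB.instance Definition _ :=
  GRing.isMonoidMorphism.Build k M mx_alg_fun mx_alg_monoid.
Lemma mx_alg_mul c (z : M) i j : (mx_alg_fun c * z) i j = alg_struct C c * z i j.
Proof.
rewrite mxE (bigD1 i) //= big1 ?addr0 => [|l li]; first by rewrite mxE eqxx.
by rewrite mxE eq_sym (negPf li) mul0r.
Qed.
Fact mx_alg_central c (z : M) : mx_alg_fun c * z = z * mx_alg_fun c.
Proof.
apply/matrixP => i j; rewrite mx_alg_mul mxE (bigD1 j) //= big1 ?addr0 => [|l li].
  by rewrite mxE eqxx alg_central.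
by rewrite mxE (negPf li) mulr0.
Qed.
Definition mx_alg : algebra k := Algebra mx_alg_central.

Lemma mx_finite_dim : finite_dim C -> finite_dim mx_alg.
Proof.
case=> m [b [co [co_lin coE]]].
pose bb (x : 'I_n.+1 * 'I_n.+1 * 'I_m) : mx_alg := umx x.1.1 x.1.2 (b x.2).
pose cc (x : 'I_n.+1 * 'I_n.+1 * 'I_m) (z : mx_alg) : k := co x.2 ((z : M) x.1.1 x.1.2).
apply: (finite_dim_fin (b := bb) (co := cc)) => [i c x y|z].
  by rewrite /cc mxE mx_alg_mul co_lin.
apply/matrixP => p q; rewrite summxE [LHS]coE.
rewrite -(pair_bigA _ (fun x l => (alg_struct mx_alg (cc (x, l) z) * bb (x, l) : M) p q)) /=.
rewrite (bigD1 (p, q)) //= [X in _ + X]big1 ?addr0 => [|[i j] ij].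
  by apply: eq_bigr => l _; rewrite mx_alg_mul mxE !eqxx.
rewrite big1 // => l _; rewrite mx_alg_mul mxE /=.
case: eqP => [pi|] /=; last by rewrite mulr0.
case: eqP => [qj|] /=; last by rewrite mulr0.
by rewrite pi qj eqxx in ij.
Qed.

End MatrixAlgebra.

Section CornerAction.
Variables (k : fieldType) (P : algebra k) (g : idem P).
Local Notation Q := (cofree (idem_val g)).

Fact corner_act_lin (f : Q) (c : corner g) a x y :
  f (corner_val c * (alg_struct P a * x + y)) =
  a * f (corner_val c * x) + f (corner_val c * y).
Proof. by rewrite mulrDr mulrA -alg_central -mulrA cofree_lin. Qed.
Fact corner_act_supp (f : Q) (c : corner g) x :
  f (corner_val c * (idem_val g * x)) = f (corner_val c * x).
Proof. by rewrite mulrA corner_idr. Qed.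
(** The right action of gPg on Hom_k(gP, k), dual to left multiplication on gP. *)
Definition corner_act (f : Q) (c : corner g) : Q :=
  Cofree (corner_act_lin f c) (corner_act_supp f c).

Lemma corner_actD f c d : corner_act f (c + d) = corner_act f c + corner_act f d.
Proof. by apply: cofreeP => x /=; rewrite mulrDl cofreeD. Qed.
Lemma corner_act0 f : corner_act f 0 = 0.
Proof. by apply: (addIr (corner_act f 0)); rewrite -corner_actD !add0r. Qed.
Lemma corner_actN f c : corner_act f (- c) = - corner_act f c.
Proof. by apply/eqP; rewrite -addr_eq0 -corner_actD addNr corner_act0. Qed.
Lemma corner_actM f c d : corner_act f (c * d) = corner_act (corner_act f c) d.
Proof. by apply: cofreeP => x /=; rewrite mulrA. Qed.
Lemma corner_act_linear c : exists th : {linear Q -> Q}, forall f, th f = corner_act f c.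
Proof.
have [|th thE] := @ex_linear P Q Q (corner_act^~ c); last by exists th; rewrite thE.
by move=> p f h; apply: cofreeP => x /=; rewrite mulrA.
Qed.
End CornerAction.

(** * The gluing datum of a finite-dimensional split basic algebra *)

Section BasicGlue.
Variables (k : fieldType) (P : algebra k) (T : finType) (bP : basic P T) (J : {set T}).
Variables (n : nat) (b : 'I_n -> P) (co : 'I_n -> P -> k).
Hypothesis co_lin : forall i c x y, co i (alg_struct P c * x + y) = c * co i x + co i y.
Hypothesis coE : forall x, x = \sum_i alg_struct P (co i x) * b i.

Let gJ : idem P := Idem (bset_idem bP J).
Local Notation g := (bset bP J).
Local Notation Q := (cofree g).
Local Notation C := (corner_alg gJ).
Local Notation M := (mx_alg C n).
Local Notation la := (bchar bP).
Local Notation ep := (bidem bP).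

(* The generator 0 of the free right C-module of rank n + 1 is sent to 0, and
   the generator l + 1 to the l-th coordinate form on P, restricted to g P. *)
Let coord l : Q := cofree_coord (bset_idem bP J) co_lin l.
Definition mkap (z : M) : Q :=
  \sum_l corner_act (g := gJ) (coord l) ((z : 'M[C]_n.+1) (lift ord0 l) ord0).
Fact mkap_zmod : zmod_morphism mkap.
Proof.
move=> x y; rewrite -sumrB; apply: eq_bigr => l _; rewrite !mxE corner_actD.
by rewrite corner_actN.
Qed.
HB.instance Definition _ := GRing.isZmodMorphism.Build M Q mkap mkap_zmod.

Let me : M := umx ord0 ord0 (1 : C).
Let mu l : M := umx l ord0 (1 : C).
Let mv l : M := umx ord0 l (1 : C).

Fact me_idem : me * me = me. Proof. by rewrite umxM eqxx mulr1. Qed.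
Fact mu_me l : mu l * me = mu l. Proof. by rewrite umxM eqxx mulr1. Qed.
Fact me_mv l : me * mv l = mv l. Proof. by rewrite umxM eqxx mulr1. Qed.
Fact muv : \sum_l mu l * mv l = 1. Proof. exact: umx_sum. Qed.

Lemma mkap_right z c :
  mkap (z * me * c) = corner_act (g := gJ) (mkap z) ((c : 'M[C]_n.+1) ord0 ord0).
Proof.
have [th thE] := corner_act_linear ((c : 'M[C]_n.+1) ord0 ord0).
rewrite -thE linear_sum; apply: eq_bigr => l _; rewrite thE -corner_actM.
suff -> : (z * me * c : 'M[C]_n.+1) (lift ord0 l) ord0 =
    (z : 'M[C]_n.+1) (lift ord0 l) ord0 * (c : 'M[C]_n.+1) ord0 ord0 by [].
rewrite -mulrA mxE (bigD1 ord0) //= big1 ?addr0 => [|i i0].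
  by rewrite [(me * c) _ _]umx_mul eqxx mul1r.
by rewrite [(me * c) _ _]umx_mul (negPf i0) mulr0.
Qed.

Fact mkap_id : mkap me = 0.
Proof. by rewrite /mkap big1 // => l _; rewrite mxE /= corner_act0. Qed.

Fact mkap_mulid z : mkap (z * me) = mkap z.
Proof.
by apply: eq_bigr => l _; rewrite mul_umx eqxx mulr1.
Qed.

Fact mkap_surj q : exists z, mkap z = q.
Proof.
exists (\matrix_(i, j) if unlift ord0 i is Some l then corner_alg_fun gJ (q (b l)) else 0).
rewrite [RHS](cofree_coordE (bset_idem bP J) co_lin coE); apply: eq_bigr => l _.
rewrite mxE liftK; apply: cofreeP => x; rewrite cofree_algE.
rewrite -[LHS]/(coord l (alg_struct P (q (b l)) * g * x)).
by rewrite -mulrA cofreeZ cofree_supp.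
Qed.

Fact mkap_right_lin c : exists th : {linear Q -> Q}, forall z, mkap (z * me * c) = th (mkap z).
Proof.
have [th thE] := corner_act_linear ((c : 'M[C]_n.+1) ord0 ord0).
by exists th => z; rewrite mkap_right thE.
Qed.

Fact mkap_endo (th : {linear Q -> Q}) : exists c, forall z, mkap (z * me * c) = th (mkap z).
Proof.
have [c gc thE] := cofree_endo (bset_idem bP J) co_lin coE th.
exists (umx ord0 ord0 (@Corner _ gJ c gc : C)) => z.
by rewrite mkap_right mxE /=; apply: cofreeP => x; rewrite thE.
Qed.

Fact mkap_scale c z : mkap (alg_struct M c * z) = alg_struct P c *: mkap z.
Proof.
rewrite scaler_sumr; apply: eq_bigr => l _; rewrite mx_alg_mul.
move: (_ (lift ord0 l) ord0) => y; apply: cofreeP => x; rewrite cofree_algE.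
rewrite -[LHS]/(coord l (alg_struct P c * g * corner_val y * x)) -!mulrA cofreeZ.
by rewrite [g * _]mulrA (corner_idl y).
Qed.

Definition basic_glue : glue Q := series_glue me_idem muv mu_me me_mv mkap_id mkap_mulid
  mkap_surj mkap_right_lin mkap_endo mkap_scale.

Lemma basic_glue_is_order : is_order (ord basic_glue).
Proof.
apply: series_is_order; apply: mx_finite_dim; apply: corner_finite_dim.
by exists n, b, co.
Qed.

Fact bcorner_subproof j : g * (g * ep j * g) * g = g * ep j * g.
Proof. by rewrite !mulrA bset_idem -!mulrA bset_idem. Qed.
Definition bcorner j : C := @Corner _ gJ _ (bcorner_subproof j).
Lemma bcorner_val j : corner_val (bcorner j) = if j \in J then ep j else 0.
Proof. by rewrite /= bset_idemr; case: ifP => jJ; rewrite ?mul0r // bset_idem_l jJ. Qed.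
Lemma bcornerE j : j \in J -> corner_val (bcorner j) = ep j.
Proof. by rewrite bcorner_val => ->. Qed.
Lemma bcorner_idem j : bcorner j * bcorner j = bcorner j.
Proof.
apply: corner_val_inj; rewrite -[LHS]/(corner_val (bcorner j) * corner_val (bcorner j)).
by rewrite bcorner_val; case: ifP => _; rewrite ?mulr0 // bidemM eqxx.
Qed.

Definition bej j : gring basic_glue := serC (umx ord0 ord0 (bcorner j) : M).
(** On E = (gPg)[[t]] and for j in J this is the residue character at j. *)
Definition bchi j (x : gring basic_glue) : k :=
  la j (corner_val ((scoef x 0 : 'M[C]_n.+1) ord0 ord0)).

Lemma bej_l j : gid basic_glue * bej j = bej j.
Proof. by rewrite -serCM umxM eqxx mul1r. Qed.
Lemma bej_r j : bej j * gid basic_glue = bej j.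
Proof. by rewrite -serCM umxM eqxx mulr1. Qed.
Lemma bej_idem j : bej j * bej j = bej j.
Proof. by rewrite -serCM umxM eqxx bcorner_idem. Qed.

Lemma bchiB j x y : bchi j (x - y) = bchi j x - bchi j y.
Proof. by rewrite /bchi scoefB !mxE /= bcharD bcharN. Qed.

Lemma gid_corner (x : gring basic_glue) : gid basic_glue * x * gid basic_glue = x ->
  scoef x 0 = umx ord0 ord0 ((scoef x 0 : 'M[C]_n.+1) ord0 ord0) :> 'M[C]_n.+1.
Proof.
move=> xe; rewrite -[in LHS]xe !scoefM0 [LHS]umx_corner.
by rewrite mul1r mulr1.
Qed.

Lemma bchiM j x y : gid basic_glue * x * gid basic_glue = x ->
  gid basic_glue * y * gid basic_glue = y -> bchi j (x * y) = bchi j x * bchi j y.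
Proof.
move=> xe ye; rewrite /bchi scoefM0 (gid_corner xe) (gid_corner ye).
by rewrite umxM eqxx !mxE /= bcharM.
Qed.

Lemma bchiZ j c x : bchi j (alg_struct _ (fpsC c) * x) = c * bchi j x.
Proof.
have cx : scoef (alg_struct _ (fpsC c) * x) 0 = mx_alg_fun C n c * (scoef x 0 : 'M[C]_n.+1).
  exact: scoefM0.
rewrite /bchi cx mx_alg_mul.
rewrite -[corner_val _]/(alg_struct P c * g * corner_val ((scoef x 0 : 'M[C]_n.+1) ord0 ord0)).
by rewrite -mulrA (corner_idl ((scoef x 0 : 'M[C]_n.+1) ord0 ord0)) bcharZ.
Qed.

Lemma bchi_ej i j : i \in J -> j \in J -> bchi i (bej j) = (i == j)%:R.
Proof.
by move=> iJ jJ; rewrite /bchi mxE -[corner_val _]/(corner_val (bcorner j)) bcornerE // bchar_idem.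
Qed.

(** All characters vanish on the constant coefficient of x in gPg, which is therefore nilpotent; a
    left inverse modulo t lifts to the power series. *)
Lemma bchi_unit x : gid basic_glue * x * gid basic_glue = x ->
  (forall j, j \in J -> bchi j x = 0) -> exists y, y * (1 - x) = 1.
Proof.
move=> xe x0; pose a : C := (scoef x 0 : 'M[C]_n.+1) ord0 ord0.
have [m am] : exists m, corner_val a ^+ m = 0.
  apply: bnil (bP) _ _; apply: (@brad_corner _ _ _ bP J) => //.
  exact: (corner_idl a).
have am' : a ^+ m.+1 = 0.
  have aX i : corner_val (a ^+ i.+1) = corner_val a ^+ i.+1.
    by elim: i => [|i IH]; rewrite ?expr1 // exprS [RHS]exprS -IH.
  by apply: corner_val_inj; rewrite aX exprS am mulr0.
have [y ya] := nil_quasiregular am'.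
(* A left inverse of 1 - x modulo t: y inverts 1 - a in the corner, and elsewhere 1 - x is the
   identity matrix. *)
pose z : M := umx ord0 ord0 y + (1 - umx ord0 ord0 1).
apply: (series_left_inverse (a := z)); rewrite scoefB scoef1 /= (gid_corner xe) -/a.
rewrite /z mulrDl mulrBr mulr1 [_ * umx _ _ a]umxM eqxx.
rewrite mulrBl mul1r mulrBr mulr1 [umx _ _ 1 * umx _ _ a]umxM eqxx mul1r.
have e1 (p q r s : 'M[C]_n.+1) : p - q + (1 - r - (s - r)) = p - q + (1 - s).
  by rewrite opprB [1 - r + _]addrA subrK.
rewrite e1.
have uD (c d : C) : umx ord0 ord0 (c + d) = umx ord0 ord0 c + umx ord0 ord0 d :> M.
  by apply/matrixP => p q; rewrite !mxE; case: ifP; rewrite ?addr0.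
have yE : y = 1 + y * a :> C by rewrite -ya mulrBr mulr1 subrK.
by rewrite [in X in X - _ + _]yE uD addrK addrC subrK.
Qed.

Lemma bkap_ej j z x : j \in J ->
  (gkap basic_glue (z * bej j) : Q) x = (gkap basic_glue z : Q) (ep j * x).
Proof.
move=> jJ; rewrite -[gkap _ _]/(mkap (scoef (z * bej j) 0)) -[gkap _ z]/(mkap (scoef z 0)).
rewrite scoefM0 /= /mkap !cofree_sumE; apply: eq_bigr => l _.
rewrite [X in corner_act _ X](mul_umx _ ord0 ord0 (bcorner j)) eqxx.
by rewrite corner_actM -(bcornerE jJ).
Qed.

End BasicGlue.

(** * From Pi to the model *)

Section QuotientIsomorphism.
Variables (k : fieldType) (Pi : algebra k) (Q : lmodType Pi) (G : glue Q) (I : ideal Pi).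
Hypothesis annI : forall p, p \in I <-> forall f : Q, p *: f = 0.
Local Notation A := (ord G).
Local Notation oe := (idem_val (oid G)).
Local Notation B := (quot_alg (principal_ideal oe)).
Local Notation PiJ := (quot_alg I).

Lemma acts_as_ideal a p p' : acts_as (ov (a : A)) p -> acts_as (ov a) p' ->
  quot_pi (I) p = quot_pi _ p'.
Proof.
move=> ap ap'; apply/quot_piP/annI => f; have [z <-] := gkap_surj G f.
by rewrite scalerBl -ap -ap' subrr.
Qed.

Definition bar (u : B) : PiJ := quot_pi _ (acts_val (repr u : A)).

Lemma barE (a : A) p : acts_as (ov a) p -> bar (quot_pi _ a) = quot_pi _ p.
Proof.
move=> ap; pose r : A := repr (quot_pi (principal_ideal oe) a).
have ra : acts_as (ov (a - r)) 0.
  by apply: principal_acts0; apply/quot_piP; rewrite quot_repr.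
apply: (@acts_as_ideal r); first exact: acts_valP.
by rewrite -[r](subKr a) ovB -[p]subr0; apply: acts_asB.
Qed.

Lemma bar_pi (u : B) : exists a p,
  [/\ u = quot_pi _ a, acts_as (ov (a : A)) p & bar u = quot_pi _ p].
Proof.
exists (repr u), (acts_val (repr u : A)); rewrite quot_repr; split=> //; exact: acts_valP.
Qed.

Fact bar_zmod : zmod_morphism bar.
Proof.
move=> u v; have [a [p [-> ap ->]]] := bar_pi u; have [a' [p' [-> ap' ->]]] := bar_pi v.
by rewrite -rmorphB (barE (a := a - a') (acts_asB ap ap')) rmorphB.
Qed.
Fact bar_monoid : monoid_morphism bar.
Proof.
split=> [|u v]; first exact: (barE (a := 1) (@acts_as1 _ _ _ G)).
have [a [p [-> ap ->]]] := bar_pi u; have [a' [p' [-> ap' ->]]] := bar_pi v.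
by rewrite -rmorphM (barE (a := a * a') (acts_asM ap ap')) rmorphM.
Qed.
Lemma bar_rmorphism : exists phi : {rmorphism B -> PiJ}, forall u, phi u = bar u.
Proof.
by exists (HB.pack_for {rmorphism B -> PiJ} bar
  (GRing.isZmodMorphism.Build B PiJ bar bar_zmod)
  (GRing.isMonoidMorphism.Build B PiJ bar bar_monoid)).
Qed.

Lemma bar_eq (a : A) p : bar (quot_pi _ a) = quot_pi _ p <-> acts_as (ov a) p.
Proof.
split=> [|ap]; last exact: barE.
rewrite (barE (acts_valP a)) => /quot_piP/annI ap z.
by rewrite (acts_valP a) -[X in X *: _](subrK p) scalerDl ap add0r.
Qed.

Lemma bar_alg c : bar (alg_struct B (fpsC c)) = alg_struct PiJ c.
Proof.
change (bar (quot_pi (principal_ideal oe) (alg_struct A (fpsC c))) =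
  quot_pi I (alg_struct Pi c)).
by apply: barE => z; rewrite ov_alg gkap_scale.
Qed.

Lemma bar_bij : bijective bar.
Proof.
apply: surj_bij => [u v uv|q].
  have [a [p [ua ap up]]] := bar_pi u; have [a' [p' [va ap' vp]]] := bar_pi v.
  rewrite ua va; apply/quot_piP/acts0_principal; rewrite ovB -(subrr p).
  by apply: acts_asB => //; apply/bar_eq; rewrite -va -up -uv.
have [a ap] := acts_surj G (repr q).
by exists (quot_pi _ a); rewrite -[RHS]quot_repr; apply: barE.
Qed.

End QuotientIsomorphism.

Section PreprojectiveModel.
Variables (k : fieldType) (D : dynkin) (J : {set vertex D}).
Local Notation Pi := (preproj k D).
Variable bP : basic Pi (vertex D).
Hypothesis bPE : forall j, bidem bP j = vertex_idem k j.
Variables (n : nat) (b : 'I_n -> Pi) (co : 'I_n -> Pi -> k).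
Hypothesis co_lin : forall i c x y, co i (alg_struct Pi c * x + y) = c * co i x + co i y.
Hypothesis coE : forall x, x = \sum_i alg_struct Pi (co i x) * b i.

Local Notation g := (bset bP J).
Local Notation Q := (cofree g).

Let fdP : finite_dim Pi.
Proof. by exists n, b, co. Qed.

Lemma bset_set_idem : g = set_idem k J.
Proof. by apply: eq_bigr => j _; rewrite bPE. Qed.

Lemma ideal_ofP p : p \in ideal_of k J <-> forall f : Q, p *: f = 0.
Proof.
rewrite -(cofree_annihilator (bset_idem bP J) co_lin coE) /ideal_of.
by rewrite bset_set_idem.
Qed.

Variables (G : glue Q) (ej : vertex D -> gring G) (chi : vertex D -> gring G -> k).
Local Notation e := (gid G).
Hypothesis ej_l : forall j, e * ej j = ej j.
Hypothesis ej_r : forall j, ej j * e = ej j.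
Hypothesis ej_idem : forall j, ej j * ej j = ej j.
Hypothesis kap_ej : forall j z x, j \in J ->
  (gkap G (z * ej j) : Q) x = (gkap G z : Q) (bidem bP j * x).
Hypothesis chiB : forall j x y, chi j (x - y) = chi j x - chi j y.
Hypothesis chiM : forall j x y, e * x * e = x -> e * y * e = y ->
  chi j (x * y) = chi j x * chi j y.
Hypothesis chiZ : forall j c x, chi j (alg_struct _ (fpsC c) * x) = c * chi j x.
Hypothesis chi_ej : forall i j, i \in J -> j \in J -> chi i (ej j) = (i == j)%:R.
Hypothesis chi_unit : forall x, e * x * e = x -> (forall j, j \in J -> chi j x = 0) ->
  exists y, y * (1 - x) = 1.

Local Notation A := (ord G).
Local Notation oe := (idem_val (oid G)).
Local Notation Ae := (submod (left_ideal oe)).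
Local Notation B := (quot_alg (principal_ideal oe)).
Local Notation PiJ := (quot_alg (ideal_of k J)).

Variable phi : {rmorphism B -> PiJ}.
Hypothesis phiE : forall u, phi u = bar _ u.

Lemma bar_alg_iso : alg_iso phi.
Proof.
split=> [|c]; last by rewrite phiE; exact: (bar_alg G ideal_ofP).
have [h hK Kh] := bar_bij G ideal_ofP.
by exists h => x; [rewrite phiE hK | rewrite phiE Kh].
Qed.

Lemma phi_eq (a : A) p : phi (quot_pi _ a) = quot_pi _ p <-> acts_as (ov a) p.
Proof. by rewrite phiE; apply: (bar_eq (G := G) ideal_ofP). Qed.

Local Notation oj := (oej ej_l).
Local Notation Aej j := (submod (left_ideal (oj j))).

(** The embedding [io] realizes X as the intersection of A with Ah e_j, as [rel_cotop_bsimple]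
    requires. *)
Lemma Aej_cotop j (X : lmodType A) : j \in J -> lin_iso X (Aej j) ->
  iso_along phi (rel_cotop oe X) (bsimple bP j).
Proof.
move=> jJ [f /linear_inverse[h fK hK]].
have [|io ioE] := @ex_linear A X (over_mod G) (fun x => ov (val (f x) : A)).
  by move=> a x y; rewrite linearP val_left_idealD val_left_idealZ.
have io_inj : injective io.
  by move=> x y; rewrite !ioE => /ov_inj/val_inj/(can_inj fK).
have io_ej x : (io x : gring G) * ej j = (io x : gring G).
  rewrite ioE -(ov_oej ej_l) -ovM.
  by rewrite left_ideal_idr //; apply: oej_idem; apply: ej_idem.
have io_ord x : is_ord (io x : gring G) by rewrite ioE; exists (val (f x)).
have io_surj (z : gring G) : is_ord z -> z * ej j = z ->
    exists x, (io x : gring G) = z.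
  move=> [a az] zj; have [w wE] := left_ideal_mem (oj j) a.
  by exists (h w); rewrite ioE hK wE ovM az ov_oej zj.
have [s [sD sb sZ]] := rel_cotop_bsimple jJ (ej_r j) (ej_idem j)
  (fun z x => kap_ej z x jJ) io_inj io_ej io_ord io_surj.
have [t [sK tK]] := bij_additive_inverse sD sb.
exists t; first by exists s.
by move=> a p m /phi_eq ap; apply: (can_inj sK); rewrite tK (sZ a) // tK.
Qed.

(** Every p in Pi is the action of some a in A, so linearity over Pi can be checked on M. *)
Lemma iso_along_bsimple (M : lmodType A) (S S' : lmodType Pi) :
  iso_along phi M S -> iso_along phi M S' -> lin_iso S S'.
Proof.
move=> [f [f' fK f'K] fZ] [h hb hZ].
have [|l lE] := @ex_linear Pi S S' (h \o f').
  move=> p x y; have [a ap] := acts_surj G p.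
  have pa : phi (quot_pi _ a) = quot_pi _ p by apply/phi_eq.
  have f'P : f' (p *: x + y) = a *: f' x + f' y.
    by apply: (can_inj fK); rewrite f'K raddfD /= (fZ a p) // !f'K.
  by rewrite /= f'P raddfD /= (hZ a p).
exists l; rewrite lE; apply: bij_comp => //; by exists f.
Qed.

Lemma bsimple_inj i j : lin_iso (bsimple bP i) (bsimple bP j) -> i = j.
Proof.
case=> f /bij_inj finj; apply: contrapT => /eqP ij.
have := linearZ_LR f (bidem bP i) (1 : k).
rewrite !bsimple_scaleE bchar_idem eqxx mul1r bchar_idem eq_sym (negPf ij) mul0r.
move=> f1; have /eqP := finj (1 : k) 0 (etrans f1 (esym (linear0 f))).
by rewrite oner_eq0.
Qed.

Lemma Q_is_Q : is_Q J Q.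
Proof.
exists (fun j => cofree_comp j : submodClosed Q); split=> [j jJ|f].
  have iso := cofree_comp_iso bP jJ; split.
  - apply: injective_mod_iso iso _; apply: cofree_injective; exact: bset_idem.
  - by apply: indecomposable_iso iso _; apply: cofree_comp_indecomposable.
  - by have [v vP] := cofree_comp_simple_soc bP jJ; exists v; rewrite -bPE.
exact: cofree_decomposition.
Qed.

Lemma glue_cotop_bijection : cotop_bijection phi Q.
Proof.
have indA X : ind Ae X -> exists2 j, j \in J & lin_iso X (Aej j).
  apply: (ind_Aej (J := J) _ _ ej_idem chiB).
  - exact: ej_r.
  - exact: chiM.
  - exact: chiZ.
  - exact: chi_ej.
  - exact: chi_unit.
have Aind j : j \in J -> ind Ae (Aej j).
  apply: (Aej_ind (J := J) _ _ ej_idem chiB).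
  - exact: ej_r.
  - exact: chiM.
  - exact: chi_ej.
  - exact: chi_unit.
split=> [X /indA[j jJ Xj]|X X' S /indA[j jJ Xj] /indA[j' j'J X'j] XS X'S|S indS].
- exists (bsimple bP j); first exact: bsimple_ind_soc.
  exact: Aej_cotop.
- have SX := iso_along_bsimple XS (Aej_cotop jJ Xj).
  have SX' := iso_along_bsimple X'S (Aej_cotop j'J X'j).
  have jj' := bsimple_inj (lin_iso_trans (lin_iso_sym SX) SX').
  by subst j'; apply: lin_iso_trans Xj (lin_iso_sym X'j).
- have [j jJ Sj] := ind_soc_bsimple indS.
  exists (Aej j); first exact: Aind.
  have [|t tb tZ] := @Aej_cotop j (Aej j) jJ; first by exists idfun; exists idfun.
  have [h hb] := lin_iso_sym Sj.
  exists (h \o t : {additive _ -> _}); first exact: bij_comp.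
  by move=> a p m ap; rewrite -(linearZ_LR h); congr (h _); apply: tZ.
Qed.

Lemma fin_gen_cofree : fin_gen Q.
Proof.
exists n, (cofree_coord (bset_idem bP J) co_lin) => f.
exists (fun i => alg_struct Pi (f (b i))).
exact: (cofree_coordE (bset_idem bP J) co_lin coE).
Qed.

Lemma glue_models_along : models J (oid G).
Proof.
have injQ : injective_mod Q by apply: cofree_injective; apply: bset_idem.
exists phi; split.
- exact: bar_alg_iso.
- by move=> X; apply: glue_Ext1_eq0.
- by move=> X; apply: glue_Ext2_eq0 => //; apply: fin_gen_cofree.
- by exists Q; [apply: Q_is_Q | apply: glue_cotop_bijection].
Qed.

End PreprojectiveModel.

Lemma finite_dim_models (k : fieldType) (D : dynkin) (J : {set vertex D})
    (bP : basic (preproj k D) (vertex D)) :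
  (forall j, bidem bP j = vertex_idem k j) -> finite_dim (preproj k D) ->
  exists (A : algebra (fps k)) (e : idem A), is_order A /\ models J e.
Proof.
move=> bPE [n [b [co [co_lin coE]]]].
exists (ord (basic_glue bP J co_lin coE)), (oid (basic_glue bP J co_lin coE)).
split; first exact: basic_glue_is_order.
have [phi phiE] := bar_rmorphism (basic_glue bP J co_lin coE)
  (ideal_ofP J bPE co_lin coE).
exact: (glue_models_along bPE co_lin coE (bej_l bP J co_lin coE)
  (bej_r bP J co_lin coE) (bej_idem bP J co_lin coE)
  (fun j z x => @bkap_ej _ _ _ bP J n b co co_lin coE j z x)
  (@bchiB _ _ _ bP J n b co co_lin coE) (@bchiM _ _ _ bP J n b co co_lin coE)
  (@bchiZ _ _ _ bP J n b co co_lin coE) (@bchi_ej _ _ _ bP J n b co co_lin coE)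
  (@bchi_unit _ _ _ bP J n b co co_lin coE) phiE).
Qed.

(** * The quadratic form inequality *)

Lemma sum_enum_val (V : nmodType) (I : finType) (F : I -> V) :
  \sum_i F i = \sum_(i < #|I|) F (enum_val i).
Proof. by rewrite (reindex (fun i : 'I_#|I| => enum_val i)) //; apply/onW_bij/enum_val_bij. Qed.

Section Isotropic.
Variables (K : fieldType) (S M G : finType).
Variables (d : S -> M -> K) (p : S -> G -> K) (sw : M -> M) (om : M -> K).
Hypothesis swK : involutive sw.
Hypothesis om_neq0 : forall m, om m != 0.
Hypothesis isotropic : forall s s', \sum_m om m * d s m * d s' (sw m) = 0.
Hypothesis d_p_inj : forall v : S -> K, (forall m, \sum_s v s * d s m = 0) ->
  (forall g, \sum_s v s * p s g = 0) -> forall s, v s = 0.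

(* The rank of d is at most half of #|M| because its row space is isotropic for
   a non-degenerate form, and p separates the kernel of d. *)
Lemma isotropic_card : (2 * #|S| <= #|M| + 2 * #|G|)%N.
Proof.
pose Dm : 'M[K]_(#|S|, #|M|) := \matrix_(s, m) d (enum_val s) (enum_val m).
pose Pm : 'M[K]_(#|S|, #|G|) := \matrix_(s, g) p (enum_val s) (enum_val g).
pose Om : 'M[K]_#|M| := diag_mx (\row_m om (enum_val m)).
pose Sw : 'M[K]_#|M| := \matrix_(m, m') (enum_val m == sw (enum_val m'))%:R.
have unitO : Om \in unitmx.
  rewrite unitmxE det_diag unitfE; apply/prodf_neq0 => m _; by rewrite mxE.
have unitS : Sw \in unitmx.
  suff SS : Sw *m Sw = 1%:M by case/mulmx1_unit: SS.
  apply/matrixP => m m'; rewrite !mxE (bigD1 (enum_rank (sw (enum_val m')))) //=.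
  rewrite !mxE enum_rankK eqxx mulr1 swK (inj_eq enum_val_inj) big1 ?addr0 // => l lm.
  rewrite !mxE; case: eqP => [_|]; last by rewrite mul0r.
  by case: eqP => [lE|]; [rewrite -lE enum_valK eqxx in lm | rewrite mulr0].
have iso : (Dm *m Om) *m (Dm *m Sw)^T = 0.
  apply/matrixP => s s'; rewrite !mxE -[RHS](isotropic (enum_val s) (enum_val s')).
  rewrite [RHS]sum_enum_val; apply: eq_bigr => m _.
  rewrite mul_mx_diag !mxE (bigD1 (enum_rank (sw (enum_val m)))) //=.
  rewrite !mxE enum_rankK eqxx mulr1 big1 ?addr0 => [|l lm]; first by rewrite (mulrC (d _ _)).
  rewrite !mxE; case: eqP => [lE|]; last by rewrite mulr0.
  by rewrite -lE enum_valK eqxx in lm.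
have rk2 : (\rank Dm + \rank Dm <= #|M|)%N.
  have := mulmx0_rank_max iso; rewrite mxrank_tr.
  by rewrite !mxrankMfree // row_free_unit.
have free : row_free (row_mx Dm Pm).
  rewrite -kermx_eq0; apply/eqP/row_matrixP => i; rewrite row0.
  have : row i (kermx (row_mx Dm Pm)) *m row_mx Dm Pm = 0.
    by rewrite -row_mul mulmx_ker row0.
  move: (row i _) => v; rewrite mul_mx_row -[0]row_mx0 => /eq_row_mx[vD vP].
  have v0 := @d_p_inj (fun s => v 0 (enum_rank s)) _ _.
  apply/rowP => s; rewrite -[s]enum_valK mxE; apply: v0 => [m|g]; rewrite sum_enum_val.
    move/rowP/(_ (enum_rank m)): vD; rewrite !mxE => vE; rewrite -[RHS]vE.
    by apply: eq_bigr => t _; rewrite !mxE enum_rankK enum_valK.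
  move/rowP/(_ (enum_rank g)): vP; rewrite !mxE => vE; rewrite -[RHS]vE.
  by apply: eq_bigr => t _; rewrite !mxE enum_rankK enum_valK.
have le : (#|S| <= \rank Dm + #|G|)%N.
  rewrite -[X in (X <= _)%N](eqP free) -[row_mx _ _]trmxK mxrank_tr tr_row_mx.
  rewrite -addsmxE (leq_trans (mxrank_adds_leqif _ _)) // !mxrank_tr leq_add2l.
  exact: rank_leq_col.
by rewrite !mul2n -!addnn (leq_trans (leq_add le le)) // addnACA leq_add2r.
Qed.
End Isotropic.

(** * Commutators with the arrows of a graded cyclic module *)

Section QuiverInequality.
Variables (K : fieldType) (T : finType) (adj : rel T) (eps : T -> T -> K).
Hypothesis epsN : forall x y, eps x y = - eps y x.
Hypothesis eps_neq0 : forall x y, adj x y -> eps x y != 0.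
Hypothesis adj_sym : symmetric adj.
Variables (n : nat) (c : 'I_n -> T) (X : 'M[K]_n) (g : 'rV[K]_n) (i0 : T).
Hypothesis X_adj : forall p q, X p q != 0 -> adj (c p) (c q).
Hypothesis X_rel : forall p q, c p = c q -> \sum_r eps (c p) (c r) * X p r * X r q = 0.
Hypothesis g_supp : forall p, g 0 p != 0 -> c p = i0.
Hypothesis g_gen : forall Y : 'M[K]_n, (forall p q, Y p q != 0 -> c p = c q) ->
  Y *m X = X *m Y -> g *m Y = 0 -> Y = 0.

Local Notation alpha x := #|[set p | c p == x]|.

Let S := {s : 'I_n * 'I_n | c s.1 == c s.2}.
Let M := {m : 'I_n * 'I_n | adj (c m.1) (c m.2)}.
Let G := {p : 'I_n | c p == i0}.

(** The entry m of the commutator [E_s, X], for the matrix unit E_s. Basis vector p sits at the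
    vertex [c p], and X is the sum of the actions of all arrows. *)
Let d (s m : 'I_n * 'I_n) : K :=
  (m.1 == s.1)%:R * X s.2 m.2 - X m.1 s.1 * (m.2 == s.2)%:R.

(** The product of two commutators has four terms. In the two mixed ones X is composed with itself
    between equal vertices, so the preprojective relations make them 0; the other two cancel because
    eps is antisymmetric. *)
Lemma quiver_isotropic (s s' : 'I_n * 'I_n) : c s.1 = c s.2 -> c s'.1 = c s'.2 ->
  \sum_a \sum_b eps (c a) (c b) * d s (a, b) * d s' (b, a) = 0.
Proof.
case: s s' => p q [p' q'] /= pq pq'.
have dE a b : eps (c a) (c b) * d (p, q) (a, b) * d (p', q') (b, a) =
   (a == p)%:R * (b == p')%:R * (eps (c a) (c b) * X q b * X q' a)
   - (a == p)%:R * (a == q')%:R * (eps (c a) (c b) * X q b * X b p')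
   - (b == q)%:R * (b == p')%:R * (eps (c a) (c b) * X a p * X q' a)
   + (a == q')%:R * (b == q)%:R * (eps (c a) (c b) * X a p * X b p').
  by rewrite /d /=; ring.
under eq_bigr do under eq_bigr do rewrite dE.
have delta2 u v (F : 'I_n -> 'I_n -> K) :
    \sum_a \sum_b (a == u)%:R * (b == v)%:R * F a b = F u v.
  rewrite (bigD1 u) //= [X in _ + X]big1 ?addr0 => [|a /negPf au].
    rewrite (bigD1 v) //= big1 ?addr0 => [|b /negPf bv]; first by rewrite !eqxx !mul1r.
    by rewrite bv mulr0 mul0r.
  by apply: big1 => b _; rewrite au !mul0r.
have delta1 u v (F : 'I_n -> K) :
    \sum_a (a == u)%:R * (a == v)%:R * F a = (u == v)%:R * F u.
  rewrite (bigD1 u) //= eqxx mul1r big1 ?addr0 // => a /negPf ->.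
  by rewrite !mul0r.
under eq_bigr do rewrite !big_split /= !sumrN.
rewrite !big_split /= !sumrN.
rewrite delta2.
rewrite [X in _ - X - _ + _]exchange_big /= .
under [X in _ - X - _ + _]eq_bigr do rewrite delta1.
under [X in _ - _ - X + _]eq_bigr do rewrite delta1.
rewrite delta2 -!mulr_sumr.
have -> : (p == q')%:R * (\sum_b eps (c p) (c b) * X q b * X b p') = 0.
  case: eqP => [pq'E|]; last by rewrite mul0r.
  by rewrite mul1r pq X_rel // -pq pq'E -pq'.
have -> : (q == p')%:R * (\sum_a eps (c a) (c q) * X a p * X q' a) = 0.
  case: eqP => [qp'E|]; last by rewrite mul0r.
  rewrite mul1r; transitivity (- \sum_a eps (c q') (c a) * X q' a * X a p).
    by rewrite -sumrN; apply: eq_bigr => a _; rewrite epsN qp'E pq'; ring.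
  by rewrite X_rel ?oppr0 // pq qp'E.
by rewrite (epsN (c q')) pq' -pq; ring.
Qed.

Lemma card_label_pairs (r : rel T) :
  #|{: {m : 'I_n * 'I_n | r (c m.1) (c m.2)}}| =
  (\sum_x \sum_(y | r x y) alpha x * alpha y)%N.
Proof.
rewrite card_sig -sum1_card.
transitivity (\sum_p \sum_(q | r (c p) (c q)) 1)%N.
  by rewrite (pair_big_dep xpredT (fun p q => r (c p) (c q)) (fun _ _ => 1%N)) /=.
rewrite (partition_big c xpredT) //=; apply: eq_bigr => x _.
transitivity (\sum_(p | c p == x) \sum_(y | r x y) alpha y)%N.
  apply: eq_bigr => p /eqP <-; rewrite (partition_big c (r (c p))) //=.
  apply: eq_bigr => y rpy; rewrite -sum1_card; apply: eq_bigl => q; rewrite inE.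
  by rewrite andbC; case: eqP => // ->.
rewrite sum_nat_const big_distrr /=; apply: eq_bigr => y _; congr (_ * _)%N.
by apply: eq_card => p; rewrite !inE.
Qed.

(** Twice the Tits form inequality q(alpha) <= alpha_i0: ordered pairs of adjacent vertices count
    each edge twice. S indexes the graded endomorphisms, M the entries of commutators, and G the
    coordinates of the image of the generator g, which determine an endomorphism. *)
Lemma quiver_inequality :
  (2 * \sum_x alpha x ^ 2 <= \sum_x \sum_(y | adj x y) alpha x * alpha y + 2 * alpha i0)%N.
Proof.
have swP (m : M) : adj (c (val m).2) (c (val m).1) by rewrite adj_sym (valP m).
pose sw (m : M) : M := Sub ((val m).2, (val m).1) (swP m).
have cardS : #|{: S}| = (\sum_x alpha x ^ 2)%N.
  rewrite (card_label_pairs eq_op); apply: eq_bigr => x _.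
  by under eq_bigl do rewrite eq_sym; rewrite big_pred1_eq.
have cardG : #|{: G}| = alpha i0.
  by rewrite card_sig; apply: eq_card => q; rewrite !inE.
rewrite -cardS -(card_label_pairs adj) -cardG.
have sumS (F : 'I_n * 'I_n -> K) : \sum_(s : S) F (val s) =
    \sum_p \sum_(q | c p == c q) F (p, q).
  rewrite -(big_sub (fun s => c s.1 == c s.2)) pair_big_dep /=.
  by apply: eq_big => -[].
have sumM (F : 'I_n * 'I_n -> K) : (forall a b, ~~ adj (c a) (c b) -> F (a, b) = 0) ->
    \sum_(m : M) F (val m) = \sum_a \sum_b F (a, b).
  move=> F0; rewrite -(big_sub (fun s => adj (c s.1) (c s.2))) pair_big /=.
  rewrite big_mkcond; apply: eq_bigr => -[a b] _ /=.
  by case: ifPn => // /F0.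
have d0 s : c s.1 = c s.2 -> forall a b, ~~ adj (c a) (c b) -> d s (a, b) = 0.
  case: s => p q /= pq a b nab; have X0 u v : c u = c a -> c v = c b -> X u v = 0.
    by move=> ua vb; apply: contraNeq nab; rewrite -ua -vb; apply: X_adj.
  rewrite /d /=; case: (a =P p) => [ap|_]; case: (b =P q) => [bq|_];
    by rewrite ?mul0r ?mulr0 ?subr0 ?sub0r ?mul1r ?mulr1 ?X0 ?subr0 ?oppr0 ?ap ?bq ?pq.
apply: (@isotropic_card K S M G (fun s m => d (val s) (val m))
  (fun s q => g 0 (val s).1 * ((val s).2 == val q)%:R) sw
  (fun m => eps (c (val m).1) (c (val m).2))).
- by move=> [[a b] ab]; apply: val_inj.
- by move=> m; apply: eps_neq0; apply: (valP m).
- move=> s s'; rewrite -[RHS](quiver_isotropic (eqP (valP s)) (eqP (valP s'))).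
  rewrite (sumM (fun m => eps (c m.1) (c m.2) * d (val s) m * d (val s') (m.2, m.1))) //.
  by move=> a b nab; rewrite d0 ?mulr0 ?mul0r //; apply/eqP/(valP s).
move=> v vd vg s.
(* [v] read as a matrix that preserves vertices; the assumptions on [v] say that it commutes with X
   and kills g. *)
pose Y : 'M[K]_n := \matrix_(p, q)
  if insub (p, q) is Some s' then v s' else 0.
have YE (F : 'I_n * 'I_n -> K) : \sum_(s' : S) v s' * F (val s') =
    \sum_p \sum_q Y p q * F (p, q).
  transitivity (\sum_(s' : S) Y (val s').1 (val s').2 * F (val s')).
    by apply: eq_bigr => s' _; rewrite mxE -surjective_pairing valK.
  rewrite (sumS (fun m => Y m.1 m.2 * F m)) /=; apply: eq_bigr => p _.
  rewrite big_mkcond; apply: eq_bigr => q _; case: ifPn => // pq.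
  by rewrite mxE insubN ?mul0r.
suff Y0 : Y = 0.
  by have := mxE matrix_key (fun p q => if insub (p, q) is Some s' then v s' else 0)
       (val s).1 (val s).2; rewrite -/Y Y0 mxE -surjective_pairing valK.
apply: g_gen.
- move=> p q; rewrite mxE; case: insubP => [s' /eqP //|_]; by rewrite eqxx.
- apply/matrixP => a b; apply/eqP; rewrite -subr_eq0; apply/eqP.
  have -> : (Y *m X) a b - (X *m Y) a b = \sum_p \sum_q Y p q * d (p, q) (a, b).
    under eq_bigr do under eq_bigr do rewrite mulrBr.
    under eq_bigr do rewrite big_split sumrN /=.
    rewrite big_split sumrN !mxE /=; congr (_ - _); symmetry.
      rewrite (bigD1 a) //= [X in _ + X]big1 ?addr0 => [|p]; last first.
        by rewrite eq_sym => /negPf pa; apply: big1 => q _; rewrite pa mul0r mulr0.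
      by apply: eq_bigr => q _; rewrite eqxx mul1r.
    apply: eq_bigr => p _; rewrite (bigD1 b) //= eqxx mulr1 mulrC big1 ?addr0 //.
    by move=> q; rewrite eq_sym => /negPf ->; rewrite !mulr0.
  rewrite -(YE (fun s => d s (a, b))).
  case: (boolP (adj (c a) (c b))) => ab; first exact: (vd (Sub (a, b) ab)).
  apply: big1 => s' _; rewrite d0 ?mulr0 //; apply/eqP/(valP s').
- apply/rowP => q; rewrite [RHS]mxE mxE.
  have gq : \sum_p g 0 p * Y p q = \sum_p \sum_q' Y p q' * (g 0 p * (q' == q)%:R).
    apply: eq_bigr => p _; rewrite (bigD1 q) //= eqxx mulr1 mulrC big1 ?addr0 //.
    by move=> q' /negPf ->; rewrite !mulr0.
  rewrite gq -(YE (fun s => g 0 s.1 * (s.2 == q)%:R)).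
  case: (boolP (c q == i0)) => qi; first exact: (vg (Sub q qi)).
  apply: big1 => s' _; case: eqP => [s'q|]; last by rewrite !mulr0.
  have [->|/g_supp ci] := eqVneq (g 0 (val s').1) 0; first by rewrite mul0r mulr0.
  by rewrite -s'q -(eqP (valP s')) ci eqxx in qi.
Qed.
End QuiverInequality.

(* The weights are multiples of the coefficients of the sum of the positive
   coroots. *)
Lemma dynkin_weight (D : dynkin) : exists w : vertex D -> nat,
  forall i, (\sum_(j | dynkin_adj i j) w j < 2 * w i)%N.
Proof.
have union (r : nat) (P P' : pred 'I_r) (F : 'I_r -> nat) :
    (\sum_(j | P j || P' j) F j <= \sum_(j | P j) F j + \sum_(j | P' j) F j)%N.
  rewrite big_mkcond [in X in (_ <= X + _)%N]big_mkcond [in X in (_ <= _ + X)%N]big_mkcond.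
  rewrite -big_split; apply: leq_sum => j _ /=.
  by case: (P j); case: (P' j); rewrite ?addn0 ?add0n ?leq_addr ?leq_addl.
have at1 (r a : nat) (F : nat -> nat) : (\sum_(j < r | j == a :> nat) F j <= F a)%N.
  by rewrite big_ord1_eq; case: ifP.
have atS (r a : nat) (F : nat -> nat) : (\sum_(j < r | a == j.+1 :> nat) F j <=
    if a is b.+1 then F b else 0)%N.
  case: a => [|a]; first by rewrite big1.
  by under eq_bigl do rewrite eqSS eq_sym; apply: at1.
case: D => [n|n|||]; rewrite /dynkin_adj /dynkin_arrow /=.
- exists (fun i => i.+1 * (n.+1 - i))%N => i.
  apply: leq_ltn_trans (union _ _ _ _) _.
  apply: leq_ltn_trans (leq_add (at1 _ _ (fun i => i.+1 * (n.+1 - i))%N)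
    (atS _ _ (fun i => i.+1 * (n.+1 - i))%N)) _.
  have := ltn_ord i; case: (i : nat) => [|m] mn; first by lia.
  have [q ->] : exists q, n = (m.+1 + q)%N by exists (n - m.+1)%N; lia.
  nia.
(* For D_N with N = n + 4, twice the coefficients i(2N - i - 1) along the chain and N(N - 1)/2 at
   the two ends of the fork, which clears the half. *)
- pose F i := (if i <= n.+1 then 2 * i.+1 * (2 * n.+4 - i.+2) else n.+4 * n.+3)%N.
  exists F => i; rewrite /fork /=.
  have cst (b : bool) (P : pred 'I_n.+4) (u : nat) : (\sum_(j | P j) F j <= u)%N ->
      (\sum_(j | P j && b) F j <= if b then u else 0)%N.
    case: b => [|_]; first by move=> le; rewrite (eq_bigl P) // => j; rewrite /= andbT.
    by rewrite big1 // => j; rewrite andbF.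
  have s1 : (\sum_(j < n.+4 | (j == i.+1 :> nat) && (j < n.+3)) F j <=
      if i.+1 < n.+3 then F i.+1 else 0)%N.
    rewrite (eq_bigl (fun j : 'I_n.+4 => (j == i.+1 :> nat) && (i.+1 < n.+3)))%N.
      exact/cst/at1.
    by move=> j; case: eqP => // ->.
  have s2 : (\sum_(j < n.+4 | (i == n.+1 :> nat) && (j == n.+3 :> nat)) F j <=
      if i == n.+1 :> nat then F n.+3 else 0)%N.
    by under eq_bigl do rewrite andbC; apply/cst/at1.
  have s3 : (\sum_(j < n.+4 | (i == j.+1 :> nat) && (i < n.+3)) F j <=
      if i < n.+3 then if i : nat is m.+1 then F m else 0 else 0)%N.
    exact/cst/atS.
  have s4 : (\sum_(j < n.+4 | (j == n.+1 :> nat) && (i == n.+3 :> nat)) F j <=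
      if i == n.+3 :> nat then F n.+1 else 0)%N.
    exact/cst/at1.
  apply: leq_ltn_trans (union _ _ _ _) _.
  apply: leq_ltn_trans (leq_add (union _ _ _ _) (union _ _ _ _)) _.
  apply: leq_ltn_trans (leq_add (leq_add s1 s2) (leq_add s3 s4)) _.
  have := ltn_ord i; rewrite /F; move: (i : nat) => {s1 s2 s3 s4 cst}.
  case=> [|m] mn.
    by rewrite /=; lia.
  case: (ltngtP m n) => mn1.
  + have [q nE] : exists q, n = (m + q).+1 by exists (n - m.+1)%N; lia.
    subst n; do !case: ifP => /= ?; first [lia | nia].
  + case: (ltngtP m n.+1) => mn2; first by lia.
      have -> : m = n.+2 by lia.
      do !case: ifP => /= ?; first [lia | nia].
    subst m; do !case: ifP => /= ?; first [lia | nia].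
  + subst m; do !case: ifP => /= ?; first [lia | nia].
- exists (fun i => nth 0 [:: 16; 30; 42; 30; 16; 22] i)%N => -[[|[|[|[|[|[|//]]]]]] i];
    by rewrite big_mkcond !big_ord_recl big_ord0.
- exists (fun i => nth 0 [:: 34; 66; 96; 75; 52; 27; 49] i)%N
    => -[[|[|[|[|[|[|[|//]]]]]]] i];
    by rewrite big_mkcond !big_ord_recl big_ord0.
- exists (fun i => nth 0 [:: 92; 182; 270; 220; 168; 114; 58; 136] i)%N
    => -[[|[|[|[|[|[|[|[|//]]]]]]]] i];
    by rewrite big_mkcond !big_ord_recl big_ord0.
Qed.

(** * Bounds from the positive definite Tits form *)

Section TitsForm.
Import Order.TTheory Num.Theory.

Lemma dynkin_adj_sym (D : dynkin) : symmetric (@dynkin_adj D).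
Proof. by move=> i j; rewrite /dynkin_adj orbC. Qed.

(** Put a = b w. From 2 b_x b_y <= b_x^2 + b_y^2, weighted by w_x w_y, the sum of b_x^2 w_x (2 w_x -
    sum_y w_y) is at most 2 a_i0, and each bracket is at least 1. So a_x^2 <= 2 w_x a_i0 for every
    x. *)
Lemma tits_form_bound (T : finType) (adj : rel T) (w : T -> nat) (i0 : T) (a : T -> nat) :
  symmetric adj -> (forall i, (\sum_(j | adj i j) w j < 2 * w i)%N) ->
  (2 * \sum_x a x ^ 2 <= \sum_x \sum_(y | adj x y) a x * a y + 2 * a i0)%N ->
  forall x, (a x <= 4 * w x * w i0)%N.
Proof.
move=> adj_sym w_bound le.
pose d x : rat := (w x)%:R; pose b x : rat := (a x)%:R / d x.
have d0 x : 0 < d x by rewrite ltr0n; have := w_bound x; case: (w x).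
have bd x : (a x)%:R = b x * d x by rewrite /b divfK // gt_eqF.
have db x : \sum_(y | adj x y) d y <= 2 * d x - 1.
  by rewrite -natr_sum lerBrDr -natrM natr1 ler_nat.
have amgm : \sum_x \sum_(y | adj x y) b x * d x * (b y * d y) <=
    \sum_x \sum_(y | adj x y) b x ^+ 2 * d x * d y.
  have sym : \sum_x \sum_(y | adj x y) b x ^+ 2 * d x * d y =
      \sum_x \sum_(y | adj x y) b y ^+ 2 * d x * d y.
    rewrite (exchange_big_dep xpredT) //=; apply: eq_bigr => y _.
    by apply: eq_big => x; [rewrite adj_sym | move=> _; ring].
  rewrite -(ler_pM2l (ltr0n _ 2)) mulr_natl [leRHS]mulr_natl [leRHS]mulr2n {2}sym.
  rewrite -big_split -sumrMnl; apply: ler_sum => x _ /=; rewrite -big_split -sumrMnl.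
  apply: ler_sum => y _ /=; rewrite -subr_ge0.
  have -> : b x ^+ 2 * d x * d y + b y ^+ 2 * d x * d y - b x * d x * (b y * d y) *+ 2 =
    (b x - b y) ^+ 2 * (d x * d y) by ring.
  by rewrite mulr_ge0 ?sqr_ge0 // mulr_ge0 ?ltW.
have form : \sum_x b x ^+ 2 * d x <= 2 * (a i0)%:R.
  have := le; rewrite -(ler_nat rat) natrM natrD natrM !natr_sum => le'.
  have : \sum_x \sum_(y | adj x y) b x ^+ 2 * d x * d y <=
      \sum_x (2 * (b x * d x) ^+ 2 - b x ^+ 2 * d x).
    apply: ler_sum => x _; rewrite -mulr_sumr.
    have -> : 2 * (b x * d x) ^+ 2 - b x ^+ 2 * d x = b x ^+ 2 * d x * (2 * d x - 1) by ring.
    by rewrite ler_wpM2l // mulr_ge0 ?sqr_ge0 // ltW.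
  rewrite sumrB -mulr_sumr.
  move: le'; under eq_bigr do rewrite natrX bd.
  under [X in _ <= X + _]eq_bigr do
    (rewrite natr_sum; under eq_bigr do rewrite natrM !bd).
  by move: amgm; lra.
have term x : b x ^+ 2 * d x <= 2 * (a i0)%:R.
  apply: le_trans form; rewrite (bigD1 x) //= lerDl sumr_ge0 // => y _.
  by rewrite mulr_ge0 ?sqr_ge0 // ltW.
(* At x = i0 the bound reads a_i0^2 <= 2 w_i0 a_i0, which bounds a_i0 itself. *)
have ai0 : (a i0 <= 2 * w i0)%N.
  rewrite -(ler_nat rat) natrM -/(d i0).
  have := term i0; rewrite bd mulrA (ler_pM2r (d0 i0)) (ler_pM2r (d0 i0)) => le0.
  by rewrite leNgt; apply/negP => b2; nra.
move=> x.
have : (a x ^ 2 <= 4 * w x * w i0)%N.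
  rewrite -(ler_nat rat) natrX bd !natrM -/(d x) -/(d i0).
  have := term x; move: ai0; rewrite -(ler_nat rat) natrM -/(d i0) => ai0 tx.
  have : b x ^+ 2 * d x <= 4 * d i0 by move: ai0 tx; lra.
  by rewrite -(ler_pM2r (d0 x)) => le1; lra.
by apply: leq_trans; case: (a x) => // m; rewrite expnS leq_pmulr // expn1.
Qed.

Lemma dynkin_bound (D : dynkin) (i0 : vertex D) : exists C, forall a : vertex D -> nat,
  (2 * \sum_x a x ^ 2 <= \sum_x \sum_(y | dynkin_adj x y) a x * a y + 2 * a i0)%N ->
  (\sum_x a x <= C)%N.
Proof.
have [w w_bound] := dynkin_weight D.
exists (\sum_x 4 * w x * w i0)%N => a le; apply: leq_sum => x _.
exact: tits_form_bound (@dynkin_adj_sym D) w_bound le x.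
Qed.

End TitsForm.

(** * Walks in the preprojective algebra *)

Section PathAlgebraBasis.
Variables (k : fieldType) (T : finType) (adj : rel T).
Local Notation P := (path_alg k adj).
Local Notation pw := (pa_walk k adj).
Implicit Types f g h : path_algebra k adj.

Lemma pa_coef_sum (I : Type) (r : seq I) (Q : pred I) (F : I -> path_algebra k adj) p :
  pa_coef (\sum_(i <- r | Q i) F i) p = \sum_(i <- r | Q i) pa_coef (F i) p.
Proof. by elim/big_rec2: _ => [//|i x y _ <-]. Qed.

Lemma pa_walk_out p : ~~ path adj p.1 p.2 -> pw p = 0.
Proof. by move=> /negPf np; apply: paP => q /=; rewrite np andbF. Qed.

Lemma pa_walkM i s j t :
  pw (i, s) * pw (j, t) = if last i s == j then pw (i, s ++ t) else 0.
Proof.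
have [is_path|nis] := boolP (path adj i s); last first.
  rewrite pa_walk_out // mul0r; case: ifP => // _.
  by rewrite pa_walk_out //= cat_path (negPf nis).
have [jt_path|njt] := boolP (path adj j t); last first.
  rewrite (@pa_walk_out (j, t)) // mulr0; case: eqP => // ij.
  by rewrite pa_walk_out //= cat_path ij (negPf njt) andbF.
apply: paP => -[x u] /=; rewrite /pa_conv /= is_path jt_path.
have [szs|] := boolP (size s <= size u)%N; last first.
  rewrite -ltnNge => szu; rewrite big1 => [|l _].
    case: ifP => //= _; case: eqP => // -[_ uE]; rewrite uE size_cat in szu.
    by rewrite ltnNge leq_addr in szu.
  case: eqP => [[_ sE]|]; last by rewrite mul0r.
  have := size_take_min l u; rewrite sE => szE; rewrite szE in szu.
  by rewrite ltnNge geq_minr in szu.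
rewrite (bigD1 (Ordinal (szs : size s < (size u).+1)%N)) //= big1 ?addr0 => [|l ls].
  rewrite !xpair_eqE; case: (x =P i) => [->|]; last first.
    by move=> ni; rewrite mul0r; case: ifP => //= _; rewrite xpair_eqE; case: eqP.
  case: (take (size s) u =P s) => [us|nus] /=; last first.
    rewrite mul0r; case: ifP => //= _; rewrite xpair_eqE eqxx /=.
    by case: eqP => // uE; case: nus; rewrite uE take_size_cat.
  rewrite us mul1r; case: (last i s =P j) => [ij|//] /=.
  rewrite xpair_eqE eqxx cat_path is_path ij jt_path !andbT /=.
  by rewrite -{2}(cat_take_drop (size s) u) us eqseq_cat // eqxx.
case: eqP => [[_ uE]|]; last by rewrite mul0r.
case/eqP: ls; apply: val_inj => /=; rewrite -uE size_take_min.
by apply/esym/minn_idPl; rewrite -ltnS.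
Qed.

Lemma pa_expand f (L : seq (T * seq T)) : uniq L -> (forall p, pa_coef f p != 0 -> p \in L) ->
  f = \sum_(p <- L) (pa_scalar adj (pa_coef f p) * pw p : path_algebra k adj).
Proof.
move=> Lu fL; apply: paP => q; rewrite pa_coef_sum.
under eq_bigr do rewrite pa_scalarl.
have out p : p != q -> pa_coef f p * pa_coef (pw p) q = 0.
  by rewrite eq_sym /= => /negPf ->; rewrite mulr0.
have [qL|qL] := boolP (q \in L).
  rewrite (bigD1_seq q) //= eqxx /= big1 ?addr0; last by move=> p; apply: out.
  have [->|/pa_path ->] := eqVneq (pa_coef f q) 0; first by rewrite mul0r.
  by rewrite mulr1.
have /eqP -> : pa_coef f q == 0 by apply: contraNT qL; apply: fL.
by rewrite big_seq big1 // => p pL; apply: out; apply: contraNneq qL => <-.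
Qed.

Fact pa_degP1 (d : nat) f p : (if size p.2 == d then pa_coef f p else 0) != 0 ->
  path adj p.1 p.2.
Proof. by case: ifP => _; [apply: pa_path | rewrite eqxx]. Qed.
Fact pa_degP2 (d : nat) f : exists L : seq (T * seq T), forall p,
  (if size p.2 == d then pa_coef f p else 0) != 0 -> p \in L.
Proof.
have [L fL] := pa_finite f; exists L => p.
by case: ifP => _; [apply: fL | rewrite eqxx].
Qed.
Definition pa_deg d f := PathAlgebra (@pa_degP1 d f) (pa_degP2 d f).

Lemma pa_degB d f g : pa_deg d (f - g) = pa_deg d f - pa_deg d g.
Proof. by apply: paP => p /=; case: ifP => _ //; rewrite subr0. Qed.

Lemma pa_degM d f g :
  pa_deg d (f * g) = \sum_(i < d.+1) (pa_deg i f * pa_deg (d - i) g : path_algebra k adj).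
Proof.
apply: paP => -[x s]; rewrite pa_coef_sum /= /pa_conv /= exchange_big /=.
have le (j : 'I_(size s).+1) : (j <= size s)%N by rewrite -ltnS.
case: eqP => [sd|sd].
  rewrite -sd; apply: eq_bigr => j _; rewrite (bigD1 j) //= big1 ?addr0.
    by rewrite size_takel // eqxx size_drop eqxx.
  move=> i ij; rewrite size_takel // ifF ?mul0r //.
  by apply/eqP => ji; case/eqP: ij; apply: val_inj.
rewrite big1 // => j _; rewrite big1 // => i _.
rewrite size_takel // size_drop.
case: eqP => [ji|]; last by rewrite mul0r.
case: eqP => [sji|]; last by rewrite mulr0.
by case: sd; rewrite -(subnK (le j)) sji ji subnK // -ltnS.
Qed.

Section GradedIdeal.
Variable I : ideal P.
Definition graded_core : {pred P} := [pred f | `[< forall d, (pa_deg d f : P) \in I >]].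
Fact graded_core_zmod : zmod_closed graded_core.
Proof.
split=> [|f g /asboolP fI /asboolP gI]; apply/asboolP => d; last by rewrite pa_degB rpredB.
by rewrite (_ : pa_deg d 0 = 0) ?rpred0 //; apply: paP => p /=; case: ifP.
Qed.
Fact graded_core_Ml f g : g \in graded_core -> (f : P) * g \in graded_core.
Proof.
move=> /asboolP gI; apply/asboolP => d; rewrite pa_degM.
by apply: rpred_sum => i _; apply: idealMl.
Qed.
Fact graded_core_Mr f g : g \in graded_core -> g * (f : P) \in graded_core.
Proof.
move=> /asboolP gI; apply/asboolP => d; rewrite pa_degM.
by apply: rpred_sum => i _; apply: idealMr.
Qed.
HB.instance Definition _ := GRing.isZmodClosed.Build P graded_core graded_core_zmod.
HB.instance Definition _ := isIdeal.Build P graded_core graded_core_Ml graded_core_Mr.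
End GradedIdeal.

(** The elements whose homogeneous components all lie in the ideal of r form an ideal, and it
    contains r because r is homogeneous. *)
Lemma homogeneous_ideal (r : P) e d f : (forall p, pa_coef r p != 0 -> size p.2 = e) ->
  f \in principal_ideal r -> (pa_deg d f : P) \in principal_ideal r.
Proof.
move=> re /asboolP fr.
suff /asboolP : f \in graded_core (principal_ideal r) by apply.
apply: (fr (graded_core (principal_ideal r))) => _ ->; apply/asboolP => d'.
have rr : r \in principal_ideal r by apply/asboolP => I; apply.
have [<-|ed] := eqVneq e d'.
  suff -> : pa_deg e r = r by [].
  apply: paP => p /=; case: eqP => // sp; apply/esym/eqP.
  by apply: contrapT => /negP/re.
suff -> : pa_deg d' r = 0 by rewrite rpred0.
apply: paP => p /=; case: eqP => // sp; apply/eqP; apply: contrapT => /negP/re pe.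
by rewrite -pe sp eqxx in ed.
Qed.

End PathAlgebraBasis.

(** * Homogeneous bases selected from a spanning family *)

Section GradedBasis.
Variables (k : fieldType) (P : algebra k) (W : finType) (Ty : eqType).
Variables (t : W -> Ty) (v : W -> P).
Local Notation al := (alg_struct P).
Hypothesis graded : forall la : W -> k, \sum_w al (la w) * v w = 0 ->
  forall y, \sum_(w | t w == y) al (la w) * v w = 0.

(** S is a maximal independent subfamily. The dependence of another v_w on S can be restricted to
    the terms of the type of w, because relations are graded. *)
Lemma graded_basis : exists (S : {set W}) (ka : W -> W -> k),
  [/\ forall la : W -> k, \sum_(b in S) al (la b) * v b = 0 ->
        forall b, b \in S -> la b = 0,
      forall w, v w = \sum_(b in S) al (ka w b) * v b &
      forall w b, ka w b != 0 -> t b = t w].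
Proof.
pose indep (S : {set W}) := `[< forall la : W -> k,
  \sum_(b in S) al (la b) * v b = 0 -> forall b, b \in S -> la b = 0 >].
have [|S /maxsetP[/asboolP Si Smax]] := @ex_maxset _ indep.
  by exists set0; apply/asboolP => la _ b; rewrite inE.
have gradedS (B : {set W}) (la : W -> k) : \sum_(b in B) al (la b) * v b = 0 ->
    forall y, \sum_(b in B | t b == y) al (la b) * v b = 0.
  have E (Q : pred W) : \sum_(b in B | Q b) al (la b) * v b =
      \sum_(b | Q b) al (if b \in B then la b else 0) * v b.
    rewrite big_mkcondl; apply: eq_bigr => b _.
    by case: ifP => // _; rewrite rmorph0 mul0r.
  move=> la0 y; rewrite E; apply: graded.
  by rewrite -(E xpredT) -[RHS]la0; apply: eq_bigl => b; rewrite andbT.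
have span w : exists la : W -> k, v w = \sum_(b in S) al (la b) * v b /\
    forall b, la b != 0 -> t b = t w.
  have [wS|wS] := boolP (w \in S).
    exists (fun b => (b == w)%:R); split=> [|b]; last by case: (b =P w) => [->|]; rewrite ?eqxx.
    rewrite (bigD1 w) //= eqxx rmorph1 mul1r big1 ?addr0 // => b /andP[_ /negPf bw].
    by rewrite bw rmorph0 mul0r.
  have /asboolPn : ~~ indep (w |: S).
    apply: contraL wS => /Smax/(_ (subsetUr _ _)) <-; by rewrite negbK setU11.
  move=> ndep; have [la [la0 [b bwS lab]]] : exists la : W -> k,
      \sum_(b in w |: S) al (la b) * v b = 0 /\ exists2 b, b \in w |: S & la b <> 0.
    apply: contrapT => nex; apply: ndep => la la0 b bwS; apply: contrapT => lab.
    by apply: nex; exists la; split=> //; exists b.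
  have law : la w != 0.
    apply/eqP => law; apply: lab; move: la0; rewrite big_setU1 //= law rmorph0 mul0r add0r.
    by move: bwS; rewrite !inE => /predU1P[-> //|bS] /Si; apply.
  exists (fun b => if t b == t w then - (la w)^-1 * la b else 0); split; last first.
    by move=> b'; case: (t b' =P t w); rewrite ?eqxx.
  have := gradedS _ _ la0 (t w); rewrite big_mkcondr big_setU1 //= eqxx.
  move=> /eqP; rewrite addr_eq0 => /eqP /(congr1 (fun x => al (la w)^-1 * x)).
  rewrite mulrA -rmorphM mulVf // rmorph1 mul1r => ->.
  rewrite mulrN -mulNr -rmorphN mulr_sumr; apply: eq_bigr => b' _.
  by case: ifP => _; rewrite ?mulr0 ?rmorph0 ?mul0r // mulrA -rmorphM.
have [ka kaP] := boolp.choice span.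
by exists S, ka; split=> [//|w|w b]; case: (kaP w) => // _; apply.
Qed.
End GradedBasis.

Section PreprojectiveWalks.
Variables (k : fieldType) (D : dynkin).
Local Notation V := (vertex D).
Local Notation adj := (@dynkin_adj D).
Local Notation P := (path_alg k adj).
Local Notation Pi := (preproj k D).
Local Notation pw := (pa_walk k adj).
Local Notation rho := (preproj_relation k D).
Local Notation al := (alg_struct Pi).

(** The preprojective relation at x is the sum over y of [arrow_sign x y] times the walk x, y, x. *)
Definition arrow_sign (x y : V) : k := (dynkin_arrow x y)%:R - (dynkin_arrow y x)%:R.

Lemma arrow_signN x y : arrow_sign x y = - arrow_sign y x.
Proof. by rewrite /arrow_sign opprB. Qed.

Lemma dynkin_arrow_lt (x y : V) : dynkin_arrow x y -> (x < y)%N.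
Proof.
have fork_lt r b i j : (b < r.-1)%N -> fork r b i j -> (i < j)%N.
  by move=> br; case/orP => /andP[/eqP]; [move=> -> | move=> -> /eqP ->].
case: D x y => [n|n|||] x y; rewrite /dynkin_arrow; first by move/eqP ->.
all: exact: fork_lt.
Qed.

Lemma arrow_sign_neq0 x y : adj x y -> arrow_sign x y != 0.
Proof.
have anti (u v : V) : dynkin_arrow u v -> dynkin_arrow v u = false.
  move=> uv; apply/negP => vu; have := dynkin_arrow_lt vu.
  by rewrite ltnNge (ltnW (dynkin_arrow_lt uv)).
rewrite /arrow_sign; case/orP => a; rewrite a (anti _ _ a) ?subr0 ?sub0r ?oppr_eq0;
  exact: oner_neq0.
Qed.

Lemma rho_size p : pa_coef rho p != 0 -> size p.2 = 2%N.
Proof.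
move=> nz; apply: contraNeq nz => sp; rewrite /preproj_relation pa_coef_sum.
rewrite big1 // => x _; rewrite pa_coef_sum big1 // => y _ /=.
have ne q : size q.2 = 2%N -> (p == q) = false.
  by move=> sq; apply: contraNF sp => /eqP ->; rewrite sq.
by rewrite !ne // subr0.
Qed.

Definition walk_class (p : V * seq V) : Pi := quot_pi (principal_ideal rho) (pw p).

Lemma walk_rel x s :
  \sum_y al (arrow_sign (last x s) y) * walk_class (x, s ++ [:: y; last x s]) = 0.
Proof.
have : quot_pi (principal_ideal rho) (pw (x, s) * rho) = 0.
  rewrite -(raddf0 (quot_pi _)); apply/quot_piP; rewrite subr0.
  by apply: idealMl; apply/asboolP => I; apply.
set l := last x s; pose w y := pw (x, s ++ [:: y; l]).
have -> : pw (x, s) * rho = \sum_y pa_scalar adj (arrow_sign l y) * w y.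
  rewrite /preproj_relation mulr_sumr.
  under eq_bigr do (rewrite mulr_sumr; under eq_bigr do rewrite mulrBr !pa_walkM -/l).
  under eq_bigr do rewrite sumrB.
  rewrite sumrB; under [RHS]eq_bigr do rewrite /arrow_sign rmorphB mulrBl.
  rewrite sumrB; congr (_ - _).
    rewrite (bigD1 l) //= [X in _ + X]big1 ?addr0 => [|i]; last first.
      by rewrite eq_sym => /negPf li; apply: big1 => y _; rewrite li.
    rewrite big_mkcond; apply: eq_bigr => y _; rewrite eqxx.
    by case: ifP => _; rewrite ?rmorph1 ?rmorph0 ?mul1r ?mul0r.
  apply: eq_bigr => y _; rewrite big_mkcond (bigD1 l) //= eqxx big1 ?addr0.
    by case: ifP => _; rewrite ?rmorph1 ?rmorph0 ?mul1r ?mul0r.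
  by move=> j; rewrite eq_sym => /negPf ->; case: ifP.
rewrite raddf_sum /= => rel; rewrite -[RHS]rel; apply: eq_bigr => y _.
by rewrite rmorphM.
Qed.

Lemma walk_cat0 x s t : walk_class (x, s) = 0 -> walk_class (x, s ++ t) = 0.
Proof.
move=> s0; suff -> : walk_class (x, s ++ t) = walk_class (x, s) * walk_class (last x s, t).
  by rewrite s0 mul0r.
by rewrite /walk_class -rmorphM /= pa_walkM eqxx.
Qed.

(** The relation is homogeneous of degree 2, so components by length stay in the ideal; right
    multiplication by the trivial walk at y then selects the walks that end at y. *)
Lemma walk_graded (I : finType) (x : V) (s : I -> seq V) (la : I -> k) (d : nat) (y : V) :
  \sum_i al (la i) * walk_class (x, s i) = 0 ->
  \sum_(i | (size (s i), last x (s i)) == (d, y)) al (la i) * walk_class (x, s i) = 0.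
Proof.
pose f (Q : pred I) : path_algebra k adj := \sum_(i | Q i) pa_scalar adj (la i) * pw (x, s i).
have fE Q : \sum_(i | Q i) al (la i) * walk_class (x, s i) = quot_pi (principal_ideal rho) (f Q).
  by rewrite raddf_sum /=; apply: eq_bigr => i _; rewrite rmorphM.
have piE (g : P) : quot_pi (principal_ideal rho) g = 0 <-> g \in principal_ideal rho.
  by rewrite -(raddf0 (quot_pi (principal_ideal rho))) quot_piP subr0.
rewrite !fE => /piE fI; apply/piE.
suff -> : f (fun i => (size (s i), last x (s i)) == (d, y)) =
    pa_deg d (f xpredT) * pw (y, [::]).
  by apply: idealMr; apply: (@homogeneous_ideal k V adj rho 2 d (f xpredT) rho_size fI).
have -> : pa_deg d (f xpredT) = f (fun i => size (s i) == d).
  apply: paP => p /=; rewrite !pa_coef_sum [RHS]big_mkcond.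
  case: ifP => pd; last first.
    apply/esym/big1 => i _; case: ifP => // sd; rewrite pa_scalarl /=.
    by case: eqP => [pE|]; [rewrite pE /= sd in pd | rewrite mulr0].
  apply: eq_bigr => i _; case: ifPn => // sd; rewrite pa_scalarl /=.
  by case: eqP => [pE|]; [rewrite -(eqP pd) pE eqxx in sd | rewrite mulr0].
rewrite /f mulr_suml [in LHS]big_mkcond [in RHS]big_mkcond /=; apply: eq_bigr => i _.
rewrite xpair_eqE; case: ifPn => [/andP[-> /eqP ly]|].
  by rewrite -mulrA pa_walkM ly eqxx cats0.
by case: ifP => //= _ ny; rewrite -mulrA pa_walkM (negPf ny) mulr0.
Qed.

End PreprojectiveWalks.

(** * The truncations of e_i0 Pi by length *)

Section CyclicModule.
Variables (k : fieldType) (D : dynkin) (i0 : vertex D) (N : nat).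
Local Notation V := (vertex D).
Local Notation adj := (@dynkin_adj D).
Local Notation Pi := (preproj k D).
Local Notation al := (alg_struct Pi).
Local Notation W := (N.-bseq V).
Local Notation wc s := (walk_class k (i0, (s : seq V))).
Variables (S : {set W}) (ka : W -> W -> k).
Hypothesis indep : forall la : W -> k, \sum_(b in S) al (la b) * wc (bseqval b) = 0 ->
  forall b, b \in S -> la b = 0.
Hypothesis span : forall w : W, wc w = \sum_(b in S) al (ka w b) * wc (bseqval b).
Hypothesis ka_type : forall w b, ka w b != 0 ->
  (size b, last i0 b) = (size w, last i0 w) :> nat * V.

Let n := #|S|.
Let e (p : 'I_n) : W := enum_val p.
Let c (p : 'I_n) : V := last i0 (e p).
(** Coordinates of the class of the walk s from i0. They are meaningful for length at most N only,
    as [insub_bseq] replaces longer sequences by a default; hence the bounds on lengths below. *)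
Let kas (s : seq V) (b : W) : k := ka (insub_bseq N s) b.

Lemma insub_bseqK s : (size s <= N)%N -> insub_bseq N s = s :> seq V.
Proof. by move=> sN; rewrite /insub_bseq insubdK. Qed.

Lemma sum_basis (U : zmodType) (F : W -> U) : \sum_(b in S) F b = \sum_p F (e p).
Proof. by rewrite big_enum_val. Qed.

Lemma indep_ord (la : 'I_n -> k) : \sum_p al (la p) * wc (e p) = 0 -> forall p, la p = 0.
Proof.
pose la' (b : W) := \sum_p (e p == b)%:R * la p.
have la'E p : la' (e p) = la p.
  rewrite /la' (bigD1 p) //= eqxx mul1r big1 ?addr0 // => q qp.
  by rewrite (inj_eq enum_val_inj) (negPf qp) mul0r.
move=> la0 p; rewrite -la'E; apply: indep; last exact: enum_valP.
by rewrite sum_basis -[RHS]la0; apply: eq_bigr => q _; rewrite la'E.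
Qed.

Lemma span_seq s : (size s <= N)%N -> wc s = \sum_p al (kas s (e p)) * wc (e p).
Proof. by move=> sN; rewrite -{1}(insub_bseqK sN) span sum_basis. Qed.

Lemma kas_type s p : (size s <= N)%N -> kas s (e p) != 0 ->
  size (e p) = size s /\ c p = last i0 s.
Proof. by move=> sN /ka_type[]; rewrite insub_bseqK. Qed.

(* X describes the right multiplication by the sum of all arrows on the right
   module spanned by the walks of length at most N from i0, modulo the longer
   walks. *)
Definition cyclic_mx : 'M[k]_n :=
  \matrix_(p, q) if (size (e p) < N)%N then kas (rcons (e p) (c q)) (e q) else 0.
Local Notation X := cyclic_mx.

(** Expand s in the basis and append y to each basis walk; independence compares the coordinates.
    Only basis walks ending at y can occur in the result. *)
Lemma kas_rcons s q : (size s < N)%N ->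
  forall y, kas (rcons s y) (e q) = (c q == y)%:R * \sum_p kas s (e p) * X p q.
Proof.
move=> sN y; pose F q := kas (rcons s y) (e q) - (c q == y)%:R * \sum_p kas s (e p) * X p q.
suff /(_ q)/eqP : forall q, F q = 0 by rewrite subr_eq0 => /eqP.
apply: indep_ord.
have sz : (size (rcons s y) <= N)%N by rewrite size_rcons.
under eq_bigr do rewrite rmorphB mulrBl.
rewrite sumrB -span_seq //; apply/eqP; rewrite subr_eq0; apply/eqP.
have rconsE t : wc (rcons t y) = wc t * walk_class k (last i0 t, [:: y]).
  by rewrite -cats1 /walk_class -rmorphM /= pa_walkM eqxx.
rewrite rconsE (span_seq (ltnW sN)) mulr_suml.
transitivity (\sum_p al (kas s (e p)) * wc (rcons (e p) y)).
  apply: eq_bigr => p _; have [->|ks] := eqVneq (kas s (e p)) 0.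
    by rewrite rmorph0 !mul0r.
  by have [_ cp] := kas_type (ltnW sN) ks; rewrite -mulrA rconsE -cp.
transitivity (\sum_p \sum_q al (kas s (e p)) * (al ((c q == y)%:R * X p q) * wc (e q))).
  apply: eq_bigr => p _; rewrite -mulr_sumr; have [->|ks] := eqVneq (kas s (e p)) 0.
    by rewrite rmorph0 !mul0r.
  have [ep _] := kas_type (ltnW sN) ks; congr (_ * _).
  have epN : (size (e p) < N)%N by rewrite ep.
  rewrite span_seq ?size_rcons //; apply: eq_bigr => q' _; congr (al _ * _).
  rewrite mxE epN; case: (c q' =P y) => [->|nq]; first by rewrite mul1r.
  rewrite [RHS]mul0r; apply/eqP; apply: contrapT => /negP/kas_type[]; first by rewrite size_rcons.
  by rewrite last_rcons.
rewrite exchange_big; apply: eq_bigr => q' _.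
rewrite mulr_sumr rmorph_sum mulr_suml; apply: eq_bigr => p _.
by rewrite mulrA -rmorphM mulrCA.
Qed.

Lemma kas_basis p q : kas (e p) (e q) = (p == q)%:R.
Proof.
suff F0 : forall q, kas (e p) (e q) - (p == q)%:R = 0.
  by apply/eqP; rewrite -subr_eq0 F0.
apply: indep_ord; under eq_bigr do rewrite rmorphB mulrBl.
rewrite sumrB -span_seq ?size_bseq // (bigD1 p) //= eqxx rmorph1 mul1r big1 ?addr0 ?subrr //.
by move=> r /negPf; rewrite eq_sym => ->; rewrite rmorph0 raddf0 mul0r.
Qed.

Lemma cyclic_size p q : X p q != 0 -> (size (e p) < N)%N /\ size (e q) = (size (e p)).+1.
Proof.
rewrite mxE; case: ifP => [epN /kas_type[]|]; last by rewrite eqxx.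
  by rewrite size_rcons.
by rewrite size_rcons.
Qed.

Lemma cyclic_adj p q : X p q != 0 -> adj (c p) (c q).
Proof.
move=> Xpq; have [epN _] := cyclic_size Xpq; apply: contraNT Xpq => nadj.
rewrite mxE epN; apply/eqP; move: q nadj => q0 nadj.
have : forall q, kas (rcons (e p) (c q0)) (e q) = 0; last by apply.
apply: indep_ord; rewrite -span_seq ?size_rcons // /walk_class pa_walk_out ?raddf0 //=.
by rewrite rcons_path (negPf nadj) andbF.
Qed.

Lemma kas_step p r y : (size (e p) < N)%N ->
  kas (rcons (e p) y) (e r) = (c r == y)%:R * X p r.
Proof.
move=> epN; rewrite kas_rcons //; congr (_ * _); rewrite (bigD1 p) //= kas_basis eqxx mul1r.
by rewrite big1 ?addr0 // => q /negPf; rewrite eq_sym kas_basis => ->; rewrite mul0r.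
Qed.

(** If [e p] can be prolonged twice within length N, this is [walk_rel] in coordinates. Otherwise
    two steps leave the truncation and every product is 0. *)
Lemma cyclic_rel p q : c p = c q -> \sum_r arrow_sign k (c p) (c r) * X p r * X r q = 0.
Proof.
move=> pq; have [sz|sz] := leqP (size (e p)).+2 N; last first.
  apply: big1 => r _; have [->|/cyclic_size[epN er]] := eqVneq (X p r) 0.
    by rewrite mulr0 mul0r.
  have [->|/cyclic_size[]] := eqVneq (X r q) 0; first by rewrite mulr0.
  by rewrite er ltnNge -ltnS sz.
have Xrel : forall q', \sum_y arrow_sign k (c p) y * kas (rcons (rcons (e p) y) (c p)) (e q') = 0.
  apply: indep_ord; rewrite -[RHS](walk_rel k i0 (e p)).
  under eq_bigr do rewrite rmorph_sum mulr_suml.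
  rewrite exchange_big; apply: eq_bigr => y _.
  have -> : e p ++ [:: y; last i0 (e p)] = rcons (rcons (e p) y) (c p).
    by rewrite -!cats1 -catA.
  rewrite span_seq ?size_rcons // mulr_sumr; apply: eq_bigr => q' _.
  by rewrite rmorphM mulrA.
rewrite -[RHS](Xrel q).
transitivity (\sum_y \sum_r arrow_sign k (c p) y * ((c r == y)%:R * X p r * X r q)).
  rewrite exchange_big; apply: eq_bigr => r _ /=.
  rewrite (bigD1 (c r)) //= eqxx mul1r big1 ?addr0 ?mulrA // => y.
  by rewrite eq_sym => /negPf ->; rewrite !mul0r mulr0.
apply: eq_bigr => y _; rewrite kas_rcons ?size_rcons // pq eqxx mul1r mulr_sumr.
by apply: eq_bigr => r _; rewrite kas_step // ltnW.
Qed.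

(** [quiver_inequality] applies with the class of the trivial walk as generator: a graded
    endomorphism that kills it kills the class of every walk, by induction on the length. *)
Lemma cyclic_dim C :
  (forall a : V -> nat, (2 * \sum_x a x ^ 2 <=
      \sum_x \sum_(y | adj x y) a x * a y + 2 * a i0)%N -> (\sum_x a x <= C)%N) ->
  (n <= C)%N.
Proof.
move=> /(_ (fun x => #|[set p | c p == x]|)) bound.
suff ineq : (2 * \sum_x #|[set p | c p == x]| ^ 2 <= \sum_x \sum_(y | adj x y)
    #|[set p | c p == x]| * #|[set p | c p == y]| + 2 * #|[set p | c p == i0]|)%N.
  apply: leq_trans (bound ineq); rewrite -[X in (X <= _)%N]card_ord -sum1_card.
  rewrite (partition_big c xpredT) //= leq_eqVlt; apply/orP; left; apply/eqP.
  by apply: eq_bigr => x _; rewrite -sum1_card; apply: eq_bigl => p; rewrite inE.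
apply: (quiver_inequality (@arrow_signN k D) (@arrow_sign_neq0 k D) (@dynkin_adj_sym D)
  cyclic_adj cyclic_rel (g := \row_p kas [::] (e p))) => [p|Y Yc YX gY].
  by rewrite mxE => /kas_type[].
pose K s : 'rV[k]_n := \row_p kas s (e p).
have KY s : (size s <= N)%N -> K s *m Y = 0.
  elim/last_ind: s => [//|s y IH]; rewrite size_rcons => sN.
  apply/rowP => q; rewrite [RHS]mxE mxE.
  transitivity ((c q == y)%:R * (K s *m X *m Y) 0 q).
    rewrite mxE mulr_sumr; apply: eq_bigr => p _; rewrite mxE kas_rcons //.
    have -> : (K s *m X) 0 p = \sum_p' kas s (e p') * X p' p.
      by rewrite mxE; apply: eq_bigr => p' _; rewrite mxE.
    have [->|/Yc ->] := eqVneq (Y p q) 0; first by rewrite !mulr0.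
    by rewrite mulrA.
  by rewrite -mulmxA -YX mulmxA IH ?(ltnW sN) // mul0mx mxE mulr0.
apply/row_matrixP => p; rewrite row0 -(KY (e p)) ?size_bseq // rowE; congr (_ *m _).
by apply/rowP => q; rewrite !mxE kas_basis eqxx eq_sym.
Qed.

End CyclicModule.

(** * Finite dimension and split basic structure of Pi *)

Section PreprojectiveFinite.
Variables (k : fieldType) (D : dynkin).
Local Notation V := (vertex D).
Local Notation adj := (@dynkin_adj D).
Local Notation Pi := (preproj k D).
Local Notation al := (alg_struct Pi).
Local Notation rho := (preproj_relation k D).
Local Notation pi := (quot_pi (principal_ideal rho)).

(** A nonzero walk of length C has nonzero prefixes of all lengths 0, ..., C. A homogeneous basis
    then has an element in each of these C + 1 lengths, but it has at most C elements. *)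
Lemma long_walk_from (x : V) : exists N, forall s, size s = N -> walk_class k (x, s) = 0.
Proof.
have [C CP] := dynkin_bound x; exists C => s sC; apply: contrapT => s_neq0.
have [|S [ka [indep span ka_type]]] := @graded_basis k Pi (C.-bseq V) (nat * V)%type
    (fun b => (size b, last x b)) (fun b => walk_class k (x, bseqval b)).
  by move=> la la0 [d y]; apply: walk_graded.
have := cyclic_dim indep span ka_type CP; apply/negP; rewrite -ltnNge.
have /fin_all_exists[f fP] (d : 'I_C.+1) : exists b, b \in S /\ size (bseqval b) = d.
  have dC : (d <= size s)%N by rewrite sC -ltnS.
  have sz : size (take d s) = d by rewrite size_takel.
  have sd0 : walk_class k (x, take d s) <> 0.
    by move=> sd0; apply: s_neq0; rewrite -(cat_take_drop d s); apply: walk_cat0.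
  have wE : insub_bseq C (take d s) = take d s :> seq V.
    by rewrite insub_bseqK // sz -ltnS.
  apply: contrapT => nex; apply: sd0; rewrite -wE span big1 // => b bS.
  have [->|/ka_type[sb _]] := eqVneq (ka (insub_bseq C (take d s)) b) 0.
    by rewrite rmorph0 mul0r.
  by case: nex; exists b; split=> //; rewrite sb wE sz.
have f_inj : injective f.
  by move=> d d' dd'; apply: val_inj; rewrite /= -(fP d).2 dd' (fP d').2.
rewrite -(card_ord C.+1) -(card_imset predT f_inj) subset_leq_card //.
by apply/subsetP => _ /imsetP[d _ ->]; case: (fP d).
Qed.

Lemma long_walk : exists N, forall (x : V) s, (N <= size s)%N -> walk_class k (x, s) = 0.
Proof.
have /fin_all_exists[N NP] := long_walk_from; exists (\max_x N x) => x s le.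
have Nx : (N x <= size s)%N by apply: leq_trans le; apply: leq_bigmax.
rewrite -(cat_take_drop (N x) s); apply/walk_cat0/NP.
by rewrite size_takel.
Qed.

Lemma pi_expand (f : path_algebra k adj) : exists L : seq (V * seq V),
  pi f = \sum_(p <- L) al (pa_coef f p) * walk_class k p.
Proof.
have [L fL] := pa_finite f; exists (undup L).
rewrite {1}(pa_expand (undup_uniq L) (f := f)) => [|p /fL]; last by rewrite mem_undup.
by rewrite raddf_sum; apply: eq_bigr => p _; apply: rmorphM.
Qed.

Lemma preproj_finite_dim : finite_dim Pi.
Proof.
have [N NP] := long_walk.
pose v (w : V * N.-bseq V) := walk_class k (w.1, bseqval w.2).
(* Only a basis is wanted here, so all walks get the same type. *)
have [|S [ka [indep span _]]] := @graded_basis k Pi (V * N.-bseq V)%type unit (fun=> tt) v.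
  by move=> la la0 []; rewrite -[RHS]la0; apply: eq_bigl.
have sumE (F : V * N.-bseq V -> Pi) : \sum_(b in S) F b = \sum_(i < #|S|) F (enum_val i).
  by rewrite big_enum_val.
have repr_ex (u : Pi) : exists la : 'I_#|S| -> k, u = \sum_i al (la i) * v (enum_val i).
  have walk_ex p : exists la : V * N.-bseq V -> k, walk_class k p = \sum_(b in S) al (la b) * v b.
    have [sN|/ltnW sN] := leqP (size p.2) N.
      exists (ka (p.1, insub_bseq N p.2)); rewrite -span /v insub_bseqK //.
      by case: p sN.
    exists (fun=> 0); rewrite [p]surjective_pairing NP // big1 // => b _.
    by rewrite rmorph0 mul0r.
  have [la laE] := boolp.choice walk_ex.
  have [L] := pi_expand (repr u); rewrite quot_repr => uE.
  exists (fun i => \sum_(p <- L) pa_coef (repr u) p * la p (enum_val i)).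
  rewrite {1}uE -(sumE (fun b => al (\sum_(p <- L) _ * la p b) * v b)).
  under [RHS]eq_bigr do rewrite rmorph_sum mulr_suml.
  rewrite exchange_big; apply: eq_bigr => p _; rewrite laE mulr_sumr.
  by apply: eq_bigr => b _; rewrite rmorphM mulrA.
have [co coE] := boolp.choice repr_ex.
have uniq_co (la mu : 'I_#|S| -> k) : \sum_i al (la i) * v (enum_val i) =
    \sum_i al (mu i) * v (enum_val i) -> la =1 mu.
  move=> lamu i; apply/eqP; rewrite -subr_eq0; apply/eqP.
  pose F b := \sum_(i < #|S|) (enum_val i == b)%:R * (la i - mu i).
  have FE j : F (enum_val j) = la j - mu j.
    rewrite /F (bigD1 j) //= eqxx mul1r big1 ?addr0 // => l lj.
    by rewrite (inj_eq enum_val_inj) (negPf lj) mul0r.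
  rewrite -FE; apply: indep; last exact: enum_valP.
  rewrite sumE; under eq_bigr do rewrite FE rmorphB mulrBl.
  by rewrite sumrB lamu subrr.
exists #|S|, (fun i => v (enum_val i)), (fun i u => co u i); split=> [i c x y|x]; last exact: coE.
apply: (uniq_co (co (al c * x + y)) (fun i => c * co x i + co y i)).
rewrite -coE {1}(coE x) {1}(coE y) mulr_sumr -big_split; apply: eq_bigr => j _.
rewrite -[RHS]/(al (c * co x j + co y j) * v (enum_val j)).
rewrite -[LHS]/(al c * (al (co x j) * v (enum_val j)) + al (co y j) * v (enum_val j)).
by rewrite rmorphD rmorphM mulrDl mulrA.
Qed.

Section Augmentation.
Variable j : V.
Definition augmentation : {pred path_alg k adj} := [pred f | pa_coef f (j, [::]) == 0].
Lemma pa_coef_vertexM (f g : path_algebra k adj) :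
  pa_coef (f * g) (j, [::]) = pa_coef f (j, [::]) * pa_coef g (j, [::]).
Proof. by rewrite /= /pa_conv big_ord1. Qed.
Fact augmentation_zmod : zmod_closed augmentation.
Proof.
split=> [|f g]; rewrite !inE /= ?eqxx // => /eqP f0 /eqP g0.
by rewrite f0 g0 subr0.
Qed.
Fact augmentation_Ml f g : g \in augmentation -> f * g \in augmentation.
Proof. by rewrite !inE => /eqP g0; rewrite pa_coef_vertexM g0 mulr0. Qed.
Fact augmentation_Mr f g : g \in augmentation -> g * f \in augmentation.
Proof. by rewrite !inE => /eqP g0; rewrite pa_coef_vertexM g0 mul0r. Qed.
HB.instance Definition _ := GRing.isZmodClosed.Build _ augmentation augmentation_zmod.
HB.instance Definition _ := isIdeal.Build _ augmentation augmentation_Ml augmentation_Mr.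
End Augmentation.

Definition vertex_char (j : V) (u : Pi) : k := pa_coef (repr u) (j, [::]).

(** Two representatives differ by an element of the ideal of the relation. The relation has no
    trivial walk in its support, so this ideal lies in [augmentation j]. *)
Lemma vertex_charE j f : vertex_char j (pi f) = pa_coef f (j, [::]).
Proof.
have /quot_piP/asboolP/(_ (augmentation j)) : pi (repr (pi f)) = pi f by rewrite quot_repr.
rewrite inE /= subr_eq0 => /(_ _)/eqP; apply=> _ ->.
rewrite inE; apply: contrapT => /negP/rho_size //.
Qed.

Lemma pa_coef_expr (f : path_alg k adj) n p : (forall j, pa_coef f (j, [::]) = 0) ->
  pa_coef (f ^+ n : path_algebra k adj) p != 0 -> (n <= size p.2)%N.
Proof.
move=> f0; elim: n p => [//|n IH] p; rewrite exprS => /pa_conv_neq0[i [fi /IH]].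
rewrite size_drop => ni; case: p i fi ni => x [|y s] [|i] /=; rewrite ?f0 ?eqxx //.
by rewrite subSS => _ /leq_trans; apply; apply: leq_subr.
Qed.

(** A representative of u involves no trivial walk, so its N-th power involves only walks of length
    at least N, whose classes are 0 for large N. *)
Lemma vertex_char_nil u : (forall j, vertex_char j u = 0) -> exists n, u ^+ n = 0.
Proof.
move=> u0; have [N NP] := long_walk; exists N.
rewrite -(quot_repr u) -rmorphXn; have [L LE] := pi_expand (repr u ^+ N); apply: etrans LE _.
apply: big1 => p _; have [->|nz] := eqVneq (pa_coef (repr u ^+ N : path_algebra k adj) p) 0.
  by rewrite rmorph0 mul0r.
rewrite [p]surjective_pairing NP ?mulr0 //.
exact: pa_coef_expr nz.
Qed.

Lemma vertex_idemM i j : vertex_idem k i * vertex_idem k j =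
  if i == j then vertex_idem k i else 0 :> Pi.
Proof.
rewrite /vertex_idem -rmorphM /= pa_walkM /=; case: eqP => [->//|_].
exact: raddf0.
Qed.

Lemma vertex_char_lin j c x y :
  vertex_char j (al c * x + y) = c * vertex_char j x + vertex_char j y.
Proof.
have -> : al c * x + y = pi (pa_scalar adj c * repr x + repr y).
  by rewrite rmorphD rmorphM /= !quot_repr.
rewrite vertex_charE -[LHS]/(pa_coef (pa_scalar adj c * repr x) (j, [::]) + vertex_char j y).
by rewrite pa_scalarl.
Qed.

Lemma vertex_charM j x y : vertex_char j (x * y) = vertex_char j x * vertex_char j y.
Proof.
by rewrite -[x in LHS]quot_repr -[y in LHS]quot_repr -rmorphM vertex_charE pa_coef_vertexM.
Qed.

Lemma vertex_char_idem i j : vertex_char i (vertex_idem k j) = (i == j)%:R.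
Proof. by rewrite vertex_charE /= xpair_eqE eqxx !andbT; case: eqP. Qed.

Definition preproj_basic : basic Pi V := Basic vertex_idemM vertex_char_lin vertex_charM
  vertex_char_idem vertex_char_nil.

End PreprojectiveFinite.

Theorem theorem6p10 (T : realType) (D : dynkin) (J : {set vertex D}) :
  exists (A : algebra (fps (complex T))) (e : idem A),
    is_order A /\ models J e.
Proof.
apply: (@finite_dim_models _ D J (preproj_basic (complex T) D)) => //.
exact: preproj_finite_dim.
Qed.
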